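(* Let $v\in\mathcal L(H)\otimes A_s$ be a finite dimensional unitary corepresentation of a Woronowicz algebra $A$. Then the lattice of $C^*$-algebras $A_{ij}:=\mathrm{End}(v^{\otimes[i,j]})$, $0\le i\le j<\infty$, with the inclusions $A_{ij}\subset A_{kl}$, $x\mapsto \mathrm{id}_{H^{\otimes[k,i]}}\otimes x\otimes \mathrm{id}_{H^{\otimes[j,l]}}$ ($k\le i\le j\le l$), together with the canonical traces $\tau_{v^{\otimes[i,j]}}$ and with the Jones projections given for every $k\ge 1$ by $$e_{2k}:=d(v)^{-1}\,i_v\,p_{\hat v}\in \mathrm{End}(v\otimes\hat v)=A_{2k-2,2k},\qquad e_{2k+1}:=d(v)^{-1}\,i_{\hat v}\,p_v\in \mathrm{End}(\hat v\otimes v)=A_{2k-1,2k+1},$$ is a Popa $\lambda$-system with $\lambda=d(v)^{-2}$.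
   Context: **Woronowicz algebras.** Consider pairs $(A,u)$, $A$ a unital $C^*$-algebra and $u\in M_n(A)$ unitary, with: (w1) the coefficients of $u$ generate a dense $*$-subalgebra $A_s\subset A$; (w2) there is a $C^*$-morphism $\delta:A\to A\otimes_{\min}A$ with $\delta(u_{ij})=\sum_k u_{ik}\otimes u_{kj}$; (w3) there is a linear antimultiplicative map $\kappa:A_s\to A_s$ with $\kappa(\kappa(a^* )^* )=a$ for all $a\in A_s$ and $(\mathrm{id}\otimes\kappa)u=u^{-1}$. Woronowicz algebras are the inductive limits of such pairs (morphisms: $C^*$-morphisms commuting with $\delta$); as only one corepresentation is considered, they may be supposed to come from a pair $(A,u)$ satisfying (w1), (w2) and (w3). $A_s$ is a Hopf $*$-algebra (comultiplication $\delta$, antipode $\kappa$, counit $u_{ij}\mapsto\delta_{ij}$). A finite dimensional unitary corepresentation on a finite dimensional Hilbert space $H$ is a unitary $v\in\mathcal L(H)\otimes A_s$ with $(\mathrm{id}\otimes\delta)v=v_{12}v_{13}$. $\mathrm{Hom}(v,w)=\{T: (T\otimes1)v=w(T\otimes 1)\}$, $\mathrm{End}(v)=\mathrm{Hom}(v,v)$, $v\otimes w=v_{13}w_{23}$. **Modular data.** $h$ is the Haar measure (the unique bi-invariant state on $A$). With $f*a=(\mathrm{id}\otimes f)\delta(a)$, $a*f=(f\otimes\mathrm{id})\delta(a)$, $f*g=(f\otimes g)\delta$, let $\{f_z\}_{z\in\mathbb C}$ be Woronowicz's canonical family of characters of $A_s$: the unique one, entire of exponential growth on the right half-plane in $z$,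 with $f_z*f_{z'}=f_{z+z'}$, $f_0=$ counit, $f_z\kappa(a)=f_{-z}(a)$, $f_z(a^* )=\overline{f_{-\bar z}(a)}$, $\kappa^2(a)=f_{-1}*a*f_1$, $h(ab)=h(b(f_1*a*f_1))$. Put $Q_v=(\mathrm{id}\otimes f_{1/2})v\in\mathcal L(H)$ (a positive invertible operator), $d(v)=\mathrm{Tr}(Q_v^2)=\mathrm{Tr}(Q_v^{-2})$ (quantum dimension), $\tau_v(x)=d(v)^{-1}\mathrm{Tr}(Q_v^2x)$ on $\mathrm{End}(v)$ (canonical trace), $\hat v=Q_v^t\,\bar v\,(Q_v^t)^{-1}$ (canonical dual, a unitary corepresentation on $\bar H$), where $\bar v$ is the complex conjugate of $v$ and $a\mapsto a^t$ is the transposition $\mathcal L(H)\to\mathcal L(\bar H)$. Identify $\bar{\bar H}=H$, $\overline{H\otimes K}=\bar K\otimes\bar H$. Let $\xi:\mathcal L(H)\simeq H\otimes\bar H$ be the canonical linear map (rank one operator $x\mapsto\langle x,b\rangle a$ goes to $a\otimes\bar b$). Define $i_v\in\mathcal L(\mathbb C,H\otimes\bar H)$ by $1\mapsto\xi(Q_v)$ and $p_v:=i_{\hat v}^*$ (one has $\hat{\hat v}=v$, so $p_{\hat v}=i_v^*$). **Words.** For integers $0\le i\le j$, $[i,j]$ is the word whose letters in positions $i+1,\dots,j$ are $\alpha$ at odd positions and $\beta$ at even positions (so $[2,6]=\alpha\beta\alpha\beta$, $[1,4]=\beta\alpha\beta$, $[i,i]=$ empty word). $v^{\otimes[i,j]}$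 (resp. $H^{\otimes[i,j]}$) is the tensor product obtained by replacing $\alpha$ by $v$ (resp. $H$), $\beta$ by $\hat v$ (resp. $\bar H$); the empty word gives $1$ (resp. $\mathbb C$). **Popa system.** A Popa $\lambda$-system (standard $\lambda$-lattice) is a system of finite dimensional $C^*$-algebras $(A_{ij})_{0\le i\le j<\infty}$ with $A_{ii}=\mathbb C$, unital inclusions $A_{ij}\subset A_{kl}$ for $k\le i$, $j\le l$, a faithful (normalized) trace $\tau$ on $\bigcup A_{ij}$, and projections $(e_k)_{k\ge2}$ such that ($E_B$ = $\tau$-preserving conditional expectation onto $B$): - Commuting squares: $E_{A_{ij}}E_{A_{kl}}=E_{A_{kl}}E_{A_{ij}}=E_{A_{rs}}$, $r=\max\{i,k\}$, $s=\min\{j,l\}$ ($A_{rs}$ read as $\mathbb C$ if $r>s$). - Jones conditions: $e_ke_{k\pm1}e_k=\lambda e_k$, $[e_k,e_l]=0$ for $|k-l|\ge2$; $e_j\in A_{i-2,k}$ for $2\le i\le j\le k$; $e_{j+1}xe_{j+1}=E_{A_{i,j-1}}(x)e_{j+1}$ for $i\le j-1$, $x\in A_{ij}$; $e_{i+1}xe_{i+1}=E_{A_{i+1,j}}(x)e_{i+1}$ for $1\le i$, $i+1\le j$, $x\in A_{ij}$. - Markov conditions: $\lambda^{-1}E_{A_{i,j+1}}(xe_{j+2})e_{j+2}=xe_{j+2}$ for $j\ge i$, $x\in A_{i,j+2}$; $\lambda^{-1}E_{A_{i+1,j}}(xe_{i+2})e_{i+2}=xe_{i+2}$ for $j\ge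 i+2$, $x\in A_{ij}$. - Commutation: $[A_{ij},A_{kl}]=0$ for $i\le j\le k\le l$. *)

(* Defs.v *)
From HB Require Import structures.
From mathcomp Require Import all_boot all_order all_algebra.
From mathcomp Require Import complex.
From mathcomp Require Import all_classical all_reals all_analysis.

Set Implicit Arguments.
Unset Strict Implicit.
Unset Printing Implicit Defensive.

Import Order.TTheory GRing.Theory Num.Theory.
Import numFieldNormedType.Exports.

Local Open Scope classical_set_scope.
Local Open Scope complex_scope.
Local Open Scope ring_scope.

HB.mixin Record isStarAlgebra (R : realType) A & GRing.Algebra R[i] A := {
  star : A -> A;
  starD : forall x y : A, star (x + y) = star x + star y;
  starZ : forall (k : R[i]) (x : A), star (k *: x) = k^* *: star x;
  starM : forall x y : A, star (x * y) = star y * star x;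
  starK : forall x : A, star (star x) = x
}.

#[short(type="starAlgType")]
HB.structure Definition StarAlgebra (R : realType) :=
  {A of GRing.Algebra R[i] A & isStarAlgebra R A}.

Section StarSubalgebras.
Variables (R : realType) (A : starAlgType R).

Record star_subalg (S : set A) : Prop := {
  subalg1 : S 1;
  subalgD : forall x y, S x -> S y -> S (x + y);
  subalgZ : forall (k : R[i]) x, S x -> S (k *: x);
  subalgM : forall x y, S x -> S y -> S (x * y);
  subalg_star : forall x, S x -> S (star x)
}.

Record cstar_norm_on (S : set A) (N : A -> R) : Prop := {
  cnorm_ge0 : forall x, S x -> 0 <= N x;
  cnorm0 : forall x, S x -> N x = 0 -> x = 0;
  cnormD : forall x y, S x -> S y -> N (x + y) <= N x + N y;
  cnormZ : forall (k : R[i]) x, S x -> (N (k *: x))%:C = `|k| * (N x)%:C;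
  cnormM : forall x y, S x -> S y -> N (x * y) <= N x * N y;
  cnorm_star : forall x, S x -> N (star x * x) = N x ^+ 2
}.

(* Completeness is automatic in finite dimension, and a *-algebra has at most
   one norm that makes it a C*-algebra. *)
Record fd_cstar_subalg (S : set A) : Prop := {
  fd_subalg : star_subalg S;
  fd_dim : exists (d : nat) (b : 'I_d -> A),
    forall x, S x -> exists c : 'I_d -> R[i], x = \sum_i c i *: b i;
  fd_norm : exists N : A -> R, cstar_norm_on S N
}.

Record cond_exp (tr : A -> R[i]) (S B : set A) (E : A -> A) : Prop := {
  ce_range : forall x, S x -> B (E x);
  ce_linear : forall (k : R[i]) x y, S x -> S y -> E (k *: x + y) = k *: E x + E y;
  ce_id : forall b, B b -> E b = b;
  ce_bimod : forall b x b', B b -> S x -> B b' -> E (b * x * b') = b * E x * b';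
  ce_pos : forall x, S x -> exists2 y, B y & E (star x * x) = star y * y;
  ce_trace : forall x, S x -> tr (E x) = tr x
}.

Definition star_gen (n : nat) (u : 'M[A]_n) : set A :=
  [set a | forall S : set A, star_subalg S -> (forall i j, S (u i j)) -> S a].

End StarSubalgebras.

Definition star_morph (R : realType) (A B : starAlgType R) (S : set A)
    (f : A -> B) : Prop :=
  [/\ forall (k : R[i]) x y, S x -> S y -> f (k *: x + y) = k *: f x + f y,
      f 1 = 1,
      forall x y, S x -> S y -> f (x * y) = f x * f y &
      forall x, S x -> f (star x) = star (f x)].

(* The norm is a field of its own because the normed modules of the library
   have no join with its algebras. *)
HB.mixin Record isCStarAlgebra (R : realType) A & StarAlgebra R A := {
  cnorm : A -> R;
  cnorm_cstar : cstar_norm_on [set: A] cnorm;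
  cnorm_complete : forall a : nat -> A,
    (forall eps : R, 0 < eps -> exists N, forall p q, (N <= p)%N -> (N <= q)%N ->
       cnorm (a p - a q) < eps) ->
    exists l : A, forall eps : R, 0 < eps -> exists N, forall p, (N <= p)%N ->
       cnorm (a p - l) < eps
}.

#[short(type="cstarAlgType")]
HB.structure Definition CStarAlgebra (R : realType) :=
  {A of StarAlgebra R A & isCStarAlgebra R A}.

Definition norm_dense (R : realType) (A : cstarAlgType R) (S : set A) : Prop :=
  forall (a : A) (eps : R), 0 < eps -> exists2 b, S b & cnorm (a - b) < eps.

Definition bounded_linear (R : realType) (A B : cstarAlgType R) (f : A -> B) :=
  linear f /\ exists M : R, forall x, cnorm (f x) <= M * cnorm x.

Definition alg_tensor (R : realType) (A B T : cstarAlgType R)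
    (l : A -> T) (r : B -> T) : set T :=
  [set x | exists s : seq (A * B), x = \sum_(p <- s) l p.1 * r p.2].

(* The minimal tensor product: the completion of the algebraic tensor product
   (the span of the a (x) b := l a * r b) for its least C*-norm. *)
Record min_tensor (R : realType) (A B : cstarAlgType R) := MinTensor {
  mt_alg :> cstarAlgType R;
  mt_l : A -> mt_alg;
  mt_r : B -> mt_alg;
  mt_l_morph : star_morph setT mt_l;
  mt_r_morph : star_morph setT mt_r;
  mt_comm : forall a b, mt_l a * mt_r b = mt_r b * mt_l a;
  mt_disjoint : forall (n : nat) (a : 'I_n -> A) (b : 'I_n -> B),
    (forall c : 'I_n -> R[i], \sum_i c i *: a i = 0 -> forall i, c i = 0) ->
    \sum_i mt_l (a i) * mt_r (b i) = 0 -> forall i, b i = 0;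
  mt_dense : norm_dense (alg_tensor mt_l mt_r);
  mt_min : forall N : mt_alg -> R, cstar_norm_on (alg_tensor mt_l mt_r) N ->
    forall x, alg_tensor mt_l mt_r x -> cnorm x <= N x
}.

(* A finite dimensional Hilbert space H is C^n, n = dim H, with its standard
   inner product, and L(H) (x) A is 'M[A]_n. *)
Definition adj (R : realType) (A : starAlgType R) (m n : nat) (v : 'M[A]_(m, n)) :
  'M[A]_(n, m) := \matrix_(i, j) star (v j i).

Definition unitary_mx (R : realType) (A : starAlgType R) (n : nat) (v : 'M[A]_n) :=
  adj v *m v = 1%:M /\ v *m adj v = 1%:M.

Record woronowicz (R : realType) := Woronowicz {
  wo_alg :> cstarAlgType R;
  wo_tensor : min_tensor wo_alg wo_alg;
  wo_n : nat;
  wo_u : 'M[wo_alg]_wo_n;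
  wo_unitary : unitary_mx wo_u;
  wo_dense : norm_dense (star_gen wo_u);
  wo_delta : wo_alg -> wo_tensor;
  wo_delta_morph : star_morph setT wo_delta;
  wo_delta_u : forall i j,
    wo_delta (wo_u i j) =
    \sum_k mt_l wo_tensor (wo_u i k) * mt_r wo_tensor (wo_u k j);
  (* only the restriction of kappa to A_s is meaningful *)
  wo_kappa : wo_alg -> wo_alg;
  wo_kappa_range : forall a, star_gen wo_u a -> star_gen wo_u (wo_kappa a);
  wo_kappa_linear : forall (k : R[i]) a b, star_gen wo_u a -> star_gen wo_u b ->
    wo_kappa (k *: a + b) = k *: wo_kappa a + wo_kappa b;
  wo_kappa_anti : forall a b, star_gen wo_u a -> star_gen wo_u b ->
    wo_kappa (a * b) = wo_kappa b * wo_kappa a;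
  wo_kappa_star : forall a, star_gen wo_u a ->
    wo_kappa (star (wo_kappa (star a))) = a;
  wo_kappa_u : map_mx wo_kappa wo_u *m wo_u = 1%:M /\
               wo_u *m map_mx wo_kappa wo_u = 1%:M
}.

Section Woronowicz.
Variables (R : realType) (G : woronowicz R).

Definition As : set G := star_gen (wo_u G).

Definition tens (a b : G) : wo_tensor G := mt_l (wo_tensor G) a * mt_r (wo_tensor G) b.

(* A chosen finite decomposition of delta a, a \in A_s, in the algebraic tensor
   product of A_s with itself; the convolutions below do not depend on it. *)
Definition sweedler (a : G) : seq (G * G) :=
  xget [::] [set s : seq (G * G) | {in s, forall p, As p.1 /\ As p.2} /\
                     wo_delta a = \sum_(p <- s) tens p.1 p.2].

(* f * a = (id (x) f) delta a,  a * f = (f (x) id) delta a,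
   f * g = (f (x) g) delta *)
Definition conv_fa (f : G -> R[i]) (a : G) : G := \sum_(p <- sweedler a) f p.2 *: p.1.
Definition conv_af (a : G) (f : G -> R[i]) : G := \sum_(p <- sweedler a) f p.1 *: p.2.
Definition conv_fg (f g : G -> R[i]) (a : G) : R[i] :=
  \sum_(p <- sweedler a) f p.1 * g p.2.

(* The slice maps id (x) h and h (x) id on the minimal tensor product are the
   unique bounded linear maps with the given values on elementary tensors. *)
Record haar_state (h : G -> R[i]) : Prop := {
  haar_linear : forall (k : R[i]) a b, h (k *: a + b) = k * h a + h b;
  haar1 : h 1 = 1;
  haar_pos : forall a, 0 <= h (star a * a);
  haar_right : exists2 S : wo_tensor G -> G,
    bounded_linear S /\ (forall a b, S (tens a b) = h b *: a) &
    forall a, S (wo_delta a) = h a *: 1;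
  haar_left : exists2 S : wo_tensor G -> G,
    bounded_linear S /\ (forall a b, S (tens a b) = h a *: b) &
    forall a, S (wo_delta a) = h a *: 1
}.

Record canonical_characters (h : G -> R[i]) (f : R[i] -> G -> R[i]) : Prop := {
  cc_linear : forall z (k : R[i]) a b, As a -> As b ->
    f z (k *: a + b) = k * f z a + f z b;
  cc_mul : forall z a b, As a -> As b -> f z (a * b) = f z a * f z b;
  cc_one : forall z, f z 1 = 1;
  cc_entire : forall a, As a ->
    forall z, derivable ((fun z => f z a) : R[i]^o -> R[i]^o) z 1;
  cc_growth : forall a, As a -> exists M mu : R, forall z, 0 < complex.Re z ->
    `|f z a| <= (M * expR (mu * complex.Re z))%:C;
  cc_conv : forall z z' a, As a -> conv_fg (f z) (f z') a = f (z + z') a;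
  (* f_0 is the counit *)
  cc_counit : forall i j, f 0 (wo_u G i j) = (i == j)%:R;
  cc_kappa : forall z a, As a -> f z (wo_kappa a) = f (- z) a;
  cc_star : forall z a, As a -> f z (star a) = (f (- z^*) a)^*;
  cc_kappa2 : forall a, As a ->
    wo_kappa (wo_kappa a) = conv_af (conv_fa (f (-1)) a) (f 1);
  cc_haar : forall a b, As a -> As b ->
    h (a * b) = h (b * conv_af (conv_fa (f 1) a) (f 1))
}.

Record unitary_corep (N : nat) (v : 'M[G]_N) : Prop := {
  corep_coef : forall i j, As (v i j);
  corep_unitary : unitary_mx v;
  corep_delta : forall i j, wo_delta (v i j) = \sum_k tens (v i k) (v k j)
}.

(* lift_mx T = T (x) 1 *)
Definition lift_mx (M N : nat) (T : 'M[R[i]]_(M, N)) : 'M[G]_(M, N) :=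
  map_mx (fun c => c%:A) T.

Definition Hom (M N : nat) (v : 'M[G]_M) (w : 'M[G]_N) : set 'M[R[i]]_(N, M) :=
  [set T | lift_mx T *m v = w *m lift_mx T].

Definition End (N : nat) (v : 'M[G]_N) : set 'M[R[i]]_N := Hom v v.

Variable f : R[i] -> G -> R[i].

Definition Qmx (N : nat) (v : 'M[G]_N) : 'M[R[i]]_N := map_mx (f 2^-1) v.

Definition qdim (N : nat) (v : 'M[G]_N) : R[i] := \tr (Qmx v *m Qmx v).

Definition qtrace (N : nat) (v : 'M[G]_N) (x : 'M[R[i]]_N) : R[i] :=
  (qdim v)^-1 * \tr (Qmx v *m Qmx v *m x).

(* Operators on the conjugate space are written in the conjugate basis, so that
   L(H) -> L(Hbar), a |-> a^t, is matrix transposition and vbar is (v_ij^* ). *)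
Definition hat (N : nat) (v : 'M[G]_N) : 'M[G]_N :=
  lift_mx (Qmx v)^T *m map_mx star v *m lift_mx (invmx (Qmx v)^T).

End Woronowicz.

Section Words.
Variables (R : realType) (m : nat).

(* H = C^(m+1) is nonzero, and the p-th tensor power of H or Hbar factors has its
   orthonormal basis of elementary tensors indexed by p.-tuple 'I_m.+1. *)
Definition widx (p : nat) : nat := #|{: p.-tuple 'I_m.+1}|.

Definition Lop (p : nat) := 'M[R[i]]_(widx p).

HB.instance Definition _ p := GRing.PzRing.on (Lop p).
HB.instance Definition _ p := GRing.Lmodule.on (Lop p).

Lemma Lop_nonzero1 p : (1 : Lop p) != 0.
Proof.
apply/eqP => /matrixP.
pose k := enum_rank [tuple of nseq p (ord0 : 'I_m.+1)].
by move=> /(_ k k) /eqP; rewrite !mxE eqxx oner_eq0.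
Qed.

HB.instance Definition _ p := GRing.PzSemiRing_isNonZero.Build (Lop p) (Lop_nonzero1 p).
HB.instance Definition _ p := GRing.LSemiModule_isLSemiAlgebra.Build R[i] (Lop p)
  (@scalemxAl _ _ _ _).
HB.instance Definition _ p := GRing.LSemiAlgebra_isSemiAlgebra.Build R[i] (Lop p)
  (fun k => scalemxAr k).

Definition ctr (M N : nat) (x : 'M[R[i]]_(M, N)) : 'M[R[i]]_(N, M) :=
  map_mx Num.conj x^T.

Lemma ctrD p (x y : Lop p) : ctr (x + y) = ctr x + ctr y :> Lop p.
Proof. by rewrite /ctr linearD map_mxD. Qed.
Lemma ctrZ p (k : R[i]) (x : Lop p) : ctr (k *: x) = k^* *: ctr x :> Lop p.
Proof. by rewrite /ctr linearZ map_mxZ. Qed.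
Lemma ctrM p (x y : Lop p) : ctr (x * y) = ctr y * ctr x :> Lop p.
Proof. by rewrite /ctr [x * y]/(x *m y) trmx_mul map_mxM. Qed.
Lemma ctrK p (x : Lop p) : ctr (ctr x) = x :> Lop p.
Proof. by apply/matrixP => i j; rewrite !mxE conjCK. Qed.

HB.instance Definition _ p :=
  isStarAlgebra.Build R (Lop p) (@ctrD p) (@ctrZ p) (@ctrM p) (@ctrK p).

(* id (x) x (x) id on q tensor factors, x acting on the factors a+1, ..., a+p. *)
Definition place (p q a : nat) (x : Lop p) : Lop q :=
  \matrix_(s, t)
    let s' : q.-tuple 'I_m.+1 := enum_val s in
    let t' : q.-tuple 'I_m.+1 := enum_val t in
    let mid (w : q.-tuple 'I_m.+1) : p.-tuple 'I_m.+1 :=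
      [tuple nth ord0 w (a + b)%N | b < p] in
    ((take a s' == take a t') && (drop (a + p) s' == drop (a + p) t'))%:R
    * x (enum_rank (mid s')) (enum_rank (mid t')).

Definition word_incl (i j k l : nat) : Lop (j - i) -> Lop (l - k) := @place _ _ (i - k).

Variables (G : woronowicz R) (f : R[i] -> G -> R[i]) (v : 'M[G]_m.+1).

(* v at the odd positions p >= 1 (the letter alpha), hat v at the even ones *)
Definition letter (p : nat) : 'M[G]_m.+1 := if odd p then v else hat f v.

(* The tensor product over the word [i,j]; v (x) w = v_13 w_23 has the entries
   (v (x) w)_{(a,c),(b,d)} = v_ab w_cd. *)
Definition word_corep (i j : nat) : 'M[G]_(widx (j - i)) :=
  \matrix_(s, t) \prod_(a < j - i)
    letter (i + a.+1) (tnth (enum_val s) a) (tnth (enum_val t) a).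

(* xi maps x to the vector with coordinates x_ab on e_a (x) conj(e_b) *)
Definition ximx (x : 'M[R[i]]_m.+1) : 'M[R[i]]_(widx 2, 1) :=
  \col_s x (tnth (enum_val s) ord0) (tnth (enum_val s) ord_max).

Definition imx (w : 'M[G]_m.+1) : 'M[R[i]]_(widx 2, 1) := ximx (Qmx f w).
Definition pmx (w : 'M[G]_m.+1) : 'M[R[i]]_(1, widx 2) := ctr (imx (hat f w)).

(* For k >= 2 this place is the identity; it only replaces the exponent 2 by
   k - (k - 2). *)
Definition jones (k : nat) : Lop (k - (k - 2)) :=
  place _ 0 ((qdim f v)^-1 *:
    (if odd k then imx (hat f v) *m pmx v else imx v *m pmx (hat f v)) : Lop 2).

End Words.

Section Popa.
Variable R : realType.
(* A i j is a subalgebra of M i j; only the indices i <= j matter. *)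
Variables (lambda : R[i]) (M : nat -> nat -> starAlgType R).
Variables (A : forall i j, set (M i j)).
Arguments A : clear implicits.
Variables (inc : forall i j k l, M i j -> M k l).
Variables (tau : forall i j, M i j -> R[i]).
Variables (e : forall k, M (k - 2) k).

(* The union of the A i j is the increasing union of the A 0 n.  Relations
   between elements of the union are stated in A 0 n for every n that is large
   enough; up, jp and box are the images there of an element of A i j, of e_k
   and of A i j. *)
Definition up n i j (x : M i j) : M 0 n := inc 0 n x.
Definition jp n k : M 0 n := up n (e k).
Definition box n i j : set (M 0 n) :=
  if (i <= j)%N then [set up n x | x in A i j] else [set c%:A | c in [set: R[i]]].
Arguments box : clear implicits.

Record popa_axioms (E : forall n : nat, nat -> nat -> M 0 n -> M 0 n) : Prop := {
  popa_lambda : 0 < lambda;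
  popa_cstar : forall i j, (i <= j)%N -> fd_cstar_subalg (A i j);
  popa_scalar : forall i x, A i i x -> exists c : R[i], x = c%:A;
  popa_incl : forall i j k l, (k <= i <= j)%N -> (j <= l)%N ->
    [/\ forall x, A i j x -> A k l (inc k l x),
        star_morph (A i j) (inc k l) &
        forall x y, A i j x -> A i j y -> inc k l x = inc k l y -> x = y];
  popa_incl_id : forall i j x, (i <= j)%N -> A i j x -> inc i j x = x;
  popa_incl_comp : forall i j k l p q x, (p <= k)%N -> (k <= i <= j)%N ->
    (j <= l <= q)%N -> A i j x -> inc p q (inc k l x) = inc p q x;
  popa_tau_linear : forall i j (k : R[i]) x y, (i <= j)%N -> A i j x -> A i j y ->
    tau (k *: x + y) = k * tau x + tau y;
  popa_tau1 : forall i j, (i <= j)%N -> tau (1 : M i j) = 1;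
  popa_tauM : forall i j x y, (i <= j)%N -> A i j x -> A i j y ->
    tau (x * y) = tau (y * x);
  popa_tau_ge0 : forall i j x, (i <= j)%N -> A i j x -> 0 <= tau (star x * x);
  popa_tau_faithful : forall i j x, (i <= j)%N -> A i j x ->
    tau (star x * x) = 0 -> x = 0;
  popa_tau_incl : forall i j k l x, (k <= i <= j)%N -> (j <= l)%N -> A i j x ->
    tau (inc k l x) = tau x;
  popa_proj : forall k, (2 <= k)%N -> e k * e k = e k /\ star (e k) = e k;
  popa_E : forall n i j, (j <= n)%N ->
    cond_exp (@tau 0 n) (A 0 n) (box n i j) (E n i j);
  popa_square : forall n i j k l x,
    (i <= j <= n)%N -> (k <= l <= n)%N -> A 0 n x ->
    E n i j (E n k l x) = E n (maxn i k) (minn j l) x /\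
    E n k l (E n i j x) = E n (maxn i k) (minn j l) x;
  popa_jones : forall n k, (2 <= k < n)%N ->
    jp n k * jp n k.+1 * jp n k = lambda *: jp n k /\
    jp n k.+1 * jp n k * jp n k.+1 = lambda *: jp n k.+1;
  popa_jones_comm : forall n k l, (2 <= k)%N -> (k + 2 <= l <= n)%N ->
    jp n k * jp n l = jp n l * jp n k;
  popa_jones_mem : forall i j k, (2 <= i <= j)%N -> (j <= k)%N ->
    A (i - 2) k (inc (i - 2) k (e j));
  popa_jones_right : forall n i j x, (i < j < n)%N -> A i j x ->
    jp n j.+1 * up n x * jp n j.+1 = E n i j.-1 (up n x) * jp n j.+1;
  popa_jones_left : forall n i j x, (0 < i < j)%N -> (j <= n)%N -> A i j x ->
    jp n i.+1 * up n x * jp n i.+1 = E n i.+1 j (up n x) * jp n i.+1;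
  popa_markov_right : forall n i j (x : M i (j + 2)),
    (i <= j)%N -> (j + 2 <= n)%N -> A i (j + 2) x ->
    lambda^-1 *: (E n i j.+1 (up n x * jp n (j + 2)) * jp n (j + 2)) =
    up n x * jp n (j + 2);
  popa_markov_left : forall n i j x, (i + 2 <= j <= n)%N -> A i j x ->
    lambda^-1 *: (E n i.+1 j (up n x * jp n (i + 2)) * jp n (i + 2)) =
    up n x * jp n (i + 2);
  popa_commute : forall n i j k l x y, (i <= j)%N -> (j <= k)%N -> (k <= l <= n)%N ->
    A i j x -> A k l y -> up n x * up n y = up n y * up n x
}.

(* The trace-preserving conditional expectation onto a subalgebra is unique. *)
Definition popa_system : Prop := exists E, popa_axioms E.

End Popa.

(* Main.v *)
Require Import Defs.
From mathcomp Require Import all_boot all_order all_algebra.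
From mathcomp Require Import complex.
From mathcomp Require Import all_classical all_reals all_analysis.
From mathcomp Require Import ring zify.

(* For a unitary corepresentation v put F_z = (id (x) f_z) v, so Q_v = F_(1/2).
   From kappa^2(v) = F_1 v F_(-1) one gets the two identities
     vbar F_(-1)^t v^t = F_(-1)^t   and   v^t F_1^t vbar = F_1^t,
   which make hat v unitary and show that slicing an intertwiner of v (x) w with
   F_(-1) on the left factor, or with F_1 on the right factor, gives again an
   intertwiner.  The quasi-invariance of h under the f_z gives
     Tr (F_(-1) y) = Tr (F_1 y)   for y in End v,
   so both slices preserve the canonical trace, and E_(A_ij) is the slice map with
   the weights F_(-1) / d on the letters before i and F_1 / d on those after j.
   A linear identity between slice maps and inclusions only has to be checked on
   simple tensors X_1 (x) ... (x) X_n, where it holds letter by letter; the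
   relations for e_k reduce in this way to computations with the vector xi(Q) on
   two letters. *)

Set Implicit Arguments.
Unset Strict Implicit.
Unset Printing Implicit Defensive.

Import Order.TTheory GRing.Theory Num.Theory.

Local Open Scope classical_set_scope.
Local Open Scope complex_scope.
Local Open Scope ring_scope.

(** * Bilinear maps on the coefficient algebra *)

(** The slices are defined on all matrices, and there the bimodule property, the compositions for
    overlapping intervals and the relations with the e_k hold already. What fails there is whatever
    exchanges the two kinds of weights: preservation of the trace, which has F_1 on every letter,
    and the value of the slice onto an empty interval, which depends on where the word is cut. Only
    on End of the whole word do all these cuts give tau(x) 1; this is what the trace identity is
    for. A second obstacle is that counit and antipode are given on the generators u: they are
    carried over to the coefficients of v through arbitrary decompositions of the coproduct, and
    independence of the choice rests on the disjointness of the two copies of A in the minimal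
    tensor product. Positivity of E is required in the form E(x^* x) = y^* y with y an intertwiner,
    which calls for a square root inside End. Finally lambda = d^(-2): one factor 1/d normalizes
    e_k, the other normalizes the weight, and the weight Q^(-2) sits between two copies of Q, so
    that Q Q^(-2) Q = 1. *)

Section TensorProduct.
Variables (R : realType) (G : woronowicz R).
Local Notation C := (R[i]).
Local Notation As := (As (G := G)).
Local Notation tens := (tens (G := G)).

Lemma As_subalg : star_subalg As.
Proof.
split.
- by move=> S HS _; case: HS.
- by move=> x y Hx Hy S HS Su; case: (HS) => _ HD _ _ _; apply: HD; [apply: Hx|apply: Hy].
- by move=> k x Hx S HS Su; case: (HS) => _ _ HZ _ _; apply: HZ; apply: Hx.
- by move=> x y Hx Hy S HS Su; case: (HS) => _ _ _ HM _; apply: HM; [apply: Hx|apply: Hy].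
- by move=> x Hx S HS Su; case: (HS) => _ _ _ _ H; apply: H; apply: Hx.
Qed.

Lemma As1 : As 1. Proof. by case: As_subalg. Qed.
Lemma AsD x y : As x -> As y -> As (x + y).
Proof. by case: As_subalg => _ H _ _ _; apply: H. Qed.
Lemma AsZ (k : C) x : As x -> As (k *: x).
Proof. by case: As_subalg => _ _ H _ _; apply: H. Qed.
Lemma AsM x y : As x -> As y -> As (x * y).
Proof. by case: As_subalg => _ _ _ H _; apply: H. Qed.
Lemma As_star x : As x -> As (star x).
Proof. by case: As_subalg => _ _ _ _ H; apply: H. Qed.
Lemma As0 : As 0.
Proof. by rewrite -(scale0r (1 : G)); apply: AsZ; apply: As1. Qed.

Lemma As_sum (I : Type) (r : seq I) (P : pred I) (F : I -> G) :
  (forall i, P i -> As (F i)) -> As (\sum_(i <- r | P i) F i).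
Proof. by move=> HF; apply: (big_rec As) => [|i x Pi Hx]; [apply: As0|apply: AsD => //;
  apply: HF]. Qed.

Lemma As_prod (I : Type) (r : seq I) (P : pred I) (F : I -> G) :
  (forall i, P i -> As (F i)) -> As (\prod_(i <- r | P i) F i).
Proof. by move=> HF; apply: (big_rec As) => [|i x Pi Hx]; [apply: As1|apply: AsM => //;
  apply: HF]. Qed.

Lemma As_u i j : As (wo_u G i j).
Proof. by move=> S _; apply. Qed.

Lemma tens_linl (k : C) a b c : tens (k *: a + b) c = k *: tens a c + tens b c.
Proof.
case: (mt_l_morph (wo_tensor G)) => H _ _ _.
by rewrite /tens H // mulrDl scalerAl.
Qed.

Lemma tens_linr (k : C) a b c : tens c (k *: a + b) = k *: tens c a + tens c b.
Proof.
case: (mt_r_morph (wo_tensor G)) => H _ _ _.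
by rewrite /tens H // mulrDr scalerAr.
Qed.

Lemma tensDl a b c : tens (a + b) c = tens a c + tens b c.
Proof. by have := tens_linl 1 a b c; rewrite !scale1r. Qed.
Lemma tens0l a : tens 0 a = 0.
Proof. by apply: (addrI (tens 0 a)); rewrite addr0 -tensDl addr0. Qed.
Lemma tensZl (k : C) a b : tens (k *: a) b = k *: tens a b.
Proof. by rewrite -[k *: a]addr0 tens_linl tens0l addr0. Qed.
Lemma tens_suml (I : Type) (r : seq I) (F : I -> G) b :
  tens (\sum_(i <- r) F i) b = \sum_(i <- r) tens (F i) b.
Proof. by elim: r => [|i r IH]; rewrite ?big_nil ?tens0l // !big_cons tensDl IH. Qed.
Lemma tensM a b c d : tens a b * tens c d = tens (a * c) (b * d).
Proof.
case: (mt_r_morph (wo_tensor G)) => _ _ Hr _.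
case: (mt_l_morph (wo_tensor G)) => _ _ Hl _.
by rewrite /tens Hr // Hl // !mulrA; congr (_ * _); rewrite -!mulrA mt_comm.
Qed.

Lemma tens1 : tens 1 1 = 1.
Proof.
case: (mt_r_morph (wo_tensor G)) => _ Hr _ _.
case: (mt_l_morph (wo_tensor G)) => _ Hl _ _.
by rewrite /tens Hr Hl mulr1.
Qed.

Lemma tens_star a b : star (tens a b) = tens (star a) (star b).
Proof.
case: (mt_r_morph (wo_tensor G)) => _ _ _ Hr.
case: (mt_l_morph (wo_tensor G)) => _ _ _ Hl.
by rewrite /tens starM -Hr // -Hl // mt_comm.
Qed.

(** Bilinearity is asked on [As] only: maps such as [kappa a * b] or [f z b *: a] are controlled
    nowhere else. *)
Record bilinear_As (V : lmodType C) (B : G -> G -> V) : Prop := {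
  bilAs_l : forall (k : C) a b c, As a -> As b -> As c ->
    B (k *: a + b) c = k *: B a c + B b c;
  bilAs_r : forall (k : C) a b c, As a -> As b -> As c ->
    B c (k *: a + b) = k *: B c a + B c b }.

Section Bilinear.
Variables (V : lmodType C) (B : G -> G -> V) (HB : bilinear_As B).

Lemma bilAs0l a : As a -> B 0 a = 0.
Proof.
move=> Ha; have := bilAs_l HB 1 As0 As0 Ha; rewrite !scale1r addr0 => H.
by apply: (addrI (B 0 a)); rewrite addr0 -H.
Qed.

Lemma bilAs0r a : As a -> B a 0 = 0.
Proof.
move=> Ha; have := bilAs_r HB 1 As0 As0 Ha; rewrite !scale1r addr0 => H.
by apply: (addrI (B a 0)); rewrite addr0 -H.
Qed.

Lemma bilAs_suml (I : finType) (k : I -> C) (F : I -> G) b :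
  (forall i, As (F i)) -> As b ->
  B (\sum_i k i *: F i) b = \sum_i k i *: B (F i) b.
Proof.
move=> HF Hb; pose P x y := As x /\ B x b = y.
suff: P (\sum_i k i *: F i) (\sum_i k i *: B (F i) b) by case.
elim/big_rec2: _ => [|i y x _ [Hx <-]]; first by split; [apply: As0|apply: bilAs0l].
by split; [apply: AsD => //; apply: AsZ|rewrite (bilAs_l HB)].
Qed.

(* A linear dependency between the left factors shortens the sum until they are
   independent, and then mt_disjoint applies. *)
Lemma bilAs_eq0 n (a b : 'I_n -> G) : (forall i, As (a i)) -> (forall i, As (b i)) ->
  \sum_i tens (a i) (b i) = 0 -> \sum_i B (a i) (b i) = 0.
Proof.
elim: n a b => [|n IH] a b Ha Hb H; first by rewrite big_ord0.
case: (pselect (forall c : 'I_n.+1 -> C, \sum_i c i *: a i = 0 -> forall i, c i = 0)).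
  move=> indep; have b0 := mt_disjoint indep H.
  by apply: big1 => i _; rewrite b0 bilAs0r.
move=> /existsNP [c /not_implyP [Hc /existsNP [k /eqP ck]]].
pose e i := - (c k)^-1 * c (lift k i).
have ak : a k = \sum_i e i *: a (lift k i).
  move: Hc; rewrite (bigD1_ord k) //= => /eqP; rewrite addr_eq0 => /eqP Hc.
  transitivity ((c k)^-1 *: (c k *: a k)); first by rewrite scalerA mulVf ?scale1r.
  rewrite Hc scalerN scaler_sumr -sumrN; apply: eq_bigr => i _.
  by rewrite scalerA -scaleNr -mulNr.
pose b' i := e i *: b k + b (lift k i).
have Hb' i : As (b' i) by apply: AsD => //; apply: AsZ.
have : \sum_i tens (a (lift k i)) (b' i) = 0.
  under eq_bigr do rewrite /b' tens_linr -tensZl.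
  by rewrite -[RHS]H (bigD1_ord k) //= ak tens_suml big_split /=.
move=> /(IH _ _ (fun i => Ha _) Hb') IHab; rewrite -[RHS]IHab.
rewrite (bigD1_ord k) //= ak bilAs_suml //; under [RHS]eq_bigr do rewrite /b' (bilAs_r HB) //.
by rewrite [RHS]big_split.

Qed.

(** A bilinear map factors through the algebraic tensor product, so it does not see which
    decomposition is used; this frees the convolutions from the choice made in [sweedler]. The
    second sum is appended to the first with opposite signs, which reduces the claim to a vanishing
    sum. *)
Lemma bilAs_eq (s t : seq (G * G)) :
  {in s, forall p, As p.1 /\ As p.2} -> {in t, forall p, As p.1 /\ As p.2} ->
  \sum_(p <- s) tens p.1 p.2 = \sum_(p <- t) tens p.1 p.2 ->
  \sum_(p <- s) B p.1 p.2 = \sum_(p <- t) B p.1 p.2.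
Proof.
move=> Hs Ht Hst.
pose stens := s ++ [seq (- p.1, p.2) | p <- t].
have Hin i : As (tnth (in_tuple stens) i).1 /\ As (tnth (in_tuple stens) i).2.
  have := mem_tnth i (in_tuple stens);
    rewrite mem_cat => /orP [/Hs //|/mapP [p /Ht [p1 p2] ->]].
  by split => //=; rewrite -scaleN1r; apply: AsZ.
have : \sum_(p <- in_tuple stens) tens p.1 p.2 = 0.
  rewrite big_cat big_map Hst /=;
    under [X in _ + X]eq_bigr do rewrite -scaleN1r tensZl scaleN1r.
  by rewrite sumrN subrr.
rewrite big_tuple => /(bilAs_eq0 (fun i => proj1 (Hin i)) (fun i => proj2 (Hin i))).
rewrite -(big_tuple _ _ (in_tuple stens) xpredT (fun p => B p.1 p.2)) big_cat big_map /=.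
have -> : \sum_(j <- t) B (- j.1) j.2 = - \sum_(j <- t) B j.1 j.2.
  rewrite -sumrN !big_seq; apply: eq_bigr => p /Ht [p1 p2].
  by rewrite -[- p.1]addr0 -scaleN1r (bilAs_l HB) ?bilAs0l ?addr0 ?scaleN1r //; apply: As0.
by move=> /eqP; rewrite subr_eq0 => /eqP.
Qed.

End Bilinear.
End TensorProduct.

(** * Antipode *)

Section StarLemmas.
Variables (R : realType) (A : starAlgType R).

Lemma star1 : star (1 : A) = 1.
Proof. by rewrite -[LHS]mul1r -[X in X * _]starK -starM mul1r starK. Qed.
Lemma star0 : star (0 : A) = 0.
Proof. by apply: (addrI (star 0)); rewrite -starD !addr0. Qed.
Lemma star_sum (I : Type) (r : seq I) (F : I -> A) :
  star (\sum_(i <- r) F i) = \sum_(i <- r) star (F i).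
Proof. by elim: r => [|i r IH]; rewrite ?big_nil ?star0 // !big_cons starD IH. Qed.
Lemma star_scal (k : R[i]) : star (k%:A : A) = k^*%:A.
Proof. by rewrite starZ star1. Qed.
End StarLemmas.

Section Antipode.
Variables (R : realType) (G : woronowicz R).
Variables (h : G -> R[i]) (f : R[i] -> G -> R[i]) (hf : canonical_characters h f).
Local Notation C := (R[i]).
Local Notation As := (As (G := G)).
Local Notation tens := (tens (G := G)).
Local Notation kappa := (@wo_kappa R G).
Local Notation delta := (@wo_delta R G).

Lemma char0 z : f z 0 = 0.
Proof.
have := cc_linear hf z 1 (@As0 R G) (@As0 R G); rewrite scale1r addr0 mul1r => H.
by apply: (addrI (f z 0)); rewrite addr0 -H.
Qed.
Lemma charZ z (k : C) a : As a -> f z (k *: a) = k * f z a.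
Proof. by move=> Ha; rewrite -[k *: a]addr0 (cc_linear hf) ?char0 ?addr0 //; apply: As0. Qed.
Lemma charD z a b : As a -> As b -> f z (a + b) = f z a + f z b.
Proof. by move=> Ha Hb; rewrite -[a]scale1r (cc_linear hf) ?mul1r ?scale1r. Qed.
Lemma char_sum z (I : Type) (r : seq I) (F : I -> G) : (forall i, As (F i)) ->
  f z (\sum_(i <- r) F i) = \sum_(i <- r) f z (F i).
Proof.
move=> HF; elim: r => [|i r IH]; rewrite ?big_nil ?char0 // !big_cons charD ?IH //.
exact: As_sum.
Qed.
Lemma char_prod z (I : Type) (r : seq I) (F : I -> G) : (forall i, As (F i)) ->
  f z (\prod_(i <- r) F i) = \prod_(i <- r) f z (F i).
Proof.
move=> HF; elim: r => [|i r IH]; rewrite ?big_nil ?(cc_one hf) // !big_cons (cc_mul hf) ?IH //.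
exact: As_prod.
Qed.
Lemma char_scal z (k : C) : f z k%:A = k.
Proof. by rewrite charZ ?(cc_one hf) ?mulr1 //; apply: As1. Qed.

Lemma kappa_As a : As a -> As (kappa a). Proof. exact: wo_kappa_range. Qed.
Lemma kappa0 : kappa 0 = 0.
Proof.
have := wo_kappa_linear 1 (@As0 R G) (@As0 R G); rewrite !scale1r addr0 => H.
by apply: (addrI (kappa 0)); rewrite addr0 -H.
Qed.
Lemma kappaZ (k : C) a : As a -> kappa (k *: a) = k *: kappa a.
Proof. by move=> Ha; rewrite -[k *: a]addr0 wo_kappa_linear ?kappa0 ?addr0 //; apply: As0. Qed.
Lemma kappaD a b : As a -> As b -> kappa (a + b) = kappa a + kappa b.
Proof. by move=> Ha Hb; rewrite -[a]scale1r wo_kappa_linear ?scale1r. Qed.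
Lemma kappa_sum (I : Type) (r : seq I) (F : I -> G) : (forall i, As (F i)) ->
  kappa (\sum_(i <- r) F i) = \sum_(i <- r) kappa (F i).
Proof.
move=> HF; elim: r => [|i r IH]; rewrite ?big_nil ?kappa0 // !big_cons kappaD ?IH //.
exact: As_sum.
Qed.
Lemma kappaK a : As a -> star (kappa (star (kappa a))) = a.
Proof.
move=> Ha; have := wo_kappa_star (As_star Ha).
by rewrite starK => ->; rewrite starK.
Qed.
Lemma kappa_inj a b : As a -> As b -> kappa a = kappa b -> a = b.
Proof. by move=> Ha Hb H; rewrite -(kappaK Ha) H kappaK. Qed.
(** The unit is the image of b = [star (kappa (star 1))], and antimultiplicativity applied to b 1
    reads 1 = kappa(1) 1. *)
Lemma kappa1 : kappa 1 = 1.
Proof.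
have Hb : As (star (kappa (star 1))) by apply: As_star; apply: kappa_As; apply: As_star;
  apply: As1.
have Hk := wo_kappa_star (@As1 R G).
by have := wo_kappa_anti Hb (@As1 R G); rewrite mulr1 -/kappa Hk mulr1.
Qed.
Lemma kappa_scal (k : C) : kappa k%:A = k%:A.
Proof. by rewrite kappaZ ?kappa1 //; apply: As1. Qed.

Lemma deltaD a b : delta (a + b) = delta a + delta b.
Proof. by case: (wo_delta_morph G) => H _ _ _; rewrite -[a]scale1r H // !scale1r. Qed.
Lemma delta0 : delta 0 = 0.
Proof. by apply: (addrI (delta 0)); rewrite -deltaD !addr0. Qed.
Lemma deltaZ (k : C) a : delta (k *: a) = k *: delta a.
Proof. by case: (wo_delta_morph G) => H _ _ _; rewrite -[k *: a]addr0 H // delta0 addr0. Qed.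
Lemma delta1 : delta 1 = 1. Proof. by case: (wo_delta_morph G). Qed.
Lemma deltaM a b : delta (a * b) = delta a * delta b.
Proof. by case: (wo_delta_morph G) => _ _ H _; apply: H. Qed.
Lemma delta_star a : delta (star a) = star (delta a).
Proof. by case: (wo_delta_morph G) => _ _ _ H; apply: H. Qed.
Lemma delta_sum (I : Type) (r : seq I) (F : I -> G) :
  delta (\sum_(i <- r) F i) = \sum_(i <- r) delta (F i).
Proof. by elim: r => [|i r IH]; rewrite ?big_nil ?delta0 // !big_cons deltaD IH. Qed.

(* Both antipode identities are carried along: the star of one is the image of
   the other under kappa^-1 = star kappa star. *)
Record hopf_decomp (a : G) (s : seq (G * G)) : Prop := {
  hd_As : {in s, forall p, As p.1 /\ As p.2};
  hd_delta : delta a = \sum_(p <- s) tens p.1 p.2;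
  hd_left : \sum_(p <- s) kappa p.1 * p.2 = (f 0 a)%:A;
  hd_right : \sum_(p <- s) p.1 * kappa p.2 = (f 0 a)%:A }.

Lemma char0_star a : As a -> f 0 (star a) = (f 0 a)^*.
Proof. by move=> Ha; rewrite (cc_star hf) // rmorph0 oppr0. Qed.

Lemma hopf_decomp_star a s : As a -> hopf_decomp a s ->
  hopf_decomp (star a) [seq (star p.1, star p.2) | p <- s].
Proof.
move=> Ha [HA Hd Hl Hr]; split.
- by move=> _ /mapP [p /HA [p1 p2] ->]; split; apply: As_star.
- by rewrite delta_star Hd star_sum big_map; apply: eq_bigr => p _; rewrite tens_star.
- rewrite big_map char0_star // -star_scal -Hr.
  (* [c p] is the preimage of [p.1] under [kappa], so [kappa] sends [p.2 * c p] to [p.1 * kappa p.2]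
     and the claim becomes the other antipode identity for [s]. *)
  pose c (p : G * G) := star (kappa (star p.1)).
  transitivity (star (\sum_(p <- s) p.2 * c p)).
    by rewrite star_sum; apply: eq_bigr => p _; rewrite starM starK.
  congr star; apply: kappa_inj.
  + rewrite big_seq; apply: As_sum => p /HA [p1 p2]; apply: AsM => //.
    by apply: As_star; apply: kappa_As; apply: As_star.
  + by rewrite Hr; apply: AsZ; apply: As1.
  rewrite Hr kappa_scal -Hr.
  elim: s HA {Hd Hl Hr} => [|p s IH] HA; first by rewrite !big_nil kappa0.
  have [p1 p2] := HA p (mem_head _ _).
  have cp : As (c p) by apply: As_star; apply: kappa_As; apply: As_star.
  have HA' : {in s, forall p, As p.1 /\ As p.2} by move=> q qs; apply: HA; rewrite inE qs orbT.
  rewrite !big_cons kappaD ?IH ?wo_kappa_anti //; last 1 first.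
  + rewrite big_seq; apply: As_sum => q /HA' [q1 q2]; apply: AsM => //.
    by apply: As_star; apply: kappa_As; apply: As_star.
  + by rewrite wo_kappa_star.
  + exact: AsM.
- rewrite big_map char0_star // -star_scal -Hl.
  pose c (p : G * G) := star (kappa (star p.2)).
  transitivity (star (\sum_(p <- s) c p * p.1)).
    by rewrite star_sum; apply: eq_bigr => p _; rewrite starM starK.
  congr star; apply: kappa_inj.
  + rewrite big_seq; apply: As_sum => p /HA [p1 p2]; apply: AsM => //.
    by apply: As_star; apply: kappa_As; apply: As_star.
  + by rewrite Hl; apply: AsZ; apply: As1.
  rewrite Hl kappa_scal -Hl.
  elim: s HA {Hd Hl Hr} => [|p s IH] HA; first by rewrite !big_nil kappa0.
  have [p1 p2] := HA p (mem_head _ _).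
  have cp : As (c p) by apply: As_star; apply: kappa_As; apply: As_star.
  have HA' : {in s, forall p, As p.1 /\ As p.2} by move=> q qs; apply: HA; rewrite inE qs orbT.
  rewrite !big_cons kappaD ?IH ?wo_kappa_anti //; last 1 first.
  + rewrite big_seq; apply: As_sum => q /HA' [q1 q2]; apply: AsM => //.
    by apply: As_star; apply: kappa_As; apply: As_star.
  + by rewrite wo_kappa_star.
  + exact: AsM.
Qed.

(** Since [kappa] reverses products, the antipode sum of one factor sits inside that of the other;
    being a scalar, it comes out. *)
Lemma hopf_decompM a b s t : As a -> As b -> hopf_decomp a s -> hopf_decomp b t ->
  hopf_decomp (a * b) [seq (p.1 * q.1, p.2 * q.2) | p <- s, q <- t].
Proof.
move=> Ha Hb [sA sd sl sr] [tA td tl tr]; split.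
- by move=> _ /allpairsP [[p q] /= [/sA [p1 p2] /tA [q1 q2] ->]]; split; apply: AsM.
- rewrite deltaM sd td big_allpairs_dep mulr_suml; apply: eq_bigr => p _ /=.
  by rewrite mulr_sumr; apply: eq_bigr => q _; rewrite tensM.
- rewrite big_allpairs_dep exchange_big /= (cc_mul hf) // -[RHS]scalerA -tl scaler_sumr.
  rewrite [LHS]big_seq [RHS]big_seq; apply: eq_bigr => q /tA [q1 q2].
  transitivity (kappa q.1 * (\sum_(p <- s) kappa p.1 * p.2) * q.2); last first.
    by rewrite sl mulr_algr scalerAl.
  rewrite mulr_sumr mulr_suml [LHS]big_seq [RHS]big_seq; apply: eq_bigr => p /sA [p1 p2].
  by rewrite wo_kappa_anti // !mulrA.
- rewrite big_allpairs_dep /= (cc_mul hf) // [in RHS]mulrC -[RHS]scalerA -sr scaler_sumr.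
  rewrite [LHS]big_seq [RHS]big_seq; apply: eq_bigr => p /sA [p1 p2].
  transitivity (p.1 * (\sum_(q <- t) q.1 * kappa q.2) * kappa p.2); last first.
    by rewrite tr mulr_algr scalerAl.
  rewrite mulr_sumr mulr_suml [LHS]big_seq [RHS]big_seq; apply: eq_bigr => q /tA [q1 q2].
  by rewrite wo_kappa_anti // !mulrA.
Qed.

(** [As] is the intersection of all star-subalgebras containing the entries of [wo_u G], so it
    suffices that the elements with a decomposition form such a subalgebra. On the generators the
    two identities are [wo_kappa_u], and [cc_counit] identifies the scalar. *)
Lemma hopf_decomp_exists a : As a -> exists s, hopf_decomp a s.
Proof.
pose S : set G := [set a | As a /\ exists s, hopf_decomp a s].
suff HS : star_subalg S /\ forall i j, S (wo_u G i j).
  by case: HS => HS Hu Ha; case: (Ha S HS Hu).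
split; first split.
- split; first exact: As1.
  exists [:: (1, 1)]; split.
  + by move=> _ /[!inE] /eqP -> /=; split; apply: As1.
  + by rewrite big_seq1 tens1 delta1.
  + by rewrite big_seq1 kappa1 mulr1 (cc_one hf) scale1r.
  + by rewrite big_seq1 kappa1 mulr1 (cc_one hf) scale1r.
- move=> x y [Hx [s [sA sd sl sr]]] [Hy [t [tA td tl tr]]]; split; first exact: AsD.
  exists (s ++ t); split.
  + by move=> p; rewrite mem_cat => /orP [/sA|/tA].
  + by rewrite big_cat -sd -td deltaD.
  + by rewrite big_cat sl tl charD // scalerDl.
  + by rewrite big_cat sr tr charD // scalerDl.
- move=> k x [Hx [s [sA sd sl sr]]]; split; first exact: AsZ.
  exists [seq (k *: p.1, p.2) | p <- s]; split.
  + by move=> _ /mapP [p /sA [p1 p2] ->]; split => //; apply: AsZ.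
  + rewrite deltaZ sd big_map scaler_sumr; apply: eq_bigr => p _; exact: esym (tensZl _ _ _).
  + rewrite big_map charZ // -scalerA -sl scaler_sumr [LHS]big_seq [RHS]big_seq.
    by apply: eq_bigr => p /sA [p1 p2]; rewrite kappaZ // scalerAl.
  + rewrite big_map charZ // -scalerA -sr scaler_sumr.
    by apply: eq_bigr => p _; rewrite scalerAl.
- move=> x y [Hx [s Hs]] [Hy [t Ht]]; split; first exact: AsM.
  by eexists; apply: hopf_decompM Hs Ht.
- move=> x [Hx [s Hs]]; split; first exact: As_star.
  by eexists; apply: hopf_decomp_star Hs.
move=> i j; split; first exact: As_u.
exists [seq (wo_u G i k, wo_u G k j) | k <- index_enum _]; split.
+ by move=> _ /mapP [k _ ->]; split; apply: As_u.
+ by rewrite wo_delta_u big_map.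
+ have [/matrixP /(_ i j)] := wo_kappa_u G; rewrite !mxE => H _.
  by rewrite (cc_counit hf) big_map scaler_nat -H; apply: eq_bigr => k _; rewrite !mxE.
+ have [_ /matrixP /(_ i j)] := wo_kappa_u G; rewrite !mxE => H.
  by rewrite (cc_counit hf) big_map scaler_nat -H; apply: eq_bigr => k _; rewrite !mxE.
Qed.

(** The default value in [sweedler] is never met on [As]. *)
Lemma sweedlerP a : As a ->
  {in sweedler a, forall p, As p.1 /\ As p.2} /\
  delta a = \sum_(p <- sweedler a) tens p.1 p.2.
Proof.
move=> /hopf_decomp_exists [s [sA sd _ _]].
exact: (xgetPex [::] (ex_intro (fun s => _ /\ _) s (conj sA sd))).
Qed.

(** Convolutions can now be evaluated with the explicit coproduct of the coefficients of a
    corepresentation. *)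
Lemma sweedler_sum (V : lmodType C) (B : G -> G -> V) (HB : bilinear_As B)
    (I : finType) (a : G) (x y : I -> G) : As a ->
  (forall i, As (x i)) -> (forall i, As (y i)) -> delta a = \sum_i tens (x i) (y i) ->
  \sum_(p <- sweedler a) B p.1 p.2 = \sum_i B (x i) (y i).
Proof.
move=> /sweedlerP [sA sd] Hx Hy Hd.
rewrite (bilAs_eq HB sA (t := [seq (x i, y i) | i <- index_enum I])) ?big_map //.
- by move=> _ /mapP [i _ ->]; split; [apply: Hx|apply: Hy].
- by rewrite -sd Hd.
Qed.

Lemma hopf_sum (I : finType) (a : G) (x y : I -> G) : As a ->
  (forall i, As (x i)) -> (forall i, As (y i)) -> delta a = \sum_i tens (x i) (y i) ->
  \sum_i kappa (x i) * y i = (f 0 a)%:A.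
Proof.
move=> /hopf_decomp_exists [s [sA sd <- _]] Hx Hy Hd.
have HB : bilinear_As (fun a b : G => kappa a * b).
  split=> k p q r Hp Hq Hr; first by rewrite wo_kappa_linear // mulrDl scalerAl.
  by rewrite mulrDr scalerAr.
rewrite (bilAs_eq HB sA (t := [seq (x i, y i) | i <- index_enum I])) ?big_map //.
- by move=> _ /mapP [i _ ->]; split; [apply: Hx|apply: Hy].
- by rewrite -sd Hd.
Qed.

End Antipode.

(** * Corepresentations and their duals *)

Section LiftMatrices.
Variables (R : realType).

(** [lift_mx] over any star-algebra: the coproduct of the dual is computed over [wo_tensor G]. *)
Definition liftA (A : starAlgType R) (m n : nat) (T : 'M[R[i]]_(m, n)) : 'M[A]_(m, n) :=
  map_mx (fun c => c%:A) T.

Section OneAlgebra.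
Variables (A : starAlgType R).
Local Notation lft := (@liftA A _ _).

Lemma liftAM m n p (S : 'M[R[i]]_(m, n)) (T : 'M[R[i]]_(n, p)) :
  lft (S *m T) = lft S *m lft T.
Proof.
apply/matrixP => i j; rewrite !mxE scaler_suml; apply: eq_bigr => k _.
by rewrite !mxE mulr_algl scalerA.
Qed.
Lemma liftA1 n : lft (1%:M : 'M[R[i]]_n) = 1%:M.
Proof. by apply/matrixP => i j; rewrite !mxE scaler_nat. Qed.

Lemma mul_liftAE m n p (T : 'M[R[i]]_(m, n)) (v : 'M[A]_(n, p)) i j :
  (lft T *m v) i j = \sum_k T i k *: v k j.
Proof. by rewrite !mxE; apply: eq_bigr => k _; rewrite !mxE mulr_algl. Qed.
Lemma mulA_liftE m n p (T : 'M[R[i]]_(n, p)) (v : 'M[A]_(m, n)) i j :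
  (v *m lft T) i j = \sum_k T k j *: v i k.
Proof. by rewrite !mxE; apply: eq_bigr => k _; rewrite !mxE mulr_algr. Qed.

(** Over a noncommutative algebra transposition need not reverse products; it does when one factor
    has scalar entries. *)
Lemma tr_liftMl m n p (T : 'M[R[i]]_(m, n)) (v : 'M[A]_(n, p)) :
  (lft T *m v)^T = v^T *m lft T^T.
Proof.
by apply/matrixP => i j; rewrite mulA_liftE mxE mul_liftAE; apply: eq_bigr => k _;
  rewrite !mxE.
Qed.
Lemma tr_liftMr m n p (T : 'M[R[i]]_(n, p)) (v : 'M[A]_(m, n)) :
  (v *m lft T)^T = lft T^T *m v^T.
Proof.
by apply/matrixP => i j; rewrite mul_liftAE mxE mulA_liftE; apply: eq_bigr => k _;
  rewrite !mxE.
Qed.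

Lemma adjM m n p (x : 'M[A]_(m, n)) (y : 'M[A]_(n, p)) :
  adj (x *m y) = adj y *m adj x.
Proof.
apply/matrixP => i j; rewrite !mxE star_sum; apply: eq_bigr => k _.
by rewrite !mxE starM.
Qed.
Lemma adj_lift m n (T : 'M[R[i]]_(m, n)) : adj (lft T) = lft (ctr T).
Proof. by apply/matrixP => i j; rewrite !mxE star_scal. Qed.
End OneAlgebra.

Section Morphisms.
Variables (A B : starAlgType R) (g : A -> B) (Hg : star_morph setT g).

Lemma morph_mxM m n p (x : 'M[A]_(m, n)) (y : 'M[A]_(n, p)) :
  map_mx g (x *m y) = map_mx g x *m map_mx g y.
Proof.
case: Hg => gl _ gM _.
have gD a b : g (a + b) = g a + g b by rewrite -[a]scale1r gl // !scale1r.
have g0 : g 0 = 0 by apply: (addrI (g 0)); rewrite -gD !addr0.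
apply/matrixP => i j; rewrite !mxE (big_morph g gD g0); apply: eq_bigr => k _.
by rewrite gM // !mxE.
Qed.
Lemma morph_lift m n (T : 'M[R[i]]_(m, n)) : map_mx g (liftA A T) = liftA B T.
Proof.
case: Hg => gl g1 _ _.
have gD a b : g (a + b) = g a + g b by rewrite -[a]scale1r gl // !scale1r.
have g0 : g 0 = 0 by apply: (addrI (g 0)); rewrite -gD !addr0.
by apply/matrixP => i j; rewrite !mxE -[_%:A]addr0 gl // g1 g0 addr0.
Qed.
End Morphisms.
End LiftMatrices.

Section Coreps.
Variables (R : realType) (G : woronowicz R).
Variables (h : G -> R[i]) (f : R[i] -> G -> R[i]) (hf : canonical_characters h f).
Local Notation C := (R[i]).
Local Notation As := (As (G := G)).
Local Notation tens := (tens (G := G)).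
Local Notation kappa := (@wo_kappa R G).
Local Notation delta := (@wo_delta R G).
Local Notation lft := (@lift_mx R G _ _).

(* F_z = (id (x) f_z) v *)
Definition Fmx z n (v : 'M[G]_n) : 'M[C]_n := map_mx (f z) v.

Lemma char_mxM z m n p (x : 'M[G]_(m, n)) (y : 'M[G]_(n, p)) :
  (forall i j, As (x i j)) -> (forall i j, As (y i j)) ->
  map_mx (f z) (x *m y) = map_mx (f z) x *m map_mx (f z) y.
Proof.
move=> Hx Hy; apply/matrixP => i j; rewrite !mxE (char_sum hf); last by move=> k; apply: AsM.
by apply: eq_bigr => k _; rewrite (cc_mul hf) // !mxE.
Qed.
Lemma char_lift z m n (T : 'M[C]_(m, n)) : map_mx (f z) (lft T) = T.
Proof. by apply/matrixP => i j; rewrite !mxE (char_scal hf). Qed.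

Section OneCorep.
Variables (n : nat) (v : 'M[G]_n) (hv : unitary_corep v).
Local Notation F z := (Fmx z v).

Let vAs i j : As (v i j) := corep_coef hv i j.

Lemma adj_As i j : As (adj v i j).
Proof. by rewrite mxE; apply: As_star; apply: vAs. Qed.

Lemma Fmx_mul z z' : F z *m F z' = F (z + z').
Proof.
apply/matrixP => i j; rewrite !mxE -(cc_conv hf) //.
have HB : bilinear_As (fun a b : G => f z a * f z' b : C^o).
  split=> k p q r Hp Hq Hr; rewrite (cc_linear hf) //.
    by rewrite mulrDl -mulrA.
  by rewrite mulrDr mulrCA.
rewrite /conv_fg (sweedler_sum hf HB (x := v i) (y := v^~ j)) //.
- by apply: eq_bigr => k _; rewrite !mxE.
- exact: corep_delta.
Qed.

(** [f 0] is given as the counit on the entries of [wo_u] only. For [v], the matrix F_0 is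
    idempotent by [Fmx_mul], and it has a right inverse because [f 0] is multiplicative and [v] is
    unitary. *)
Lemma Fmx0 : F 0 = 1%:M.
Proof.
have F00 : F 0 *m F 0 = F 0 by rewrite Fmx_mul addr0.
have [_ Hu] := corep_unitary hv.
have H1 : F 0 *m map_mx (f 0) (adj v) = 1%:M.
  rewrite -char_mxM ?Hu //; last exact: adj_As.
  by apply/matrixP => i j; rewrite !mxE -(char_scal hf 0 (_%:R)) scaler_nat.
by rewrite -[LHS]mulmx1 -H1 mulmxA F00 H1.
Qed.

Lemma FmxVl z : F (- z) *m F z = 1%:M. Proof. by rewrite Fmx_mul addNr Fmx0. Qed.
Lemma FmxVr z : F z *m F (- z) = 1%:M. Proof. by rewrite Fmx_mul subrr Fmx0. Qed.

(** The values of a character on [adj v] are computed twice: multiplicativity and unitarity make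
    them the inverse of F, and [cc_star] makes them an adjoint of F. *)
Lemma Fmx_ctr z : ctr (F z) = F z^*.
Proof.
have [_ Hu] := corep_unitary hv.
have H1 : F z^* *m map_mx (f z^*) (adj v) = 1%:M.
  rewrite -char_mxM ?Hu //; last exact: adj_As.
  by apply/matrixP => i j; rewrite !mxE -(char_scal hf z^* (_%:R)) scaler_nat.
have H2 : map_mx (f z^*) (adj v) = F (- z^*).
  by rewrite -[LHS]mul1mx -(FmxVl z^*) -mulmxA H1 mulmx1.
have H3 w : map_mx (f w) (adj v) = ctr (F (- w^*)).
  by apply/matrixP => i j; rewrite !mxE (cc_star hf).
have : ctr (F (- z)) = F (- z^*) by rewrite -H2 H3 conjCK.
move=> H4.
rewrite -[LHS]mul1mx -(FmxVr z^*) -mulmxA -H4.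
rewrite /ctr -map_mxM -trmx_mul FmxVr trmx1 map_mx1 mulmx1 //.
Qed.

(** The antipode identity for the coproduct of [v] says kappa(v) v = F_0 = 1, and the inverse of [v]
    is [adj v]. *)
Lemma kappa_corep i j : kappa (v i j) = star (v j i).
Proof.
suff /matrixP /(_ i j) : map_mx kappa v = adj v by rewrite !mxE.
have [_ Hu] := corep_unitary hv.
suff H : map_mx kappa v *m v = 1%:M by rewrite -[LHS]mulmx1 -Hu mulmxA H mul1mx.
apply/matrixP => a b; rewrite !mxE.
have := hopf_sum hf (x := v a) (y := v^~ b) (vAs a b) (vAs a) (vAs ^~ b) (corep_delta hv a b).
have /matrixP /(_ a b) := Fmx0; rewrite !mxE => ->; rewrite scaler_nat => <-.
by apply: eq_bigr => k _; rewrite mxE.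
Qed.

(** [conv_fa] slices the right leg of the coproduct, hence multiplies [v] by F on the right;
    [conv_af] slices the left leg and multiplies on the left. *)
Lemma kappa2_corep : map_mx (fun a => kappa (kappa a)) v = lft (F 1) *m v *m lft (F (-1)).
Proof.
apply/matrixP => i j; rewrite mulA_liftE mxE (cc_kappa2 hf) //.
pose B1 (a b : G) := f (-1) b *: a.
have HB1 : bilinear_As B1.
  split=> k p q r Hp Hq Hr; rewrite /B1; first by rewrite scalerDr !scalerA mulrC.
  by rewrite (cc_linear hf) // scalerDl scalerA.
have -> : conv_fa (f (-1)) (v i j) = \sum_k f (-1) (v k j) *: v i k.
  by rewrite /conv_fa (sweedler_sum hf HB1 (x := v i) (y := v^~ j)) //; apply: corep_delta.
pose B2 (a b : G) := f 1 a *: b.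
have HB2 : bilinear_As B2.
  split=> k p q r Hp Hq Hr; rewrite /B2; last by rewrite scalerDr !scalerA mulrC.
  by rewrite (cc_linear hf) // scalerDl scalerA.
rewrite /conv_af (sweedler_sum hf HB2 (I := ('I_n * 'I_n)%type)
   (x := fun p => f (-1) (v p.1 j) *: v i p.2) (y := fun p => v p.2 p.1)) //.
- rewrite -(pair_bigA _ (fun k l => B2 (f (-1) (v k j) *: v i l) (v l k))) /=.
  apply: eq_bigr => k _; rewrite mul_liftAE scaler_sumr; apply: eq_bigr => l _.
  by rewrite /B2 (charZ hf) // -scalerA !mxE.
- by apply: As_sum => k _; apply: AsZ.
- by move=> p; apply: AsZ.
- rewrite delta_sum -(pair_bigA _ (fun k l => tens (f (-1) (v k j) *: v i l) (v l k))) /=.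
  apply: eq_bigr => k _; rewrite deltaZ (corep_delta hv) scaler_sumr.
  by apply: eq_bigr => l _; rewrite -tensZl.
Qed.

(* Apply kappa to kappa(v) v = 1, respectively to v kappa(v) = 1. *)
Lemma conj_corep_r : map_mx star v *m lft (F (-1))^T *m v^T = lft (F (-1))^T.
Proof.
have H : map_mx star v *m (lft (F 1) *m v *m lft (F (-1)))^T = 1%:M.
  rewrite -kappa2_corep; apply/matrixP => i j.
  have [/matrixP /(_ j i) H _] := corep_unitary hv.
  move: H; rewrite !mxE => H.
  transitivity (kappa (\sum_k adj v j k * v k i)).
    rewrite kappa_sum; last by move=> k; apply: AsM; [exact: adj_As|exact: vAs].
    apply: eq_bigr => k _; rewrite !mxE wo_kappa_anti; [|by apply: As_star;
      apply: vAs|by apply: vAs].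
    by rewrite !kappa_corep.
  by rewrite H eq_sym; case: eqP => _; rewrite ?mulr0n ?mulr1n ?(kappa0) ?kappa1.
move: H; rewrite tr_liftMr tr_liftMl !mulmxA => H.
rewrite -[LHS]mulmx1 -liftA1 -trmx1 -(FmxVl 1) trmx_mul liftAM.
by rewrite !mulmxA H mul1mx.
Qed.

Lemma conj_corep_l : v^T *m lft (F 1)^T *m map_mx star v = lft (F 1)^T.
Proof.
have H : (lft (F 1) *m v *m lft (F (-1)))^T *m map_mx star v = 1%:M.
  rewrite -kappa2_corep; apply/matrixP => i j.
  have [_ /matrixP /(_ j i) H] := corep_unitary hv.
  move: H; rewrite !mxE => H.
  transitivity (kappa (\sum_k v j k * adj v k i)).
    rewrite kappa_sum; last by move=> k; apply: AsM; [exact: vAs|exact: adj_As].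
    apply: eq_bigr => k _; rewrite !mxE wo_kappa_anti; [|by apply: vAs|by apply: As_star;
      apply: vAs].
    by rewrite !kappa_corep.
  by rewrite H eq_sym; case: eqP => _; rewrite ?mulr0n ?mulr1n ?(kappa0) ?kappa1.
move: H; rewrite tr_liftMr tr_liftMl !mulmxA => H.
rewrite -[LHS]mul1mx -liftA1 -trmx1 -(FmxVl 1) trmx_mul liftAM.
by rewrite -!mulmxA; move: H; rewrite -!mulmxA => ->; rewrite mulmx1.
Qed.

End OneCorep.
End Coreps.

Section CtrLemmas.
Variable R : realType.
Local Notation C := (R[i]).

Lemma ctr_mul m n p (x : 'M[C]_(m, n)) (y : 'M[C]_(n, p)) : ctr (x *m y) = ctr y *m ctr x.
Proof. by rewrite /ctr trmx_mul map_mxM. Qed.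
Lemma ctr_K m n (x : 'M[C]_(m, n)) : ctr (ctr x) = x.
Proof. by apply/matrixP => i j; rewrite !mxE conjCK. Qed.
Lemma ctr_tr m n (x : 'M[C]_(m, n)) : ctr x^T = (ctr x)^T.
Proof. by apply/matrixP => i j; rewrite !mxE. Qed.
Lemma ctr1 n : ctr (1%:M : 'M[C]_n) = 1%:M.
Proof. by rewrite /ctr trmx1 map_mx1. Qed.
Lemma mxtrace_ctr n (x : 'M[C]_n) : \tr (ctr x) = (\tr x)^*.
Proof. by rewrite /mxtrace rmorph_sum; apply: eq_bigr => i _; rewrite !mxE. Qed.

Lemma mxtrace_ctr_mul m n (x : 'M[C]_(m, n)) :
  \tr (ctr x *m x) = \sum_i \sum_j `|x j i| ^+ 2.
Proof.
by apply: eq_bigr => i _; rewrite mxE; apply: eq_bigr => j _; rewrite !mxE normCKC.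
Qed.
Lemma mxtrace_ctr_mul_ge0 m n (x : 'M[C]_(m, n)) : 0 <= \tr (ctr x *m x).
Proof. by rewrite mxtrace_ctr_mul; do 2!apply: sumr_ge0 => ? _; rewrite exprn_ge0. Qed.
Lemma mxtrace_ctr_mul_eq0 m n (x : 'M[C]_(m, n)) : \tr (ctr x *m x) = 0 -> x = 0.
Proof.
rewrite mxtrace_ctr_mul => /psumr_eq0P H.
apply/matrixP => i j; rewrite mxE.
have /psumr_eq0P H2 : \sum_j0 `|x j0 j| ^+ 2 = 0.
  by apply: H => // k _; apply: sumr_ge0 => ? _; rewrite exprn_ge0.
by apply/eqP; rewrite -normr_eq0 -sqrf_eq0 H2 // => k _; rewrite exprn_ge0.
Qed.
End CtrLemmas.

(** * The canonical dual and the canonical trace *)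

Section Duals.
Variables (R : realType) (G : woronowicz R).
Variables (h : G -> R[i]) (f : R[i] -> G -> R[i]) (hf : canonical_characters h f).
Variables (n : nat) (v : 'M[G]_n) (hv : unitary_corep v).
Local Notation C := (R[i]).
Local Notation As := (As (G := G)).
Local Notation delta := (@wo_delta R G).
Local Notation F z := (Fmx f z v).
Local Notation Q := (Qmx f v).
Local Notation lft := (@lift_mx R G _ _).

Lemma half_add_half : 2^-1 + 2^-1 = 1 :> C.
Proof. by rewrite -[2^-1]mul1r -splitr. Qed.

Lemma Qmx_sqr : Q *m Q = F 1.
Proof. by rewrite (Fmx_mul hf hv) half_add_half. Qed.
Lemma Fmx_real z : z \is Num.real -> ctr (F z) = F z.
Proof. by move=> /conj_Creal Hz; rewrite (Fmx_ctr hf hv) Hz. Qed.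
Lemma half_real : 2^-1 \is @Num.real C. Proof. by rewrite rpredV; exact: (realn _ 2). Qed.
Lemma Qmx_ctr : ctr Q = Q. Proof. by apply: Fmx_real; apply: half_real. Qed.
Lemma QmxN_ctr : ctr (F (- 2^-1)) = F (- 2^-1).
Proof. by apply: Fmx_real; rewrite rpredN; exact: half_real. Qed.
Lemma QmxVl : F (- 2^-1) *m Q = 1%:M. Proof. exact: (FmxVl hf hv 2^-1). Qed.
Lemma QmxVr : Q *m F (- 2^-1) = 1%:M. Proof. exact: (FmxVr hf hv 2^-1). Qed.
Lemma QmxN_sqr : F (- 2^-1) *m F (- 2^-1) = F (-1).
Proof. by rewrite (Fmx_mul hf hv) -opprD half_add_half. Qed.

Lemma invmx_QT : invmx Q^T = (F (- 2^-1))^T.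
Proof.
have H : Q^T *m (F (- 2^-1))^T = 1%:M by rewrite -trmx_mul QmxVl trmx1.
have [U _] := mulmx1_unit H.
by rewrite -[LHS]mulmx1 -H mulmxA mulVmx // mul1mx.
Qed.

Lemma hatE : hat f v = lft Q^T *m map_mx star v *m lft (F (- 2^-1))^T.
Proof. by rewrite /hat invmx_QT. Qed.

Lemma adj_hat : adj (hat f v) = lft (F (- 2^-1))^T *m v^T *m lft Q^T.
Proof.
rewrite hatE !adjM !(adj_lift G) !ctr_tr Qmx_ctr QmxN_ctr mulmxA; congr (_ *m _ *m _).
by apply/matrixP => i j; rewrite !mxE starK.
Qed.

Lemma hat_unitary : unitary_mx (hat f v).
Proof.
rewrite /unitary_mx adj_hat hatE; split.
- rewrite !mulmxA -[_ *m lft Q^T *m lft Q^T]mulmxA -(liftAM G) -trmx_mul Qmx_sqr.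
  rewrite -!mulmxA [v^T *m _]mulmxA [_ *m (map_mx star v *m _)]mulmxA (conj_corep_l hf hv).
  by rewrite -!(liftAM G) -!trmx_mul -Qmx_sqr mulmxA QmxVl mul1mx QmxVr trmx1 (liftA1 G).
- rewrite !mulmxA -[_ *m lft (F _)^T *m lft (F _)^T]mulmxA -(liftAM G) -trmx_mul QmxN_sqr.
  rewrite -!mulmxA [map_mx star v *m _]mulmxA [_ *m (v^T *m _)]mulmxA (conj_corep_r hf hv).
  by rewrite -!(liftAM G) -!trmx_mul -QmxN_sqr mulmxA QmxVr mul1mx QmxVl trmx1 (liftA1 G).
Qed.

Lemma hat_corep : unitary_corep (hat f v).
Proof.
split; last first.
- pose l := mt_l (wo_tensor G); pose r := mt_r (wo_tensor G).
  have Hl : star_morph setT l := mt_l_morph (wo_tensor G).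
  have Hr : star_morph setT r := mt_r_morph (wo_tensor G).
  have Hd : star_morph setT delta := wo_delta_morph G.
  suff /matrixP H : map_mx delta (hat f v) = map_mx l (hat f v) *m map_mx r (hat f v).
    by move=> i j; move: (H i j); rewrite !mxE => ->; apply: eq_bigr => k _; rewrite !mxE.
  have H : map_mx delta (map_mx star v) = map_mx l (map_mx star v) *m map_mx r (map_mx star v).
    apply/matrixP => i j; rewrite !mxE delta_star (corep_delta hv) star_sum.
    by apply: eq_bigr => k _; rewrite !mxE tens_star.
  rewrite hatE !(morph_mxM Hd, morph_mxM Hl, morph_mxM Hr) H.
  rewrite !(morph_lift Hd, morph_lift Hl, morph_lift Hr) !mulmxA; congr (_ *m _ *m _).
  by rewrite -[RHS]mulmxA -liftAM -trmx_mul QmxVr trmx1 liftA1 mulmx1.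
- exact: hat_unitary.
- move=> i j; rewrite hatE mulA_liftE; apply: As_sum => k _; apply: AsZ.
  rewrite mul_liftAE; apply: As_sum => l _; apply: AsZ; rewrite mxE; apply: As_star.
  exact: corep_coef hv _ _.
Qed.

(** By [cc_star], [f z] sends the conjugate of [v] to the transpose of F_(-z); the outer powers of F
    commute with it and cancel. So duality exchanges F_1 and F_(-1), and the left and right weights
    of neighbouring letters match. *)
Lemma Fmx_hat z : Fmx f z (hat f v) = (F (- z))^T.
Proof.
have vbar_As i j : As (map_mx star v i j).
  by rewrite mxE; apply: As_star; exact: corep_coef hv _ _.
rewrite hatE /Fmx !(char_mxM hf) //; first last.
- by move=> i j; rewrite mxE; apply: AsZ; apply: As1.
- move=> i j; rewrite mul_liftAE; apply: As_sum => k _; exact: AsZ.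
- by move=> i j; rewrite mxE; apply: AsZ; apply: As1.
rewrite !(char_lift hf).
have -> : map_mx (f z) (map_mx star v) = (F (- z))^T.
  have zE : (- z^*)^* = - z :> C.
    exact: (etrans (rmorphN _ _) (congr1 -%R (conjCK z))).
  rewrite -[in RHS]zE -(Fmx_ctr hf hv).
  by apply/matrixP => i j; rewrite !mxE (cc_star hf) //; exact: corep_coef hv _ _.
rewrite -!trmx_mul !(Fmx_mul hf hv); congr (F _)^T.
by rewrite addrCA addNr addr0.
Qed.

Lemma map_star_hat : map_mx star (hat f v) = lft Q *m v *m lft (F (- 2^-1)).
Proof.
have -> : map_mx star (hat f v) = (adj (hat f v))^T by apply/matrixP => i j; rewrite !mxE.
by rewrite adj_hat (tr_liftMr (A := G)) (tr_liftMl (A := G)) !trmxK mulmxA.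
Qed.

(* i_v intertwines the trivial corepresentation with v (x) hat v. *)
Lemma hat_invariant : v *m lft Q *m (hat f v)^T = lft Q.
Proof.
have [_ Hu] := corep_unitary hv.
have -> : (hat f v)^T = lft (F (- 2^-1)) *m adj v *m lft Q.
  rewrite hatE (tr_liftMr (A := G)) (tr_liftMl (A := G)) !trmxK mulmxA; congr (_ *m _ *m _).
  by apply/matrixP => i j; rewrite !mxE.
rewrite !mulmxA -[_ *m lft Q *m lft _]mulmxA -(liftAM G) QmxVr (liftA1 G) mulmx1.
by rewrite Hu mul1mx.
Qed.

Lemma qdimE : qdim f v = \tr (F 1). Proof. by rewrite /qdim Qmx_sqr. Qed.

(** Apply [f z] to the entries of the intertwining relation. Commutation with F_1 is what makes
    [qtrace] tracial on [End v]. *)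
Lemma End_Fmx z y : End v y -> y *m F z = F z *m y.
Proof.
move=> /(congr1 (map_mx (f z))).
have HA i j : As (v i j) by exact: corep_coef hv _ _.
by rewrite !(char_mxM hf) ?(char_lift hf) // => i j; rewrite mxE; apply: AsZ; apply: As1.
Qed.

(* Expand Tr (F_(-1) y) with y = (id (x) h)(v (y (x) 1) v^* ) and move the
   coefficients of v past those of v^* under h. *)
Lemma spherical (hh : haar_state h) y : End v y -> \tr (F (-1) *m y) = \tr (F 1 *m y).
Proof.
move=> Hy.
have hD a b : h (a + b) = h a + h b by rewrite -[a]scale1r (haar_linear hh) mul1r scale1r.
have h0 : h 0 = 0 by apply: (addrI (h 0)); rewrite -hD !addr0.
have hZ k a : h (k *: a) = k * h a by rewrite -[_ *: a]addr0 (haar_linear hh) h0 addr0.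
have h_sum (I : finType) (X : I -> G) : h (\sum_i X i) = \sum_i h (X i).
  exact: (big_morph h hD h0).
have HA i j : As (v i j) by exact: corep_coef hv _ _.
have [Hu1 Hu2] := corep_unitary hv.
have hl (i j : 'I_n) : h ((v *m lft y *m adj v) i j) = y i j.
  have -> : v *m lft y *m adj v = lft y by rewrite -Hy -mulmxA Hu2 mulmx1.
  by rewrite mxE hZ (haar1 hh) mulr1.
pose a i j k l := h (v i k * star (v j l)).
pose b i j k l := h (star (v j l) * v i k).
(* [cc_haar] in coordinates: moving [v i k] behind [star (v j l)] multiplies [v] by F_1 on both
   sides. *)
have ab i j k l : a i j k l = \sum_p \sum_q F 1 i p * F 1 q k * b p j q l.
  rewrite /a (cc_haar hf) //; last exact: As_star.
  pose B1 (a b : G) := f 1 b *: a.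
  have HB1 : bilinear_As B1.
    split=> c p q r Hp Hq Hr; rewrite /B1; first by rewrite scalerDr !scalerA mulrC.
    by rewrite (cc_linear hf) // scalerDl scalerA.
  have -> : conv_fa (f 1) (v i k) = \sum_q f 1 (v q k) *: v i q.
    by rewrite /conv_fa (sweedler_sum hf HB1 (x := v i) (y := v^~ k)) //; apply: corep_delta.
  pose B2 (a b : G) := f 1 a *: b.
  have HB2 : bilinear_As B2.
    split=> c p q r Hp Hq Hr; rewrite /B2; last by rewrite scalerDr !scalerA mulrC.
    by rewrite (cc_linear hf) // scalerDl scalerA.
  rewrite /conv_af (sweedler_sum hf HB2 (I := ('I_n * 'I_n)%type)
     (x := fun s => f 1 (v s.2 k) *: v i s.1) (y := fun s => v s.1 s.2)) //.
  - rewrite mulr_sumr h_sum (pair_bigA _ (fun p q => F 1 i p * F 1 q k * b p j q l)) /=.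
    apply: eq_bigr => s _; rewrite /B2 (charZ hf) // -scalerAr hZ !mxE.
    by rewrite [f 1 (v i _) * _]mulrC.
  - by apply: As_sum => q _; apply: AsZ.
  - by move=> s; apply: AsZ.
  - rewrite delta_sum -(pair_bigA _ (fun p q => tens (f 1 (v q k) *: v i p) (v p q))) /=.
    rewrite exchange_big /=.
    apply: eq_bigr => q _; rewrite deltaZ (corep_delta hv) scaler_sumr.
    by apply: eq_bigr => p _; rewrite -tensZl.
have hb q l : \sum_j b j j q l = (l == q)%:R.
  have /matrixP /(_ l q) := Hu1; rewrite !mxE => H.
  rewrite -h_sum /b /=; transitivity (h ((l == q)%:R)).
    by congr h; rewrite -H; apply: eq_bigr => j _; rewrite mxE.
  by rewrite -[_%:R]scaler_nat hZ (haar1 hh) mulr1.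
have yE i j : y i j = \sum_k \sum_l y k l * a i j k l.
  rewrite -(hl i j) mxE h_sum exchange_big /=; apply: eq_bigr => l _.
  rewrite mulA_liftE mulr_suml h_sum; apply: eq_bigr => k _.
  by rewrite mxE -scalerAl hZ.
transitivity (\sum_k \sum_l \sum_q y k l * F 1 q k * (l == q)%:R); last first.
  rewrite /mxtrace exchange_big /=; apply: eq_bigr => l _; rewrite mxE.
  apply: eq_bigr => k _; rewrite (bigD1 l) //= eqxx mulr1 big1 ?addr0 1?mulrC //.
  by move=> q /negbTE ql; rewrite eq_sym ql mulr0.
transitivity (\sum_i \sum_j \sum_k \sum_l \sum_p \sum_q
   y k l * F 1 q k * ((F (-1) j i * F 1 i p) * b p j q l)).
  rewrite /mxtrace [LHS](eq_bigr (fun j => \sum_i F (-1) j i * y i j)); last by move=> j _;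
    rewrite mxE.
  rewrite exchange_big /=; apply: eq_bigr => i _; apply: eq_bigr => j _.
  rewrite {1}yE mulr_sumr; apply: eq_bigr => k _; rewrite mulr_sumr; apply: eq_bigr => l _.
  rewrite ab !mulr_sumr; apply: eq_bigr => p _; rewrite !mulr_sumr; apply: eq_bigr => q _.
  ring.
under eq_bigr do rewrite exchange_big /=; rewrite exchange_big /=; apply: eq_bigr => k _.
under eq_bigr do rewrite exchange_big /=; rewrite exchange_big /=; apply: eq_bigr => l _.
under eq_bigr do under eq_bigr do rewrite exchange_big /=.
under eq_bigr do rewrite exchange_big /=; rewrite exchange_big /=; apply: eq_bigr => q _.
under eq_bigr do under eq_bigr do rewrite -mulr_sumr.
under eq_bigr do rewrite -mulr_sumr; rewrite -mulr_sumr; congr (_ * _).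
(* [hb] turns the right-hand side into a sum of the [b j j q l]; on the left the sum over i is an
   entry of F_(-1) F_1 = 1, so only p = j survives. *)
rewrite -hb exchange_big /=; apply: eq_bigr => j _.
rewrite exchange_big /= (bigD1 j) //= [X in _ + X]big1 ?addr0.
  rewrite -mulr_suml.
  have /matrixP /(_ j j) := FmxVl hf hv 1; rewrite !mxE eqxx => H.
  by rewrite -[RHS]mul1r -[X in _ = X * _]H; congr (_ * _); apply: eq_bigr => i _;
    rewrite !mxE.
move=> p pj; rewrite -mulr_suml.
have /matrixP /(_ j p) := FmxVl hf hv 1; rewrite !mxE eq_sym (negbTE pj) => H.
by rewrite -[RHS](mul0r (b p j q l)) -[X in _ = X * _]H; congr (_ * _); apply: eq_bigr => i _;
  rewrite !mxE.
Qed.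

(** F_1 = Q Q with Q self-adjoint, so this is the squared Hilbert-Schmidt norm of x Q. *)
Lemma mxtrace_Q_ge0 m (x : 'M[C]_(m, n)) : 0 <= \tr (F 1 *m (ctr x *m x)).
Proof.
rewrite -Qmx_sqr -mulmxA mxtrace_mulC -!mulmxA.
have -> : Q *m (ctr x *m (x *m Q)) = ctr (x *m Q) *m (x *m
  Q) by rewrite ctr_mul Qmx_ctr !mulmxA.
exact: mxtrace_ctr_mul_ge0.
Qed.

Lemma mxtrace_Q_eq0 m (x : 'M[C]_(m, n)) : \tr (F 1 *m (ctr x *m x)) = 0 -> x = 0.
Proof.
rewrite -Qmx_sqr -mulmxA mxtrace_mulC -!mulmxA.
have -> : Q *m (ctr x *m (x *m Q)) = ctr (x *m Q) *m (x *m
  Q) by rewrite ctr_mul Qmx_ctr !mulmxA.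
move=> /mxtrace_ctr_mul_eq0 H; rewrite -[LHS]mulmx1 -QmxVr mulmxA H mul0mx //.
Qed.

Lemma qdim_gt0 : (0 < n)%N -> 0 < qdim f v.
Proof.
move=> n0; rewrite qdimE lt_def -[F 1]mulmx1 -[1%:M]mulmx1 -{1 3}ctr1 mxtrace_Q_ge0 andbT.
apply/eqP => /mxtrace_Q_eq0 /matrixP /(_ (Ordinal n0) (Ordinal n0)) /eqP.
by rewrite !mxE eqxx oner_eq0.
Qed.

Lemma qtraceE y : qtrace f v y = (qdim f v)^-1 * \tr (F 1 *m y).
Proof. by rewrite /qtrace Qmx_sqr. Qed.

Lemma qtraceM x y : End v x -> qtrace f v (x *m y) = qtrace f v (y *m x).
Proof.
by move=> /(End_Fmx 1) H; rewrite !qtraceE; congr (_ * _);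
  rewrite mulmxA -H -mulmxA mxtrace_mulC -mulmxA.
Qed.

Lemma End_ctr x : End v x -> End v (ctr x).
Proof.
have [Hu1 Hu2] := corep_unitary hv.
rewrite /End /Defs.Hom /mkset /= => H.
have H2 : lft (ctr x) *m adj v = adj v *m lft (ctr x).
  by have := congr1 (@adj R G _ _) H; rewrite !adjM !(adj_lift G); exact: esym.
by rewrite -[LHS]mul1mx -Hu2 -!mulmxA [adj v *m _]mulmxA -H2 -!mulmxA Hu1 mulmx1.
Qed.

End Duals.

(** By [Fmx_hat] the Q of [hat f v] is the inverse transpose of the Q of [v], so the second
    conjugation undoes the first. *)
Lemma hatK (R : realType) (G : woronowicz R) (h : G -> R[i]) f (hf : canonical_characters h f)
  n (v : 'M[G]_n) (hv : unitary_corep v) : hat f (hat f v) = v.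
Proof.
rewrite (hatE hf (hat_corep hf hv)) (map_star_hat hf hv) /Qmx -!/(Fmx f _ _).
rewrite !(Fmx_hat hf hv) !trmxK opprK !mulmxA -(liftAM G) (QmxVl hf hv) (liftA1 G) mul1mx.
by rewrite -mulmxA -(liftAM G) (QmxVl hf hv) (liftA1 G) mulmx1.
Qed.

Section EndAlgebra.
Variables (R : realType) (G : woronowicz R) (n : nat) (w : 'M[G]_n).
Lemma lift_mxM m p q (S : 'M[R[i]]_(m, p)) (T : 'M[R[i]]_(p, q)) :
  lift_mx G (S *m T) = lift_mx G S *m lift_mx G T.
Proof. exact: (liftAM G). Qed.
Lemma lift_mx1 m : lift_mx G (1%:M : 'M[R[i]]_m) = 1%:M.
Proof. exact: (liftA1 G). Qed.
Lemma End_mul x y : End w x -> End w y -> End w (x *m y).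
Proof. by rewrite /End /Defs.Hom /mkset /= !lift_mxM => Hx Hy;
  rewrite -mulmxA Hy mulmxA Hx mulmxA. Qed.
Lemma End1 : End w 1%:M.
Proof. by rewrite /End /Defs.Hom /mkset /= lift_mx1 mul1mx mulmx1. Qed.
Lemma End_lin (k : R[i]) x y : End w x -> End w y -> End w (k *: x + y).
Proof.
have E : lift_mx G (k *: x + y) = map_mx (GRing.scale k) (lift_mx G x) + lift_mx G y.
  by apply/matrixP => i j; rewrite !mxE scalerDl scalerA.
rewrite /End /Defs.Hom /mkset E mulmxDl mulmxDr => Hx ->; congr (_ + _).
apply/matrixP => i j; move/matrixP: Hx => /(_ i j); rewrite !mxE => Hx.
under eq_bigr do rewrite mxE -scalerAl; under [RHS]eq_bigr do rewrite mxE -scalerAr.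
by rewrite -!scaler_sumr Hx.
Qed.
End EndAlgebra.

(** * Matrices indexed by words *)

Section Words.
Variable m : nat.
Local Notation I := 'I_m.+1.
Local Notation widx := (widx m).

(** Indices are read as functions on nat, with the irrelevant value [ord0] beyond the length;
    concatenating and shifting words then needs no casts between tuple types. *)
Definition letters n (k : 'I_(widx n)) : nat -> I :=
  let w : n.-tuple I := enum_val k in nth ord0 w.

Definition idx n (s : nat -> I) : 'I_(widx n) := enum_rank [tuple s b | b < n].

Definition glue p (s t : nat -> I) (b : nat) : I := if (b < p)%N then s b else t (b - p)%N.
Definition shiftn (T : Type) p (s : nat -> T) (b : nat) : T := s (p + b)%N.

Lemma lettersK n (k : 'I_(widx n)) : idx n (letters k) = k.
Proof.
apply: (canLR (@enum_valK _)); apply: eq_from_tnth => b.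
by rewrite tnth_mktuple (tnth_nth ord0).
Qed.

Lemma idxK n s b : (b < n)%N -> letters (idx n s) b = s b.
Proof. by move=> bn; rewrite /letters enum_rankK (nth_mktuple _ _ (Ordinal bn)). Qed.

Lemma eq_idx n s t : (forall b, (b < n)%N -> s b = t b) -> idx n s = idx n t.
Proof. by move=> H; congr enum_rank; apply: eq_from_tnth => b; rewrite !tnth_mktuple H. Qed.

Lemma idx_eq n s t : (idx n s == idx n t) = [forall b : 'I_n, s b == t b].
Proof.
apply/eqP/forallP => [H b|H]; first by rewrite -(idxK s (ltn_ord b)) H idxK.
by apply: eq_idx => b bn; apply/eqP; apply: (H (Ordinal bn)).
Qed.

Lemma glue_shiftn p n s : idx n (glue p s (shiftn p s)) = idx n s.
Proof.
by apply: eq_idx => b _; rewrite /glue /shiftn; case: ltnP => // /subnKC ->.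
Qed.

Lemma sum_glue (V : nmodType) p q n (F : 'I_(widx n) -> V) : n = (p + q)%N ->
  \sum_k F k = \sum_(k : 'I_(widx p)) \sum_(l : 'I_(widx q))
    F (idx n (glue p (letters k) (letters l))).
Proof.
move=> nE; rewrite pair_bigA /= (reindex
  (fun k : 'I_(widx n) => (idx p (letters k), idx q (shiftn p (letters k))))) /=.
  apply: eq_bigr => k _; rewrite -[in LHS](lettersK k) -(glue_shiftn p); congr F.
  apply: eq_idx => b bn; rewrite /glue; case: ltnP => bp; rewrite idxK //.
  by rewrite ltn_subLR // -nE.
exists (fun k : 'I_(widx p) * 'I_(widx q) => idx n (glue p (letters k.1) (letters k.2))).
  move=> k _ /=; rewrite -[RHS](lettersK k) -[RHS](glue_shiftn p).
  apply: eq_idx => b bn; rewrite /glue; case: ltnP => bp; rewrite idxK //.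
  by rewrite ltn_subLR // -nE.
move=> [k l] _ /=; congr (_, _).
  rewrite -[RHS]lettersK; apply: eq_idx => b bp.
  by rewrite idxK ?/glue ?bp // nE (leq_trans bp) // leq_addr.
rewrite -[RHS]lettersK; apply: eq_idx => b bq.
by rewrite /shiftn idxK ?nE ?ltn_add2l // /glue ltnNge leq_addr /= addKn.
Qed.

(** Distributivity with the order of the factors kept, so that it also applies to entries in
    [wo_tensor G]. *)
Lemma sum_letters (B : pzSemiRingType) n (g : nat -> I -> B) :
  \sum_(k : 'I_(widx n)) \prod_(b < n) g b (letters k b) = \prod_(b < n) \sum_a g b a.
Proof.
rewrite bigA_distr_bigA /= [RHS](reindex
  (fun k : 'I_(widx n) => [ffun b : 'I_n => letters k b])) /=.
  by apply: eq_bigr => k _; apply: eq_bigr => b _; rewrite ffunE.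
exists (fun w : {ffun 'I_n -> I} => enum_rank [tuple w b | b < n]).
  move=> k _ /=; rewrite -[RHS]lettersK; congr enum_rank.
  by apply: eq_from_tnth => b; rewrite !tnth_mktuple ffunE.
by move=> w _; apply/ffunP => b; rewrite ffunE /letters enum_rankK nth_mktuple.
Qed.

Lemma sum_letters1 (V : nmodType) (F : I -> V) :
  \sum_(k : 'I_(widx 1)) F (letters k 0) = \sum_a F a.
Proof.
rewrite [RHS](reindex (fun k : 'I_(widx 1) => letters k 0)) //.
exists (fun a => idx 1 (fun _ => a)) => [k _|a _]; last by rewrite idxK.
by rewrite -[RHS]lettersK; apply: eq_idx => b; rewrite ltnS leqn0 => /eqP ->.
Qed.

Lemma letters1_eq (k l : 'I_(widx 1)) : (letters k 0 == letters l 0) = (k == l).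
Proof.
rewrite -[in RHS](lettersK k) -[in RHS](lettersK l) idx_eq.
by apply/idP/forallP => [/eqP H b|/(_ ord0)//]; rewrite ord1 /= H.
Qed.

Section SimpleTensors.
Variable B : pzSemiRingType.

(* X_0 (x) ... (x) X_(n-1) *)
Definition stens n (X : nat -> 'M[B]_m.+1) : 'M[B]_(widx n) :=
  \matrix_(k, l) \prod_(b < n) X b (letters k b) (letters l b).

Lemma stensE n X s t : stens n X (idx n s) (idx n t) = \prod_(b < n) X b (s b) (t b).
Proof. by rewrite mxE; apply: eq_bigr => b _; rewrite !idxK. Qed.

Lemma stens1E (X : nat -> 'M[B]_m.+1) k l : stens 1 X k l = X 0 (letters k 0) (letters l 0).
Proof. by rewrite mxE big_ord1. Qed.

Lemma eq_stens n X Y : (forall b, (b < n)%N -> X b = Y b) -> stens n X = stens n Y.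
Proof. by move=> H; apply/matrixP => k l; rewrite !mxE; apply: eq_bigr => b _; rewrite H. Qed.

(** Concatenation keeps the order of the factors, so this holds for words of corepresentations, with
    entries in [G], as well as for operators. *)
Lemma stens_glue p q n X s1 s2 t1 t2 : n = (p + q)%N ->
  stens n X (idx n (glue p s1 s2)) (idx n (glue p t1 t2)) =
  stens p X (idx p s1) (idx p t1) * stens q (shiftn p X) (idx q s2) (idx q t2).
Proof.
move=> nE; rewrite !stensE nE big_split_ord /=; congr (_ * _); apply: eq_bigr => b _.
  by rewrite /glue ltn_ord.
by rewrite /glue /shiftn ltnNge leq_addr /= addKn.
Qed.

Lemma prod_natr_forall n (c : 'I_n -> bool) :
  \prod_(b < n) (c b)%:R = [forall b, c b]%:R :> B.
Proof.
case: forallP => [H|H]; first by apply: big1 => b _; rewrite H.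
have [b /negbTE cb] : exists b, ~~ c b.
  by apply/existsP; rewrite -negb_forall; apply/forallP.
elim: n c H b cb => [|n IH] c H b cb; first by case: b cb.
rewrite big_ord_recl; case: (unliftP ord0 b) => [b'|] bE; last by rewrite -bE cb mul0r.
rewrite bE in cb; rewrite (IH _ _ b' cb) ?mulr0 // => H2.
by have := H2 b'; rewrite cb.
Qed.

Lemma stens1 n : stens n (fun _ => 1%:M) = 1%:M.
Proof.
apply/matrixP => k l; rewrite -(lettersK k) -(lettersK l) stensE mxE idx_eq -prod_natr_forall.
by apply: eq_bigr => b _; rewrite mxE.
Qed.
End SimpleTensors.

Section Commutative.
Variable B : comPzRingType.

(** The interchange law. It moves entries of different letters past each other, so it serves
    operators; words of corepresentations go through [unitary_glue] and [sum_letters] instead. *)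
Lemma stens_mul n (X Y : nat -> 'M[B]_m.+1) :
  stens n X *m stens n Y = stens n (fun b => X b *m Y b).
Proof.
apply/matrixP => k l; rewrite !mxE.
rewrite [RHS](eq_bigr (fun b : 'I_n => \sum_a X b (letters k b) a * Y b a (letters l b)));
  last first.
  by move=> b _; rewrite mxE.
rewrite -(sum_letters n (fun b a => X b (letters k b) a * Y b a (letters l b))).
by apply: eq_bigr => r _; rewrite !mxE big_split.
Qed.

Lemma mxtrace_st n (X : nat -> 'M[B]_m.+1) : \tr (stens n X) = \prod_(b < n) \tr (X b).
Proof.
rewrite -(sum_letters n (fun b a => X b a a)).
by apply: eq_bigr => k _; rewrite mxE.
Qed.

Lemma stens_scale n (c : nat -> B) (X : nat -> 'M[B]_m.+1) :
  stens n (fun b => c b *: X b) = (\prod_(b < n) c b) *: stens n X.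
Proof.
by apply/matrixP => k l; rewrite !mxE -big_split; apply: eq_bigr => b _; rewrite mxE.
Qed.

(** A matrix unit between two words is the simple tensor of the matrix units between their
    letters. *)
Lemma stens_span n (x : 'M[B]_(widx n)) :
  x = \sum_k \sum_l x k l *: stens n (fun b => delta_mx (letters k b) (letters l b)).
Proof.
have H k l : stens n (fun b => delta_mx (letters k b) (letters l b)) = delta_mx k l :> 'M[B]__.
  apply/matrixP => i j; rewrite -(lettersK i) -(lettersK j) stensE mxE.
  rewrite -[in RHS](lettersK k) -[in RHS](lettersK l) !idx_eq.
  transitivity (\prod_(b < n) ((letters i b == letters k b) && (letters j b == letters l
    b))%:R : B).
    by apply: eq_bigr => b _; rewrite mxE.
  rewrite prod_natr_forall; congr (nat_of_bool _)%:R; apply/forallP/andP.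
    by move=> Hb; split; apply/forallP => b; case/andP: (Hb b).
  by move=> [/forallP H1 /forallP H2] b; rewrite H1 H2.
rewrite [LHS]matrix_sum_delta; apply: eq_bigr => k _; apply: eq_bigr => l _.
by rewrite H.
Qed.

Lemma stens_ext n (V : lmodType B) (g1 g2 : 'M[B]_(widx n) -> V) : linear g1 -> linear g2 ->
  (forall X, g1 (stens n X) = g2 (stens n X)) -> forall x, g1 x = g2 x.
Proof.
move=> l1 l2 H x.
have ext (g : 'M[B]_(widx n) -> V) : linear g -> forall (I : Type) (r : seq I) (F : I ->
  'M[B]_(widx n)) c,
    g (\sum_(i <- r) c i *: F i) = \sum_(i <- r) c i *: g (F i).
  move=> lg; have g0 : g 0 = 0.
    by have := lg (-1) 0 0; rewrite scaleN1r oppr0 addr0 scaleN1r addNr.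
  by move=> J r F c; elim: r => [|i r IH]; rewrite ?big_nil // !big_cons lg IH.
have sumD (g : 'M[B]_(widx n) -> V) : linear g -> forall (I : Type) (r : seq I) (F : I ->
  'M[B]_(widx n)),
    g (\sum_(i <- r) F i) = \sum_(i <- r) g (F i).
  move=> lg J r F; have := ext g lg J r F (fun _ => 1).
  by under eq_bigr do rewrite scale1r; under [in RHS]eq_bigr do rewrite scale1r.
rewrite (stens_span x) (sumD _ l1) (sumD _ l2); apply: eq_bigr => k _.
by rewrite (ext _ l1) (ext _ l2); apply: eq_bigr => l _; rewrite H.
Qed.

Section PartialTraces.
Variables (p q n : nat).

(* (Tr (M . ) (x) id) x on p + q letters *)
Definition ptrace_left (M : 'M[B]_(widx p)) (x : 'M[B]_(widx n)) : 'M[B]_(widx q) :=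
  \matrix_(k, l) \sum_a \sum_b M b a *
    x (idx n (glue p (letters a) (letters k))) (idx n (glue p (letters b) (letters l))).

(* (id (x) Tr (M . )) x on p + q letters *)
Definition ptrace_right (M : 'M[B]_(widx q)) (x : 'M[B]_(widx n)) : 'M[B]_(widx p) :=
  \matrix_(k, l) \sum_c \sum_d M d c *
    x (idx n (glue p (letters k) (letters c))) (idx n (glue p (letters l) (letters d))).

Lemma ptrace_left_linear M : linear (ptrace_left M).
Proof.
move=> c x y; apply/matrixP => k l; rewrite !mxE mulr_sumr -big_split.
apply: eq_bigr => a _; rewrite mulr_sumr -big_split; apply: eq_bigr => b _.
by rewrite !mxE mulrDr mulrCA.
Qed.

Lemma ptrace_right_linear M : linear (ptrace_right M).
Proof.
move=> c x y; apply/matrixP => k l; rewrite !mxE mulr_sumr -big_split.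
apply: eq_bigr => a _; rewrite mulr_sumr -big_split; apply: eq_bigr => b _.
by rewrite !mxE mulrDr mulrCA.
Qed.

Lemma ptrace_left_st M X : n = (p + q)%N -> ptrace_left M (stens n X) = \tr (M *m
  stens p X) *: stens q (shiftn p X).
Proof.
move=> nE; apply/matrixP => k l; rewrite !mxE /mxtrace exchange_big mulr_suml.
apply: eq_bigr => a _; rewrite [in RHS]mxE mulr_suml; apply: eq_bigr => b _.
by rewrite (stens_glue _ _ _ _ _ nE) !lettersK !mxE mulrA.
Qed.

Lemma ptrace_right_st M X : n = (p + q)%N -> ptrace_right M (stens n X) = \tr (M *m
  stens q (shiftn p X)) *: stens p X.
Proof.
move=> nE; apply/matrixP => k l; rewrite !mxE /mxtrace exchange_big mulr_suml.
apply: eq_bigr => a _; rewrite [in RHS]mxE mulr_suml; apply: eq_bigr => b _.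
by rewrite (stens_glue _ _ _ _ _ nE) !lettersK !mxE -mulrA; congr (_ * _); rewrite mulrC.
Qed.
End PartialTraces.
End Commutative.
End Words.

Section Linear.
Variable K : comPzRingType.
Lemma lin_comp (U V W : lmodType K) (g1 : V -> W) (g2 : U -> V) :
  linear g1 -> linear g2 -> linear (fun x => g1 (g2 x)).
Proof. by move=> H1 H2 k x y; rewrite H2 H1. Qed.
Lemma lin_id (U : lmodType K) : linear (fun x : U => x).
Proof. by []. Qed.
Lemma lin_mull n p q (A : 'M[K]_(n, p)) : linear (fun x : 'M[K]_(p, q) => A *m x).
Proof. by move=> k x y; rewrite mulmxDr scalemxAr. Qed.
Lemma lin_mulr n p q (A : 'M[K]_(p, q)) : linear (fun x : 'M[K]_(n, p) => x *m A).
Proof. by move=> k x y; rewrite mulmxDl scalemxAl. Qed.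
Lemma lin_scale (U : lmodType K) (c : K) : linear (fun x : U => c *: x).
Proof. by move=> k x y; rewrite scalerDr !scalerA mulrC. Qed.
Lemma lin_trace n : linear (fun x : 'M[K]_n => \tr x : K^o).
Proof. by move=> k x y; rewrite mxtraceD mxtraceZ. Qed.
Lemma lin_scalar n : linear (fun c : K^o => c%:M : 'M[K]_n).
Proof. by move=> k x y; rewrite raddfD /= -scale_scalar_mx. Qed.
End Linear.

(** * Operators placed on a window of consecutive letters *)

Section Place.
Variables (R : realType) (m : nat).
Local Notation C := (R[i]).
Local Notation widx := (widx m).
Local Notation Lop := (Lop R m).

(** Rewrites a product over a window as one over the whole word, so that two sides of an identity
    can be compared position by position. *)
Lemma prod_window (B : comPzSemiRingType) (F : nat -> B) a p q : (a + p <= q)%N ->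
  \prod_(b < p) F (a + b)%N =
  \prod_(b < q) (if (a <= b)%N && (b < a + p)%N then F b else 1).
Proof.
move=> apq.
rewrite -(big_mkord xpredT (fun b => F (a + b)%N)).
rewrite -(big_mkord xpredT (fun b => if (a <= b)%N && (b < a + p)%N then F b else 1)).
rewrite [RHS](big_cat_nat (n := a)) ?(leq_trans (leq_addr _ _) apq) //=.
rewrite [X in _ = _ * X](big_cat_nat (n := (a + p)%N)) ?leq_addr //=.
rewrite [X in _ = X * _]big_nat_cond [X in _ = X * _]big1 ?mul1r; last first.
  by move=> b /andP [/andP [_ ba] _]; rewrite leqNgt ba.
rewrite [X in _ = _ * X]big_nat_cond [X in _ = _ * X]big1 ?mulr1; last first.
  by move=> b /andP [/andP [ba _] _]; rewrite [(b < _)%N]ltnNge ba andbF.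
rewrite -[X in index_iota X (a + p)]add0n big_addn addKn; apply: eq_big_nat => b /andP [_ bp].
by rewrite [(b + a)%N]addnC leq_addr /= ltn_add2l bp.
Qed.

Lemma placeE p q a (x : Lop p) s t : (a + p <= q)%N ->
  place q a x (idx q s) (idx q t) =
  [forall b : 'I_q, ((a <= b)%N && (b < a + p)%N) || (s b == t b)]%:R *
  x (idx p (shiftn a s)) (idx p (shiftn a t)).
Proof.
move=> apq; rewrite mxE /=.
have nthE (u : nat -> 'I_m.+1) b : (b < q)%N ->
    nth ord0 [tuple u b | b < q] b = u b by move=> bq; rewrite (nth_mktuple _ _ (Ordinal bq)).
have midE (u : nat -> 'I_m.+1) :
    enum_rank [tuple nth ord0 (enum_val (idx q u) : q.-tuple _) (a + b) | b < p] =
      idx p (shiftn a u).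
  congr enum_rank; apply: eq_from_tnth => b; rewrite !tnth_mktuple enum_rankK nthE //.
  by rewrite (leq_trans _ apq) // ltn_add2l.
rewrite !midE !enum_rankK; congr (_%:R * _); congr nat_of_bool.
apply/andP/forallP => [[/eqP H1 /eqP H2] b|H]; last first.
  split; apply/eqP.
    apply: (@eq_from_nth _ ord0); rewrite ?size_take_min ?size_tuple // => b.
    rewrite leq_min => /andP [ba bq].
    by rewrite !nth_take // !nthE //; apply/eqP; move: (H (Ordinal bq)); rewrite /= leqNgt ba.
  apply: (@eq_from_nth _ ord0); rewrite ?size_drop ?size_tuple // => b bq.
  rewrite !nth_drop; have bq2 : (a + p + b < q)%N by rewrite -ltn_subRL.
  rewrite !nthE //; apply/eqP; move: (H (Ordinal bq2)).
  by rewrite /= [(_ < a + p)%N]ltnNge leq_addr andbF.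
case: (leqP a b) => ba /=.
  case: (ltnP b (a + p)) => //= ab.
  have := congr1 (fun w => nth ord0 w (b - (a + p))) H2.
  by rewrite !nth_drop subnKC // !nthE // => ->.
have := congr1 (fun w => nth ord0 w b) H1; rewrite !nth_take //.
by rewrite !nthE // => ->.
Qed.

Definition pad a p (X : nat -> 'M[C]_m.+1) (b : nat) : 'M[C]_m.+1 :=
  if (a <= b)%N && (b < a + p)%N then X (b - a)%N else 1%:M.

Lemma place_st p q a X : (a + p <= q)%N -> place q a (stens p X : Lop p) = stens q (pad a p X).
Proof.
move=> apq; apply/matrixP => k l; rewrite -(lettersK k) -(lettersK l).
move: (letters k) (letters l) => s t; rewrite placeE // !stensE -prod_natr_forall.
transitivity (\prod_(b < q) (((a <= b)%N && (b < a + p)%N) || (s b == t b))%:R *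
  \prod_(b < p) X (a + b - a)%N (s (a + b)%N) (t (a + b)%N)).
  by congr (_ * _); apply: eq_bigr => b _; rewrite addKn.
rewrite (prod_window (fun b => X (b - a)%N (s b) (t b)) apq) -big_split.
apply: eq_bigr => b _ /=; rewrite /pad; case: (_ && _); first by rewrite mul1r.
by rewrite mulr1 mxE.
Qed.

Lemma place_linear p q a :
  linear (@place R m p q a : 'M[C]_(widx p) -> 'M[C]_(widx q)).
Proof.
move=> k x y; have E u w : (k *: x + y : Lop p) u w = k * x u w + y u w.
  by rewrite -[LHS]/((k *: (x : 'M[C]_(widx p)) + y) u w) !mxE.
by apply/matrixP => i j; rewrite !mxE /= E mulrDr mulrCA.
Qed.

Lemma placeM p q a (x y : Lop p) : (a + p <= q)%N ->
  place q a (x *m y) = place q a x *m place q a y.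
Proof.
move=> apq.
move: x; apply: stens_ext => [||X].
- exact: lin_comp (@place_linear _ _ _) (lin_mulr _).
- exact: lin_comp (lin_mulr _) (@place_linear _ _ _).
move: y; apply: stens_ext => [||Y].
- exact: lin_comp (@place_linear _ _ _) (lin_mull _).
- exact: lin_comp (lin_mull _) (@place_linear _ _ _).
rewrite stens_mul !place_st // stens_mul; apply: eq_stens => b _.
by rewrite /pad; case: ifP => // _; rewrite mulmx1.
Qed.

Lemma place1 p q a : (a + p <= q)%N -> place q a (1%:M : Lop p) = 1%:M.
Proof.
move=> apq; rewrite -!stens1 place_st //; apply: eq_stens => b _.
by rewrite /pad if_same.
Qed.

Lemma ctrE a b (x : 'M[C]_(a, b)) i j : ctr x i j = (x j i)^*.
Proof. by rewrite !mxE. Qed.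

Lemma ctr_place p q a (x : Lop p) : (a + p <= q)%N -> ctr (place q a x) = place q a (ctr x).
Proof.
move=> apq; apply/matrixP => k l; rewrite -(lettersK k) -(lettersK l) ctrE placeE // placeE //.
rewrite rmorphM /= ctrE; congr (_ * _).
rewrite (_ : [forall b : 'I_q, _] = [forall b : 'I_q, ((a <= b)%N && (b < a + p)%N) ||
   (letters k b == letters l b)]); first by case: [forall _, _]; rewrite ?rmorph1 ?rmorph0.
by apply: eq_forallb => b; rewrite eq_sym.
Qed.

Lemma ctr_st n (X : nat -> 'M[C]_m.+1) : ctr (stens n X) = stens n (fun b => ctr (X b)).
Proof. by apply/matrixP => k l; rewrite !mxE rmorph_prod; apply: eq_bigr => b _;
  rewrite !mxE. Qed.

Lemma place_place p q r a b (x : Lop p) : (a + p <= q)%N -> (b + q <= r)%N ->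
  place r b (place q a x) = place r (b + a) x.
Proof.
move=> apq bqr; move: x; apply: stens_ext => [||X].
- exact: lin_comp (@place_linear _ _ _) (@place_linear _ _ _).
- exact: place_linear.
have H : (b + a + p <= r)%N by rewrite -addnA (leq_trans _ bqr) // leq_add2l.
rewrite !place_st //; apply: eq_stens => c _; rewrite /pad.
rewrite subnDA; case: ifP => H1; last by case: ifP => // H2; exfalso; lia.
by case: ifP => H2; case: ifP => // H3; exfalso; lia.
Qed.

Lemma place_id p (x : Lop p) : place p 0 x = x.
Proof.
move: x; apply: stens_ext => [||X]; [exact: place_linear|exact: lin_id|].
by rewrite place_st //; apply: eq_stens => b bp; rewrite /pad /= add0n bp subn0.
Qed.

Lemma place_st_comm p q a (x : Lop p) (Z : nat -> 'M[C]_m.+1) : (a + p <= q)%N ->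
  (forall b, (a <= b)%N -> (b < a + p)%N -> Z b = 1%:M) ->
  place q a x *m stens q Z = stens q Z *m place q a x.
Proof.
move=> apq HZ; move: x; apply: stens_ext => [||X].
- exact: lin_comp (lin_mulr _) (@place_linear _ _ _).
- exact: lin_comp (lin_mull _) (@place_linear _ _ _).
rewrite place_st // !stens_mul; apply: eq_stens => b _; rewrite /pad.
case: ifP => [/andP [b1 b2]|_]; last by rewrite mulmx1 mul1mx.
by rewrite HZ // mulmx1 mul1mx.
Qed.

Lemma place_comm p q p' a a' (x : Lop p) (y : Lop p') :
  (a + p <= a')%N -> (a' + p' <= q)%N ->
  place q a x *m place q a' y = place q a' y *m place q a x.
Proof.
move=> H1 H2; move: y; apply: stens_ext => [||Y].
- exact: lin_comp (lin_mull _) (@place_linear _ _ _).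
- exact: lin_comp (lin_mulr _) (@place_linear _ _ _).
rewrite (place_st _ H2) place_st_comm // ?(leq_trans H1) ?(leq_trans (leq_addr _ _) H2) //.
by move=> b ab bp; rewrite /pad leqNgt (leq_trans bp H1).
Qed.
End Place.

Lemma linZ (K : comPzRingType) (U V : lmodType K) (g : U -> V) : linear g ->
  forall c x, g (c *: x) = c *: g x.
Proof.
move=> lg c x; have g0 : g 0 = 0.
  by have := lg (-1) 0 0; rewrite scaleN1r oppr0 addr0 scaleN1r addNr.
by rewrite -[c *: x]addr0 lg g0 addr0.
Qed.

(** * Slice maps *)

Section CondExp.
Variables (R : realType) (m : nat).
Local Notation C := (R[i]).
Local Notation widx := (widx m).
Local Notation Lop := (Lop R m).
Local Notation mx := 'M[C]_m.+1.

(* The normalized weights integrated against on the legs to the left and to the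
   right of the target interval. *)
Variables (L W : nat -> mx).
Hypotheses (trL : forall b, \tr (L b) = 1) (trW : forall b, \tr (W b) = 1).

Definition ptrace i j n (x : 'M[C]_(widx n)) : 'M[C]_(widx (j - i)) :=
  ptrace_left (j - i) (stens i L) (ptrace_right j (stens (n - j) (shiftn j W)) x).

Definition expect i j n (x : 'M[C]_(widx n)) : 'M[C]_(widx n) :=
  place n i (ptrace i j x : Lop (j - i)).

(** [outer] and [inner] describe the slice of a simple tensor: the scalar contributed at position b,
    and the letter left there. *)
Definition outer i j b (Y : mx) : C :=
  if (b < i)%N then \tr (L b *m Y) else if (j <= b)%N then \tr (W b *m Y) else 1.

Definition inner i j (X : nat -> mx) b : mx :=
  if (i <= b)%N && (b < j)%N then X b else 1%:M.

Lemma ptrace_linear i j n : linear (@ptrace i j n).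
Proof. exact: lin_comp (@ptrace_left_linear _ _ _ _ _ _) (@ptrace_right_linear _ _ _ _ _ _).
  Qed.

Lemma expect_linear i j n : linear (@expect i j n).
Proof. exact: lin_comp (@place_linear _ _ _ _ _) (@ptrace_linear _ _ _). Qed.

Lemma ptrace_st i j n X : (i <= j <= n)%N ->
  ptrace i j (stens n X) = (\prod_(b < n) outer i j b (X b)) *: stens (j - i) (shiftn i X).
Proof.
move=> /andP [ij jn]; rewrite /ptrace ptrace_right_st ?subnKC //.
rewrite (linZ (@ptrace_left_linear _ _ _ _ _ _)) ptrace_left_st ?subnKC // scalerA;
  congr (_ *: _).
rewrite !stens_mul !mxtrace_st /shiftn.
rewrite (prod_window (fun b => \tr (W b *m X b)) (q := n)) ?subnKC //.
rewrite (prod_window (fun b => \tr (L b *m X b)) (a := 0) (q := n)) ?(leq_trans ij) //.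
rewrite -big_split; apply: eq_bigr => b _ /=; rewrite /outer.
have bn := ltn_ord b.
by do ![case: ifP => ?]; first [by rewrite ?mul1r ?mulr1 | exfalso; lia].
Qed.

Lemma expect_st i j n X : (i <= j <= n)%N ->
  expect i j (stens n X) = (\prod_(b < n) outer i j b (X b)) *: stens n (inner i j X).
Proof.
move=> ijn; rewrite /expect ptrace_st // (linZ (@place_linear _ _ _ _ _)); congr (_ *: _).
rewrite place_st; last lia.
apply: eq_stens => b bn; rewrite /pad /inner /shiftn.
do ![case: ifP => ?]; first [by congr X; lia | by [] | exfalso; lia].
Qed.

(** A letter already sliced is the identity, which the second slice sends to 1 because the weights
    have trace 1. When the windows are disjoint, the letters of [k, l) receive the right weight if
    they lie after [i, j) and the left weight if they lie before it; the word is therefore cut at k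
    or at l. *)
Lemma expect_comp i j k l r s n (x : 'M[C]_(widx n)) :
  (i <= j <= n)%N -> (k <= l <= n)%N -> (r <= s <= n)%N ->
  [\/ r = maxn i k /\ s = minn j l, (j <= k)%N /\ r = k /\ s = k |
      (l <= i)%N /\ r = l /\ s = l] ->
  expect i j (expect k l x) = expect r s x.
Proof.
move=> ijn kln rsn H.
have {}H : (r = maxn i k /\ s = minn j l) \/ ((j <= k)%N /\ r = k /\ s = k) \/
  ((l <= i)%N /\ r = l /\ s = l) by case: H => H; [left|right; left|right; right].
move: x; apply: stens_ext => [||X].
- exact: lin_comp (@expect_linear _ _ _) (@expect_linear _ _ _).
- exact: expect_linear.
rewrite !expect_st // (linZ (@expect_linear _ _ _)) expect_st // scalerA -big_split.
congr (_ *: _); last first.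
  apply: eq_stens => b bn; rewrite /inner.
  by do ![case: ifP => ?]; first [by [] | exfalso; lia].
apply: eq_bigr => b _ /=; have bn := ltn_ord b; rewrite /outer /inner.
by do ![case: ifP => ?]; first [by rewrite ?mulmx1 ?trL ?trW ?mul1r ?mulr1 | exfalso; lia].
Qed.

(** The trace puts the right weight on the letters that the slice has kept, so the left weights stop
    at i whatever j is. *)
Lemma expect_trace i j n (x : 'M[C]_(widx n)) : (i <= j <= n)%N ->
  expect i i x = (\tr (stens n W *m expect i j x))%:M.
Proof.
move=> ijn; move: x; apply: stens_ext => [||X].
- exact: expect_linear.
- apply: lin_comp (@lin_scalar _ _) _; apply: lin_comp (@lin_trace _ _) _.
  exact: lin_comp (lin_mull _) (@expect_linear _ _ _).
rewrite !expect_st //; last lia.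
rewrite -scalemxAr stens_mul mxtraceZ mxtrace_st -scalemx1 -stens1 -big_split.
congr (_ *: _); last by apply: eq_stens => b bn; rewrite /inner; case: ifP => // ?; exfalso;
  lia.
apply: eq_bigr => b _ /=; have bn := ltn_ord b; rewrite /outer /inner.
by do ![case: ifP => ?]; first [by rewrite ?mulmx1 ?trL ?trW ?mul1r ?mulr1 | exfalso; lia].
Qed.

Lemma ptrace_place i j n (y : Lop (j - i)) : (i <= j <= n)%N -> ptrace i j (place n i y) = y.
Proof.
move=> ijn; have H : (i + (j - i) <= n)%N by lia.
move: y; apply: stens_ext => [||Y].
- exact: lin_comp (@ptrace_linear _ _ _) (@place_linear _ _ _ _ _).
- exact: lin_id.
rewrite place_st // ptrace_st // -[RHS]scale1r; congr (_ *: _); last first.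
  by apply: eq_stens => b bn; rewrite /shiftn /pad; case: ifP => ?; [congr Y; lia|exfalso;
    lia].
apply: big1 => b _; have bn := ltn_ord b; rewrite /outer /pad.
by do ![case: ifP => ?]; first [by rewrite ?mulmx1 ?trL ?trW | exfalso; lia].
Qed.

Lemma ptrace_bimod i j n (y y' : Lop (j - i)) (x : 'M[C]_(widx n)) : (i <= j <= n)%N ->
  ptrace i j (place n i y *m x *m place n i y') = y *m ptrace i j x *m y'.
Proof.
move=> ijn; have H : (i + (j - i) <= n)%N by lia.
move: x; apply: stens_ext => [||X].
- apply: lin_comp (@ptrace_linear _ _ _) _.
  exact: lin_comp (lin_mulr _) (lin_mull _).
- exact: lin_comp (lin_mulr _) (lin_comp (lin_mull _) (@ptrace_linear _ _ _)).
move: y; apply: stens_ext => [||Y].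
- apply: lin_comp (@ptrace_linear _ _ _) _.
  exact: lin_comp (lin_mulr _) (lin_comp (lin_mulr _) (@place_linear _ _ _ _ _)).
- exact: lin_comp (lin_mulr _) (lin_mulr _).
move: y'; apply: stens_ext => [||Y'].
- apply: lin_comp (@ptrace_linear _ _ _) _.
  exact: lin_comp (lin_mull _) (@place_linear _ _ _ _ _).
- exact: lin_mull.
rewrite !place_st // !stens_mul !ptrace_st // -scalemxAr -scalemxAl !stens_mul.
congr (_ *: _); last first.
  apply: eq_stens => b bn; rewrite /shiftn /pad.
  by case: ifP => ?; [congr (Y _ *m _ *m Y' _); lia|exfalso; lia].
apply: eq_bigr => b _; have bn := ltn_ord b; rewrite /outer /pad.
by do ![case: ifP => ?]; first [by rewrite ?mulmx1 ?mul1mx | exfalso; lia].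
Qed.

Lemma expect_bimod i j n (y y' : Lop (j - i)) (x : 'M[C]_(widx n)) : (i <= j <= n)%N ->
  expect i j (place n i y *m x *m place n i y') = place n i y *m expect i j x *m place n i y'.
Proof. by move=> ijn; rewrite /expect ptrace_bimod // !placeM //; lia. Qed.

(** The slice is the transpose of [place] for the trace pairing weighted on the outer letters; its
    self-adjointness and positivity are read off from this pairing. *)
Lemma ptrace_dual i j n (x : 'M[C]_(widx n)) (c : Lop (j - i)) : (i <= j <= n)%N ->
  \tr (ptrace i j x *m c) =
  \tr (stens n (fun b => if (b < i)%N then L b else if (j <= b)%N then W b else 1%:M) *m
       x *m place n i c).
Proof.
move=> ijn; have H : (i + (j - i) <= n)%N by lia.
set D := stens n _.
apply: (@stens_ext m _ n C^o (fun x => \tr (ptrace i j x *m c)) (fun x => \tr (D *m x *m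
  place n i c))) => [||X].
- apply: lin_comp (@lin_trace _ _) _.
  exact: lin_comp (lin_mulr _) (@ptrace_linear _ _ _).
- apply: lin_comp (@lin_trace _ _) _.
  exact: lin_comp (lin_mulr _) (lin_mull _).
apply: (@stens_ext m _ (j - i) C^o (fun c => \tr (ptrace i j (stens n X) *m c))
   (fun c => \tr (D *m stens n X *m place n i c))) => [||Y].
- exact: lin_comp (@lin_trace _ _) (lin_mull _).
- apply: lin_comp (@lin_trace _ _) _.
  exact: lin_comp (lin_mull _) (@place_linear _ _ _ _ _).
rewrite ptrace_st // place_st // -scalemxAl !stens_mul mxtraceZ !mxtrace_st /shiftn.
rewrite (eq_bigr (fun b : 'I_(j - i) => \tr (X (i + b)%N *m Y (i + b - i)%N))); last first.
  by move=> b _; rewrite addKn.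
rewrite (prod_window (fun b => \tr (X b *m Y (b - i)%N)) H) -big_split.
apply: eq_bigr => b _; have bn := ltn_ord b; rewrite /outer /pad /=.
by do ![case: ifP => ?]; first [by rewrite ?mulmx1 ?mul1mx ?mul1r ?mulr1 | exfalso; lia].
Qed.

(** The window ends between the two letters of [y], so just the second one is sliced. *)
Lemma expect_straddle_r i b n (y : Lop 2) : (i <= b)%N -> (b.+2 <= n)%N ->
  expect i b.+1 (place n b y) =
  place n b (ptrace_right 1 (stens 1 (shiftn b.+1 W)) y : Lop 1).
Proof.
move=> ib bn2; move: y; apply: stens_ext => [||Y].
- exact: lin_comp (@expect_linear _ _ _) (@place_linear _ _ _ _ _).
- exact: lin_comp (@place_linear _ _ _ _ _) (@ptrace_right_linear _ _ _ _ _ _).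
rewrite place_st ?addn2 // expect_st; last lia.
rewrite ptrace_right_st // (linZ (@place_linear _ _ _ _ _)) place_st ?addn1; last lia.
congr (_ *: _); last first.
  apply: eq_stens => c cn; rewrite /inner /pad.
  by do ![case: ifP => ?]; first [by [] | exfalso; lia].
rewrite stens_mul mxtrace_st /shiftn.
rewrite [RHS](eq_bigr (fun c : 'I_1 => \tr (W (b.+1 + c)%N *m Y (b.+1 + c - b)%N)));
  last first.
  by move=> c _; congr (\tr (_ *m Y _)); lia.
rewrite (prod_window (fun c => \tr (W c *m Y (c - b)%N)) (q := n)); last lia.
apply: eq_bigr => c _; have cn := ltn_ord c; rewrite /outer /pad /=.
by do ![case: ifP => ?]; first [by rewrite ?mulmx1 ?trL ?trW | exfalso; lia].
Qed.

Lemma expect_straddle_l b j n (y : Lop 2) : (b.+2 <= j)%N -> (j <= n)%N ->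
  expect b.+1 j (place n b y) =
  place n b.+1 (ptrace_left 1 (stens 1 (shiftn b L)) y : Lop 1).
Proof.
move=> bj jn; move: y; apply: stens_ext => [||Y].
- exact: lin_comp (@expect_linear _ _ _) (@place_linear _ _ _ _ _).
- exact: lin_comp (@place_linear _ _ _ _ _) (@ptrace_left_linear _ _ _ _ _ _).
rewrite place_st; last lia.
rewrite expect_st; last lia.
rewrite ptrace_left_st // (linZ (@place_linear _ _ _ _ _)) place_st; last lia.
congr (_ *: _); last first.
  apply: eq_stens => c cn; rewrite /inner /pad /shiftn.
  by do ![case: ifP => ?]; first [by congr Y; lia | by [] | exfalso; lia].
rewrite stens_mul mxtrace_st /shiftn.
rewrite [RHS](eq_bigr (fun c : 'I_1 => \tr (L (b + c)%N *m Y (b + c - b)%N))); last first.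
  by move=> c _; congr (\tr (_ *m Y _)); lia.
rewrite (prod_window (fun c => \tr (L c *m Y (c - b)%N)) (q := n)); last lia.
apply: eq_bigr => c _; have cn := ltn_ord c; rewrite /outer /pad /=.
by do ![case: ifP => ?]; first [by rewrite ?mulmx1 ?trL ?trW | exfalso; lia].
Qed.

Definition pair2 (Y0 Y1 : mx) (c : nat) : mx := if c is 0 then Y0 else Y1.

(** * Compression by a two-letter operator, and transfer of letters through it *)

Section Jones.
Variables (b : nat) (e : Lop 2).

(** The operator [x] ends at position b, so on a simple tensor [e] meets its last letter only; the
    other letters, collected in [Z0], are trivial on the window of [e] and commute with it. [He]
    then yields the scalar that the slice puts at position b. *)
Lemma jones_compress_r n i p (x : Lop p) :
  (forall Y, e *m stens 2 (pair2 Y 1%:M) *m e = \tr (W b *m Y) *: (e : 'M[C]_(widx 2))) ->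
  (i <= b)%N -> (i + p = b.+1)%N -> (b.+2 <= n)%N ->
  place n b e *m place n i x *m place n b e = expect i b (place n i x) *m place n b e.
Proof.
move=> He ib ipb bn; move: x; apply: stens_ext => [||X].
- exact: lin_comp (lin_mulr _) (lin_comp (lin_mull _) (@place_linear _ _ _ _ _)).
- exact: lin_comp (lin_mulr _) (lin_comp (@expect_linear _ _ _) (@place_linear _ _ _ _ _)).
have ipn : (i + p <= n)%N by lia.
have b2n : (b + 2 <= n)%N by lia.
rewrite place_st // expect_st; last lia.
set Z := pad i p X.
pose Z0 c := if (c == b) || (c == b.+1) then 1%:M else Z c.
have -> : stens n Z = stens n Z0 *m place n b (stens 2 (pair2 (Z b) 1%:M) : Lop 2).
  rewrite place_st // stens_mul; apply: eq_stens => c cn; rewrite /Z0 /pad.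
  have [->|cb] := eqVneq c b; first by rewrite leqnn subnn /= addn2 ltnS leqnSn mul1mx.
  have [->|cb1] := eqVneq c b.+1.
    rewrite /= leqnSn addn2 ltnSn /= subSnn /= mul1mx /Z /pad; case: ifP => // ?; exfalso; lia.
  by rewrite /= ifF ?mulmx1 //; lia.
have comm y : place n b (y : Lop 2) *m stens n Z0 = stens n Z0 *m place n b y.
  by apply: place_st_comm => // c c1 c2; rewrite /Z0 ifT //; lia.
rewrite mulmxA comm -!mulmxA -!placeM // mulmxA He (linZ (@place_linear _ _ _ _ _)).
rewrite -scalemxAl -scalemxAr; congr (_ *: _); last first.
  congr (_ *m _); apply: eq_stens => c cn; rewrite /inner /Z0 /Z /pad.
  by do ![case: ifP => ?]; first [by [] | exfalso; lia].
transitivity (\prod_(c < 1) (fun c => \tr (W c *m Z c)) (b + c)%N).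
  by rewrite big_ord1 addn0.
rewrite (prod_window (fun c => \tr (W c *m Z c)) (q := n)); last lia.
apply: eq_bigr => c _; have cn := ltn_ord c; rewrite /outer /Z /pad /=.
by do ![case: ifP => ?]; first [by rewrite ?mulmx1 ?trL ?trW | exfalso; lia].
Qed.

(** Here [x] starts at the second letter of [e], so [e] meets its first letter only, and the left
    weight of that letter appears. *)
Lemma jones_compress_l n p (x : Lop p) :
  (forall Y, e *m stens 2 (pair2 1%:M Y) *m e = \tr (L b.+1 *m Y) *: (e : 'M[C]_(widx 2))) ->
  (0 < p)%N -> (b.+1 + p <= n)%N ->
  place n b e *m place n b.+1 x *m place n b e =
  expect b.+2 (b.+1 + p) (place n b.+1 x) *m place n b e.
Proof.
move=> He p0 bpn; move: x; apply: stens_ext => [||X].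
- exact: lin_comp (lin_mulr _) (lin_comp (lin_mull _) (@place_linear _ _ _ _ _)).
- exact: lin_comp (lin_mulr _) (lin_comp (@expect_linear _ _ _) (@place_linear _ _ _ _ _)).
have b2n : (b + 2 <= n)%N by lia.
rewrite place_st // expect_st; last lia.
set Z := pad b.+1 p X.
pose Z0 c := if (c == b) || (c == b.+1) then 1%:M else Z c.
have -> : stens n Z = stens n Z0 *m place n b (stens 2 (pair2 1%:M (Z b.+1)) : Lop 2).
  rewrite place_st // stens_mul; apply: eq_stens => c cn; rewrite /Z0 /pad.
  have [->|cb] := eqVneq c b.
    rewrite leqnn subnn /= addn2 ltnS leqnSn mul1mx /Z /pad; case: ifP => // ?; exfalso; lia.
  have [->|cb1] := eqVneq c b.+1.
    by rewrite /= leqnSn addn2 ltnSn /= subSnn /= mul1mx.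
  by rewrite /= ifF ?mulmx1 //; lia.
have comm y : place n b (y : Lop 2) *m stens n Z0 = stens n Z0 *m place n b y.
  by apply: place_st_comm => // c c1 c2; rewrite /Z0 ifT //; lia.
rewrite mulmxA comm -!mulmxA -!placeM // mulmxA He (linZ (@place_linear _ _ _ _ _)).
rewrite -scalemxAl -scalemxAr; congr (_ *: _); last first.
  congr (_ *m _); apply: eq_stens => c cn; rewrite /inner /Z0 /Z /pad.
  by do ![case: ifP => ?]; first [by [] | exfalso; lia].
transitivity (\prod_(c < 1) (fun c => \tr (L c *m Z c)) (b.+1 + c)%N).
  by rewrite big_ord1 addn0.
rewrite (prod_window (fun c => \tr (L c *m Z c)) (q := n)); last lia.
apply: eq_bigr => c _; have cn := ltn_ord c; rewrite /outer /Z /pad /=.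
by do ![case: ifP => ?]; first [by rewrite ?mulmx1 ?trL ?trW | exfalso; lia].
Qed.

Variable lambda : C.

(* Since (1 (x) Y) e = (Y' (x) 1) e, the operator x may be assumed to act
   trivially on the last leg, so that it comes out of the expectation. *)
Lemma markov_r n i p (x : Lop p) :
  (forall Y, exists Y', stens 2 (pair2 1%:M Y) *m e = stens 2 (pair2 Y' 1%:M) *m e) ->
  ptrace_right 1 (stens 1 (shiftn b.+1 W)) e = lambda%:M ->
  (i <= b)%N -> (i + p = b.+2)%N -> (b.+2 <= n)%N ->
  expect i b.+1 (place n i x *m place n b e) *m place n b e =
  lambda *: (place n i x *m place n b e).
Proof.
move=> He He2 ib ipb bn; move: x; apply: stens_ext => [||X].
- apply: lin_comp (lin_mulr _) (lin_comp (@expect_linear _ _ _) _).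
  exact: lin_comp (lin_mulr _) (@place_linear _ _ _ _ _).
- apply: lin_comp (lin_scale _) _.
  exact: lin_comp (lin_mulr _) (@place_linear _ _ _ _ _).
have ipn : (i + p <= n)%N by lia.
have b2n : (b + 2 <= n)%N by lia.
rewrite place_st //; set Z := pad i p X.
have [Y' HY] := He (Z b.+1).
pose Z' c := if c == b then Z b *m Y' else if c == b.+1 then 1%:M else Z c.
pose Z0 c := if c == b.+1 then 1%:M else Z c.
have -> : stens n Z *m place n b e = stens n Z' *m place n b e.
  transitivity (stens n Z0 *m place n b (stens 2 (pair2 1%:M (Z b.+1)) : Lop 2) *m
    place n b e).
    congr (_ *m _); rewrite place_st // stens_mul; apply: eq_stens => c cn; rewrite /Z0 /pad.
    have [->|cb1] := eqVneq c b.+1.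
      by rewrite leqnSn addn2 ltnSn /= subSnn /= mul1mx.
    case: ifP => ?; last by rewrite mulmx1.
    by rewrite (_ : c = b) ?subnn /= ?mulmx1 //; lia.
  rewrite -mulmxA -placeM // HY placeM // mulmxA; congr (_ *m _).
  rewrite place_st // stens_mul; apply: eq_stens => c cn; rewrite /Z0 /Z' /pad.
  have [->|cb] := eqVneq c b.
    by rewrite leqnn subnn addn2 ltnS leqnSn /= ifF //; lia.
  have [->|cb1] := eqVneq c b.+1.
    by rewrite leqnSn addn2 ltnSn /= subSnn /= mul1mx.
  by rewrite ifF ?mulmx1 //; lia.
have -> : stens n Z' = place n i (stens (b.+1 - i) (shiftn i Z') : Lop (b.+1 - i)).
  rewrite place_st; last lia.
  apply: eq_stens => c cn; rewrite /pad; case: ifP => Hc; first by rewrite /shiftn subnKC //;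
    lia.
  rewrite /Z'; do ![case: ifP => ?]; first [by [] | exfalso; lia | idtac].
  by rewrite /Z /pad; case: ifP => // ?; exfalso; lia.
set y := stens (b.+1 - i) _.
have -> : expect i b.+1 (place n i (y : Lop (b.+1 - i)) *m place n b e) =
    lambda *: place n i (y : Lop (b.+1 - i)).
  have := @expect_bimod i b.+1 n y (1%:M : Lop _) (place n b e).
  rewrite place1 ?mulmx1 ?mulmx1; last lia.
  move=> ->; last lia.
  rewrite ?mulmx1 expect_straddle_r // He2 -scalemx1 (linZ (@place_linear _ _ _ _ _)) place1;
    last lia.
  by rewrite -scalemxAr mulmx1.
by rewrite -scalemxAl.
Qed.

(** The mirror image of [markov_r]: the first letter of [x] is transferred to the second leg of [e],
    after which [x] lies in the range of the expectation and comes out. *)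
Lemma markov_l n p (x : Lop p) :
  (forall Y, exists Y', stens 2 (pair2 Y 1%:M) *m e = stens 2 (pair2 1%:M Y') *m e) ->
  ptrace_left 1 (stens 1 (shiftn b L)) e = lambda%:M ->
  (2 <= p)%N -> (b + p <= n)%N ->
  expect b.+1 (b + p) (place n b x *m place n b e) *m place n b e =
  lambda *: (place n b x *m place n b e).
Proof.
move=> He He2 p2 bpn; move: x; apply: stens_ext => [||X].
- apply: lin_comp (lin_mulr _) (lin_comp (@expect_linear _ _ _) _).
  exact: lin_comp (lin_mulr _) (@place_linear _ _ _ _ _).
- apply: lin_comp (lin_scale _) _.
  exact: lin_comp (lin_mulr _) (@place_linear _ _ _ _ _).
have b2n : (b + 2 <= n)%N by lia.
rewrite place_st //; set Z := pad b p X.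
have [Y' HY] := He (Z b).
pose Z' c := if c == b.+1 then Z b.+1 *m Y' else if c == b then 1%:M else Z c.
pose Z0 c := if c == b then 1%:M else Z c.
have -> : stens n Z *m place n b e = stens n Z' *m place n b e.
  transitivity (stens n Z0 *m place n b (stens 2 (pair2 (Z b) 1%:M) : Lop 2) *m place n b e).
    congr (_ *m _); rewrite place_st // stens_mul; apply: eq_stens => c cn; rewrite /Z0 /pad.
    have [->|cb] := eqVneq c b.
      by rewrite leqnn subnn addn2 ltnS leqnSn /= mul1mx.
    case: ifP => ?; last by rewrite mulmx1.
    by rewrite (_ : c = b.+1) ?subSnn /= ?mulmx1 //; lia.
  rewrite -mulmxA -placeM // HY placeM // mulmxA; congr (_ *m _).
  rewrite place_st // stens_mul; apply: eq_stens => c cn; rewrite /Z0 /Z' /pad.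
  have [->|cb] := eqVneq c b.+1.
    by rewrite leqnSn addn2 ltnSn /= subSnn /= ifF //; lia.
  have [->|cb1] := eqVneq c b.
    by rewrite leqnn subnn addn2 ltnS leqnSn /= mul1mx.
  by rewrite ifF ?mulmx1 //; lia.
have -> : stens n Z' = place n b.+1 (stens (b + p - b.+1) (shiftn b.+1 Z') : Lop (b +
  p - b.+1)).
  rewrite place_st; last lia.
  apply: eq_stens => c cn; rewrite /pad; case: ifP => Hc; first by rewrite /shiftn subnKC //;
    lia.
  rewrite /Z'; do ![case: ifP => ?]; first [by [] | exfalso; lia | idtac].
  by rewrite /Z /pad; case: ifP => // ?; exfalso; lia.
set y := stens (b + p - b.+1) _.
have -> : expect b.+1 (b + p) (place n b.+1 (y : Lop (b + p - b.+1)) *m place n b e) =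
    lambda *: place n b.+1 (y : Lop (b + p - b.+1)).
  have := @expect_bimod b.+1 (b + p) n y (1%:M : Lop _) (place n b e).
  rewrite place1 ?mulmx1 ?mulmx1; last lia.
  move=> ->; last lia.
  rewrite ?mulmx1 expect_straddle_l //; last lia.
  rewrite He2 -scalemx1 (linZ (@place_linear _ _ _ _ _)) place1; last lia.
  by rewrite -scalemxAr mulmx1.
by rewrite -scalemxAl.
Qed.
End Jones.
End CondExp.

(** * Tensor products of corepresentations *)

Section TensorCoreps.
Variables (R : realType) (G : woronowicz R) (m : nat).
Local Notation C := (R[i]).
Local Notation widx := (widx m).
Local Notation As := (As (G := G)).
Local Notation tens := (tens (G := G)).
Local Notation delta := (@wo_delta R G).

Lemma idx_glue_eq p q n (s t : nat -> 'I_m.+1) : n = (p + q)%N ->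
  (idx n s == idx n t) = (idx p s == idx p t) && (idx q (shiftn p s) == idx q (shiftn p t)).
Proof.
move=> ->; rewrite !idx_eq; apply/forallP/andP => [H|[/forallP H1 /forallP H2] b].
  split; apply/forallP => b; first exact: (H (lshift q b)).
  exact: (H (rshift p b)).
case: (split_ordP b) => c ->; first exact: (H1 c).
exact: (H2 c).
Qed.

Lemma adjE p q (x : 'M[G]_(p, q)) i j : adj x i j = star (x j i).
Proof. by rewrite mxE. Qed.

Lemma unitary_mxP n (w : 'M[G]_n) : unitary_mx w <->
  (forall i j, \sum_k star (w k i) * w k j = (i == j)%:R) /\
  (forall i j, \sum_k w i k * star (w j k) = (i == j)%:R).
Proof.
split=> [[/matrixP H1 /matrixP H2]|[H1 H2]]; split.
- by move=> i j; move: (H1 i j); rewrite mxE [RHS]mxE => <-; apply: eq_bigr => k _;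
  rewrite adjE.
- by move=> i j; move: (H2 i j); rewrite mxE [RHS]mxE => <-; apply: eq_bigr => k _;
  rewrite adjE.
- apply/matrixP => i j; rewrite mxE [RHS]mxE -H1; apply: eq_bigr => k _; by rewrite adjE.
- apply/matrixP => i j; rewrite mxE [RHS]mxE -H2; apply: eq_bigr => k _; by rewrite adjE.
Qed.

(** In w^* w the first tensor factor is innermost; its unitarity makes the inner sum a scalar, and
    then the sum over the second factor collapses. In w w^* the roles of the factors are
    exchanged. *)
Lemma unitary_glue p q n (w : nat -> 'M[G]_m.+1) : n = (p + q)%N ->
  unitary_mx (stens p w) -> unitary_mx (stens q (shiftn p w)) -> unitary_mx (stens n w).
Proof.
move=> nE /unitary_mxP [A1 A2] /unitary_mxP [B1 B2]; apply/unitary_mxP; split=> k l;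
  rewrite -(lettersK k) -(lettersK l); move: (letters k) (letters l) => s t;
  rewrite (idx_glue_eq s t nE) -(glue_shiftn p n s) -(glue_shiftn p n t) (sum_glue _ nE).
- rewrite exchange_big /=.
  transitivity (\sum_(k : 'I_(widx q)) star (stens q (shiftn p w) k (idx q (shiftn p s))) *
     (idx p s == idx p t)%:R * stens q (shiftn p w) k (idx q (shiftn p t))).
    apply: eq_bigr => r2 _; rewrite -A1 mulr_sumr mulr_suml; apply: eq_bigr => r1 _.
    by rewrite !(stens_glue _ _ _ _ _ nE) !lettersK starM !mulrA.
  case: eqP => [_|_] /=; first by rewrite -B1; apply: eq_bigr => r _; rewrite mulr1.
  by apply: big1 => r _; rewrite mulr0 mul0r.
- transitivity (\sum_(k : 'I_(widx p)) stens p w (idx p s) k *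
     (idx q (shiftn p s) == idx q (shiftn p t))%:R * star (stens p w (idx p t) k)).
    apply: eq_bigr => r1 _; rewrite -B2 mulr_sumr mulr_suml; apply: eq_bigr => r2 _.
    by rewrite !(stens_glue _ _ _ _ _ nE) !lettersK starM !mulrA.
  rewrite andbC; case: eqP => [_|_] /=; first by rewrite -A2; apply: eq_bigr => r _;
    rewrite mulr1.
  by apply: big1 => r _; rewrite mulr0 mul0r.
Qed.

Lemma stens1_unitary (w : nat -> 'M[G]_m.+1) : unitary_mx (w 0) -> unitary_mx (stens 1 w).
Proof.
move=> /unitary_mxP [H1 H2]; apply/unitary_mxP.
split=> k l.
- rewrite -letters1_eq -H1 -(sum_letters1 (fun a => star (w 0 a (letters k 0)) * w 0 a
  (letters l 0))).
  by apply: eq_bigr => r _; rewrite !stens1E.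
- rewrite -letters1_eq -H2 -(sum_letters1 (fun a => w 0 (letters k 0) a * star (w 0 (letters l
  0) a))).
  by apply: eq_bigr => r _; rewrite !stens1E.
Qed.

Lemma stens_unitary n (w : nat -> 'M[G]_m.+1) : (forall b, unitary_mx (w b)) ->
  unitary_mx (stens n w).
Proof.
elim: n w => [|n IH] w Hw.
  rewrite (_ : stens 0 w = 1%:M) -?stens1; last by apply: eq_stens.
  have adj1 : adj (1%:M : 'M[G]_(widx 0)) = 1%:M by rewrite -[1%:M](liftA1 G) adj_lift ctr1.
  by rewrite /unitary_mx stens1 adj1 mulmx1.
apply: (@unitary_glue 1 n); first by [].
  exact: stens1_unitary.
by apply: IH => b; apply: Hw.
Qed.

Lemma tens_prod (I : Type) (r : seq I) (x y : I -> G) :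
  \prod_(i <- r) tens (x i) (y i) = tens (\prod_(i <- r) x i) (\prod_(i <- r) y i).
Proof. by elim: r => [|i r IH]; rewrite ?big_nil ?tens1 // !big_cons IH tensM. Qed.

(** The coproduct of an entry is an ordered product of sums over letters; distributing it gives the
    sum over intermediate words, and [tensM] separates the legs. *)
Lemma stens_corep n (w : nat -> 'M[G]_m.+1) :
  (forall b, unitary_corep (w b)) -> unitary_corep (stens n w).
Proof.
move=> Hw; split.
- by move=> i j; rewrite mxE; apply: As_prod => b _; exact: (corep_coef (Hw b)).
- by apply: stens_unitary => b; exact: (corep_unitary (Hw b)).
- move=> i j; rewrite mxE (big_morph delta (@deltaM R G) (@delta1 R G)).
  transitivity (\prod_(b < n) \sum_a tens (w b (letters i b) a) (w b a (letters j b))).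
    by apply: eq_bigr => b _; rewrite (corep_delta (Hw b)).
  rewrite -(sum_letters n (fun b a => tens (w b (letters i b) a) (w b a (letters j b)))).
  by apply: eq_bigr => k _; rewrite tens_prod !mxE.
Qed.

Section StarSums.
Variables (h : G -> R[i]) (f : R[i] -> G -> R[i]) (hf : canonical_characters h f).
Variables (n : nat) (w : 'M[G]_n) (hw : unitary_corep w).

Lemma conj_corep_sum_r c d : \sum_a \sum_b Fmx f (-1) w b a *: (star (w c a) * w d b) =
  (Fmx f (-1) w d c)%:A.
Proof.
have /matrixP /(_ c d) := conj_corep_r hf hw; rewrite [RHS]mxE [X in _ = X%:A]mxE => <-.
rewrite mxE exchange_big; apply: eq_bigr => b _ /=; rewrite mulA_liftE mulr_suml.
by apply: eq_bigr => a _; rewrite !mxE scalerAl.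
Qed.

Lemma conj_corep_sum_l c d : \sum_a \sum_b Fmx f 1 w b a *: (w a c * star (w b d)) =
  (Fmx f 1 w d c)%:A.
Proof.
have /matrixP /(_ c d) := conj_corep_l hf hw; rewrite [RHS]mxE [X in _ = X%:A]mxE => <-.
rewrite mxE exchange_big; apply: eq_bigr => b _ /=; rewrite mulA_liftE mulr_suml.
by apply: eq_bigr => a _; rewrite !mxE scalerAl.
Qed.
End StarSums.

Lemma End_entry n (w : 'M[G]_n) (x : 'M[C]_n) i j : End w x ->
  \sum_k x i k *: w k j = \sum_k x k j *: w i k.
Proof.
move=> Hx; have /matrixP /(_ i j) := (Hx : lift_mx G x *m w = w *m lift_mx G x).
by rewrite mul_liftAE mulA_liftE.
Qed.

Lemma EndP n (w : 'M[G]_n) (x : 'M[C]_n) :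
  (forall i j, \sum_k x i k *: w k j = \sum_k x k j *: w i k) -> End w x.
Proof. by move=> H; rewrite /End /Defs.Hom /mkset; apply/matrixP => i j;
  rewrite mul_liftAE mulA_liftE; apply: H. Qed.

(** * Slices of intertwiners *)

Section Traces.
Variables (h : G -> R[i]) (f : R[i] -> G -> R[i]) (hf : canonical_characters h f).
Variables (p q n : nat) (nE : n = (p + q)%N) (w : nat -> 'M[G]_m.+1).
Hypothesis hw : forall b, unitary_corep (w b).
Local Notation w1 := (stens p w).
Local Notation w2 := (stens q (shiftn p w)).
Variable x : 'M[C]_(widx n).
Hypothesis Hx : End (stens n w) x.

Let X (a : 'I_(widx p)) (s : 'I_(widx q)) (b : 'I_(widx p)) (t : 'I_(widx q)) :=
  x (idx n (glue p (letters a) (letters s))) (idx n (glue p (letters b) (letters t))).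

Let HX (a : 'I_(widx p)) (s : 'I_(widx q)) (c : 'I_(widx p)) (t : 'I_(widx q)) :
  \sum_b \sum_r X a s b r *: (w1 b c * w2 r t) =
  \sum_b \sum_r X b r c t *: (w1 a b * w2 s r).
Proof.
have := End_entry (idx n (glue p (letters a) (letters s))) (idx n (glue p (letters c) (letters
  t))) Hx.
rewrite !(sum_glue _ nE) => H.
transitivity (\sum_(k : 'I_(widx p)) \sum_(l : 'I_(widx q))
     x (idx n (glue p (letters a) (letters s))) (idx n (glue p (letters k) (letters l))) *:
     stens n w (idx n (glue p (letters k) (letters l))) (idx n (glue p (letters c) (letters
       t)))).
  by apply: eq_bigr => b _; apply: eq_bigr => r _; rewrite (stens_glue _ _ _ _ _ nE) !lettersK.
by rewrite H; apply: eq_bigr => b _; apply: eq_bigr => r _;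
  rewrite (stens_glue _ _ _ _ _ nE) !lettersK.
Qed.

Lemma exchange_big22 (V : nmodType) (I1 I2 I3 I4 : finType) (F : I1 -> I2 -> I3 -> I4 -> V) :
  \sum_i \sum_j \sum_k \sum_l F i j k l = \sum_k \sum_l \sum_i \sum_j F i j k l.
Proof.
transitivity (\sum_(u : I1 * I2) \sum_(v : I3 * I4) F u.1 u.2 v.1 v.2).
  rewrite -(pair_bigA _ (fun i j => \sum_(v : I3 * I4) F i j v.1 v.2)) /=.
  by apply: eq_bigr => i _; apply: eq_bigr => j _; rewrite pair_bigA.
rewrite exchange_big -(pair_bigA _ (fun k l => \sum_(u : I1 * I2) F u.1 u.2 k l)) /=.
by apply: eq_bigr => k _; apply: eq_bigr => l _; rewrite [RHS]pair_bigA.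
Qed.

Lemma sum_delta_scale (V : lmodType C) (I : finType) (i : I) (c : I -> C) (y : V) (F : I ->
  V) :
  (forall j, F j = (c j * (i == j)%:R) *: y) -> \sum_j F j = c i *: y.
Proof.
move=> H; rewrite (bigD1 i) //= H eqxx mulr1 big1 ?addr0 // => j /negbTE ji.
by rewrite H eq_sym ji mulr0 scale0r.
Qed.

(* x commutes with w1 (x) w2 iff w1^* x w1 = w2 x w2^*, and the slice with
   F_(-1) does not see the conjugation of the left factor by w1. *)
Lemma ptrace_left_End : End w2 (ptrace_left q (Fmx f (-1) w1) x).
Proof.
have hw1 := stens_corep p hw; set M := Fmx f (-1) w1.
have ME a b := conj_corep_sum_r hf hw1 a b.
have /unitary_mxP [U1 _] := corep_unitary hw1.
apply: EndP => s t.
(* [ME] read backwards expands each scalar [M b a] into products [star (w1 a e) * w1 b c]; in this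
   way the entries of the full word w1 (x) w2 appear and [HX] applies. *)
transitivity (\sum_a \sum_e \sum_c M c e *: (star (w1 a e) *
    (\sum_b \sum_(r : 'I_(widx q)) X a s b r *: (w1 b c * w2 r t)))).
  transitivity (\sum_a \sum_b \sum_(r : 'I_(widx q)) (M b a * X a s b r) *: w2 r t).
    under eq_bigr do rewrite mxE scaler_suml.
    rewrite exchange_big; apply: eq_bigr => a _ /=; under eq_bigr do rewrite scaler_suml.
    by rewrite exchange_big.
  apply: eq_bigr => a _.
  transitivity (\sum_e \sum_c \sum_b \sum_(r : 'I_(widx q))
     X a s b r *: (M c e *: (star (w1 a e) * w1 b c) * w2 r t)); last first.
    apply: eq_bigr => e _; apply: eq_bigr => c _; rewrite mulr_sumr scaler_sumr.
    apply: eq_bigr => b _; rewrite mulr_sumr scaler_sumr; apply: eq_bigr => r _.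
    by rewrite -scalerAr scalerA mulrC -scalerA -scalerAl mulrA.
  rewrite exchange_big22; apply: eq_bigr => b _; apply: eq_bigr => r _.
  under [RHS]eq_bigr do rewrite -scaler_sumr -mulr_suml.
  by rewrite -scaler_sumr -mulr_suml ME -scalerAl mul1r scalerA mulrC.
under eq_bigr do under eq_bigr do under eq_bigr do rewrite HX.
(* After [HX] the sum over a runs over [star (w1 a e) * w1 a b], which unitarity reduces to b =
   e. *)
transitivity (\sum_e \sum_c \sum_(r : 'I_(widx q)) (M c e * X e r c t) *: w2 s r).
  rewrite exchange_big; apply: eq_bigr => e _; rewrite exchange_big; apply: eq_bigr => c _ /=.
  rewrite -scaler_sumr; under [RHS]eq_bigr do rewrite -scalerA; rewrite -scaler_sumr.
  congr (_ *: _); under eq_bigr do rewrite mulr_sumr.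
  rewrite exchange_big /=.
  under eq_bigr do under eq_bigr do rewrite mulr_sumr.
  under eq_bigr do rewrite exchange_big /=.
  rewrite exchange_big /=; apply: eq_bigr => r _.
  apply: (@sum_delta_scale _ _ e (fun b => X b r c t)) => b.
  rewrite -scalerA; transitivity (X b r c t *: ((e == b)%:R * w2 s r)); last first.
    by rewrite mulr_natl scaler_nat.
  rewrite -U1 mulr_suml scaler_sumr; apply: eq_bigr => a _.
  by rewrite -scalerAr mulrA.
rewrite [RHS](eq_bigr (fun r : 'I_(widx q) => \sum_e \sum_c (M c e * X e r c t) *: w2 s r));
  last first.
  by move=> r _; rewrite mxE scaler_suml; apply: eq_bigr => e _; rewrite scaler_suml.
by rewrite [RHS]exchange_big; apply: eq_bigr => e _; rewrite [RHS]exchange_big.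
Qed.

(** The same relation w1^* x w1 = w2 x w2^* is sliced on the right factor, where F_1 does not see
    the conjugation by w2. The order of the steps is reversed: unitarity of w2 inserts the extra
    entries before [HX], and [ME] removes them afterwards. *)
Lemma ptrace_right_End : End w1 (ptrace_right p (Fmx f 1 w2) x).
Proof.
have hw2 : unitary_corep w2 by apply: stens_corep => b; exact: hw.
set M := Fmx f 1 w2.
have ME a b := conj_corep_sum_l hf hw2 a b.
have /unitary_mxP [_ U2] := corep_unitary hw2.
apply: EndP => s t.
transitivity (\sum_c \sum_g M g c *: (\sum_e
    (\sum_u \sum_(d : 'I_(widx q)) X s c u d *: (w1 u t * w2 d e)) * star (w2 g e))).
  transitivity (\sum_c \sum_g \sum_(u : 'I_(widx p)) (M g c * X s c u g) *: w1 u t).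
    under eq_bigr do rewrite mxE scaler_suml.
    rewrite exchange_big; apply: eq_bigr => c _ /=; under eq_bigr do rewrite scaler_suml.
    by rewrite exchange_big.
  apply: eq_bigr => c _; apply: eq_bigr => g _.
  under eq_bigr do rewrite -scalerA; rewrite -scaler_sumr; congr (_ *: _).
  under [RHS]eq_bigr do rewrite mulr_suml.
  rewrite [RHS]exchange_big /=; apply: eq_bigr => u _.
  under [RHS]eq_bigr do rewrite mulr_suml.
  rewrite [RHS]exchange_big /=; apply: esym.
  apply: (@sum_delta_scale _ _ g (fun d => X s c u d)) => d.
  rewrite -scalerA; transitivity (X s c u d *: (w1 u t * (d == g)%:R)); last first.
    by rewrite mulr_natr scaler_nat eq_sym.
  rewrite -U2 mulr_sumr scaler_sumr; apply: eq_bigr => e _.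
  by rewrite -scalerAl mulrA.
under eq_bigr do under eq_bigr do under eq_bigr do rewrite HX.
transitivity (\sum_e \sum_u \sum_(d : 'I_(widx q)) (M e d * X u d t e) *: w1 s u).
  under eq_bigr do under eq_bigr do rewrite scaler_sumr.
  under eq_bigr do rewrite exchange_big /=.
  rewrite exchange_big; apply: eq_bigr => e _ /=.
  transitivity (\sum_c \sum_g \sum_u \sum_(d : 'I_(widx q))
     X u d t e *: (w1 s u * (M g c *: (w2 c d * star (w2 g e))))).
    apply: eq_bigr => c _; apply: eq_bigr => g _; rewrite mulr_suml scaler_sumr.
    apply: eq_bigr => u _; rewrite mulr_suml scaler_sumr; apply: eq_bigr => d _.
    by rewrite -scalerAl scalerA mulrC -scalerA -scalerAr mulrA.
  rewrite exchange_big22; apply: eq_bigr => u _; apply: eq_bigr => d _.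
  under eq_bigr do rewrite -scaler_sumr -mulr_sumr.
  by rewrite -scaler_sumr -mulr_sumr ME -scalerAr mulr1 scalerA mulrC.
rewrite [RHS](eq_bigr (fun u : 'I_(widx p) => \sum_(d : 'I_(widx q)) \sum_e (M e d * X u d t
  e) *: w1 s u)); last first.
  by move=> u _; rewrite mxE scaler_suml; apply: eq_bigr => d _; rewrite scaler_suml.
rewrite exchange_big; apply: eq_bigr => u _ /=.
by rewrite exchange_big.
Qed.
End Traces.

Section PlaceEnd.
Variables (w : nat -> 'M[G]_m.+1).
Hypothesis hw : forall b, unitary_corep (w b).

Lemma place_left_entry p q n (x : Lop R m q) s1 s2 t1 t2 : n = (p + q)%N ->
  place n p x (idx n (glue p s1 s2)) (idx n (glue p t1 t2)) =
  (idx p s1 == idx p t1)%:R * x (idx q s2) (idx q t2).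
Proof.
move=> nE; rewrite placeE ?nE //; congr ((nat_of_bool _)%:R * _).
  rewrite idx_eq; apply/forallP/forallP => H b.
    have := H (lshift q b); rewrite /= /glue ltn_ord leqNgt ltn_ord /= //.
  case: (split_ordP b) => c -> /=; first by rewrite /glue ltn_ord H orbT.
  by rewrite leq_addr ltn_add2l ltn_ord.
by congr (x _ _); apply: eq_idx => b bq; rewrite /shiftn /glue ltnNge leq_addr /= addKn.
Qed.

Lemma place_right_entry p q n (x : Lop R m p) s1 s2 t1 t2 : n = (p + q)%N ->
  place n 0 x (idx n (glue p s1 s2)) (idx n (glue p t1 t2)) =
  (idx q s2 == idx q t2)%:R * x (idx p s1) (idx p t1).
Proof.
move=> nE; rewrite placeE ?nE ?leq_addr //; congr ((nat_of_bool _)%:R * _).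
  rewrite idx_eq; apply/forallP/forallP => H b.
    by have := H (rshift p b); rewrite /= /glue !ltnNge !leq_addr /= addKn.
  case: (split_ordP b) => c -> /=; first by [].
  by rewrite /glue !ltnNge !leq_addr /= addKn H.
by congr (x _ _); apply: eq_idx => b bq; rewrite /shiftn /glue bq.
Qed.

Lemma place_left_End p q n (x : Lop R m q) : n = (p + q)%N ->
  End (stens q (shiftn p w)) x -> End (stens n w) (place n p x).
Proof.
move=> nE Hx; apply: EndP => k l; rewrite -(lettersK k) -(lettersK l).
rewrite -(glue_shiftn p n (letters k)) -(glue_shiftn p n (letters l)) !(sum_glue _ nE).
move: (letters k) (letters l) => s t.
transitivity (stens p w (idx p s) (idx p t) *
   \sum_r x (idx q (shiftn p s)) r *: stens q (shiftn p w) r (idx q (shiftn p t))).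
  rewrite (bigD1 (idx p s)) //= [X in _ + X]big1 ?addr0; last first.
    move=> b /negbTE bs; apply: big1 => r _.
    by rewrite place_left_entry // lettersK eq_sym bs mul0r scale0r.
  rewrite mulr_sumr; apply: eq_bigr => r _.
  by rewrite place_left_entry // (stens_glue _ _ _ _ _ nE) !lettersK eqxx mul1r scalerAr.
rewrite (End_entry _ _ Hx) (bigD1 (idx p t)) //= [X in _ + X]big1 ?addr0; last first.
  move=> b /negbTE bs; apply: big1 => r _.
  by rewrite place_left_entry // lettersK bs mul0r scale0r.
rewrite mulr_sumr; apply: eq_bigr => r _.
by rewrite place_left_entry // (stens_glue _ _ _ _ _ nE) !lettersK eqxx mul1r scalerAr.
Qed.

Lemma place_right_End p q n (x : Lop R m p) : n = (p + q)%N ->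
  End (stens p w) x -> End (stens n w) (place n 0 x).
Proof.
move=> nE Hx; apply: EndP => k l; rewrite -(lettersK k) -(lettersK l).
rewrite -(glue_shiftn p n (letters k)) -(glue_shiftn p n (letters l)) !(sum_glue _ nE).
move: (letters k) (letters l) => s t.
rewrite exchange_big [RHS]exchange_big /=.
transitivity ((\sum_r x (idx p s) r *: stens p w r (idx p t)) *
   stens q (shiftn p w) (idx q (shiftn p s)) (idx q (shiftn p t))).
  rewrite (bigD1 (idx q (shiftn p s))) //= [X in _ + X]big1 ?addr0; last first.
    move=> b /negbTE bs; apply: big1 => r _.
    by rewrite (@place_right_entry p q n) // lettersK eq_sym bs mul0r scale0r.
  rewrite mulr_suml; apply: eq_bigr => r _.
  by rewrite (@place_right_entry p q n) // (stens_glue _ _ _ _ _ nE) !lettersK eqxx mul1r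
    scalerAl.
rewrite (End_entry _ _ Hx) (bigD1 (idx q (shiftn p t))) //= [X in _ + X]big1 ?addr0;
  last first.
  move=> b /negbTE bs; apply: big1 => r _.
  by rewrite (@place_right_entry p q n) // lettersK bs mul0r scale0r.
rewrite mulr_suml; apply: eq_bigr => r _.
by rewrite (@place_right_entry p q n) // (stens_glue _ _ _ _ _ nE) !lettersK eqxx mul1r
  scalerAl.
Qed.

Lemma place_End p q a (x : Lop R m p) : (a + p <= q)%N ->
  End (stens p (shiftn a w)) x -> End (stens q w) (place q a x).
Proof.
move=> apq Hx; rewrite -(@place_place R m p (a + p) q a 0 x (leqnn _) apq).
by apply: (@place_right_End _ (q - (a + p))); rewrite ?subnKC //; apply: place_left_End Hx.
Qed.
End PlaceEnd.
End TensorCoreps.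

(** * The C*-norm and positive square roots *)

Section OperatorNorm.
Variables (R : realType) (n : nat).
Local Notation C := (R[i]).

(* Both norms are sealed by opaque proofs: unifying unfolded square roots and
   suprema does not terminate in reasonable time. *)
Fact vnorm_subproof (u : 'rV[C]_n) : {r : R | r%:C = sqrtC (dotmx u u)}.
Proof.
exists (complex.Re (sqrtC (dotmx u u))).
by rewrite RRe_real // ger0_real // sqrtC_ge0; exact: (dnorm_ge0 (dotmx (n:=n))).
Qed.
Definition vnorm u : R := sval (vnorm_subproof u).
Lemma vnormE u : (vnorm u)%:C = sqrtC (dotmx u u).
Proof. exact: (svalP (vnorm_subproof u)). Qed.
Lemma vnorm_ge0 u : 0 <= vnorm u.
Proof. by rewrite -lecR vnormE sqrtC_ge0; exact: (dnorm_ge0 (dotmx (n:=n))). Qed.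
Lemma vnormD u v : vnorm (u + v) <= vnorm u + vnorm v.
Proof.
have eq_le (a a' b b' c c' : C) : a = a' -> b = b' -> c = c' -> a' <= b' + c' -> a <= b + c.
  by move=> -> -> ->.
have [H _] := triangle_lerif (dotmx (n:=n)) u v.
by rewrite -lecR rmorphD; exact: (eq_le _ _ _ _ _ _ (vnormE _) (vnormE _) (vnormE _) H).
Qed.
Lemma dotmx_le u v : `|dotmx u v| <= (vnorm u * vnorm v)%:C.
Proof.
have eq_le (a b b' c c' : C) : b = b' -> c = c' -> a <= b' * c' -> a <= b * c.
  by move=> -> ->.
have [H _] := CauchySchwarz_sqrt (dotmx (n:=n)) u v.
by rewrite rmorphM; exact: (eq_le _ _ _ _ _ (vnormE _) (vnormE _) H).
Qed.
Lemma vnormZ (k : C) u : (vnorm (k *: u))%:C = `|k| * (vnorm u)%:C.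
Proof.
have E : dotmx (k *: u) (k *: u) = `|k| ^+ 2 * dotmx u u.
  exact: (dnormZ (dotmx (n:=n))).
apply: etrans (vnormE _) _; rewrite E sqrtCM ?nnegrE ?exprn_ge0 //; last first.
  exact: (dnorm_ge0 (dotmx (n:=n))).
by rewrite sqrCK // -(vnormE u).
Qed.
Lemma vnorm_eq0 u : vnorm u = 0 -> u = 0.
Proof.
move=> H; have := vnormE u; rewrite H => /esym/eqP; rewrite sqrtC_eq0 => /eqP H2.
by apply/eqP; rewrite -(dnorm_eq0 (dotmx (n:=n))); apply/eqP; exact: H2.
Qed.
Lemma vnorm0 : vnorm 0 = 0.
Proof.
apply: complexI; rewrite vnormE (_ : dotmx 0 0 = 0) ?sqrtC0 //.
by apply/eqP; rewrite (dnorm_eq0 (dotmx (n:=n))).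
Qed.
Lemma vnormC_sqr u : (vnorm u)%:C ^+ 2 = dotmx u u.
Proof. by rewrite vnormE sqrtCK. Qed.
Lemma vnorm_sqr u : ((vnorm u) ^+ 2)%:C = dotmx u u.
Proof. by rewrite rmorphXn /= vnormE sqrtCK. Qed.

Lemma vnorm_scaleR (r : R) u : 0 <= r -> vnorm (r%:C *: u) = r * vnorm u.
Proof. by move=> r0; apply: complexI; rewrite vnormZ rmorphM ger0_norm // lecR. Qed.

Lemma coord_le_vnorm (u : 'rV[C]_n) i : `|u 0 i| <= (vnorm u)%:C.
Proof.
rewrite -ler_sqr ?nnegrE // ?lecR ?vnorm_ge0 // vnormC_sqr dotmxE mxE.
by rewrite (bigD1 i) //= !mxE -normCK lerDl; apply: sumr_ge0 => j _;
  rewrite !mxE -normCK exprn_ge0.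
Qed.

Lemma vnorm_sum (I : Type) (r : seq I) (F : I -> 'rV[C]_n) :
  vnorm (\sum_(i <- r) F i) <= \sum_(i <- r) vnorm (F i).
Proof.
elim: r => [|i r IH]; first by rewrite !big_nil vnorm0.
by rewrite !big_cons (le_trans (vnormD _ _)) // lerD2l.
Qed.

Lemma vnorm_mulmx_bound x u : vnorm (u *m x) <= (\sum_i vnorm (row i x)) * vnorm u.
Proof.
rewrite mulmx_sum_row (le_trans (vnorm_sum _ _)) // mulr_suml; apply: ler_sum => i _.
rewrite -lecR vnormZ rmorphM mulrC.
by apply: ler_wpM2l; [rewrite lecR vnorm_ge0|exact: coord_le_vnorm].
Qed.

Fact opnorm_subproof (x : 'M[C]_n) : {r : R | [/\ 0 <= r,
  forall u, vnorm (u *m x) <= r * vnorm u &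
  forall M, 0 <= M -> (forall u, vnorm (u *m x) <= M * vnorm u) -> r <= M]}.
Proof.
pose E : set R := [set r | exists2 u, vnorm u <= 1 & r = vnorm (u *m x)].
have ubE : has_ubound E.
  exists (\sum_i vnorm (row i x)) => _ [u u1 ->].
  apply: le_trans (vnorm_mulmx_bound x u) _.
  by rewrite ler_piMr //; apply: sumr_ge0 => i _; exact: vnorm_ge0.
exists (sup E); split.
- by apply: (ub_le_sup ubE); exists 0; rewrite ?mul0mx vnorm0 ?ler01.
- move=> u; have [u0|u0] := eqVneq (vnorm u) 0.
    by rewrite (vnorm_eq0 u0) mul0mx !vnorm0 mulr0.
  have up : 0 < vnorm u by rewrite lt_def u0 vnorm_ge0.
  rewrite -ler_pdivrMr //.
  have : vnorm (((vnorm u)^-1)%:C *: u *m x) <= sup E.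
    apply: (ub_le_sup ubE); exists (((vnorm u)^-1)%:C *: u) => //.
    by rewrite vnorm_scaleR ?invr_ge0 ?vnorm_ge0 // mulVf.
  by rewrite -scalemxAl vnorm_scaleR ?invr_ge0 ?vnorm_ge0 // mulrC.
- move=> M M0 H; apply: ge_sup.
    by exists (vnorm (0 *m x)); exists 0; rewrite ?vnorm0 ?ler01.
  by move=> _ [u u1 ->]; rewrite (le_trans (H u)) // ler_piMr.
Qed.

Definition opnorm x : R := sval (opnorm_subproof x).

Lemma opnorm_ge0 x : 0 <= opnorm x.
Proof. by case: (svalP (opnorm_subproof x)). Qed.

Lemma vnorm_mulmx x u : vnorm (u *m x) <= opnorm x * vnorm u.
Proof. by case: (svalP (opnorm_subproof x)). Qed.

Lemma opnorm_le x M : 0 <= M -> (forall u, vnorm (u *m x) <= M * vnorm u) -> opnorm x <= M.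
Proof. by case: (svalP (opnorm_subproof x)) => _ _; apply. Qed.

Lemma opnorm_eq0 x : opnorm x = 0 -> x = 0.
Proof.
move=> x0; apply/row_matrixP => i; rewrite row0 rowE; apply: vnorm_eq0; apply/eqP.
by rewrite eq_le vnorm_ge0 andbT (le_trans (vnorm_mulmx _ _)) // x0 mul0r.
Qed.

Lemma opnormD x y : opnorm (x + y) <= opnorm x + opnorm y.
Proof.
apply: opnorm_le => [|u]; first by rewrite addr_ge0 ?opnorm_ge0.
by rewrite mulmxDr mulrDl (le_trans (vnormD _ _)) // lerD ?vnorm_mulmx.
Qed.

Lemma opnormM x y : opnorm (x *m y) <= opnorm x * opnorm y.
Proof.
apply: opnorm_le => [|u]; first by rewrite mulr_ge0 ?opnorm_ge0.
rewrite mulmxA; apply: (le_trans (vnorm_mulmx y (u *m x))).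
move: (vnorm_mulmx x u) (opnorm_ge0 y).
move: (opnorm x) (opnorm y) (vnorm (u *m x)) (vnorm u) => a b c d H b0.
by rewrite (mulrC a) -mulrA ler_wpM2l.
Qed.

Lemma opnormZ (k : C) x : (opnorm (k *: x))%:C = `|k| * (opnorm x)%:C.
Proof.
pose r := complex.Re `|k|.
have rE : `|k| = r%:C by rewrite /r RRe_real // ger0_real.
have r0 : (0 : R) <= r by rewrite -lecR -rE; exact: normr_ge0.
have le (l : C) (s : R) y : `|l| = s%:C -> 0 <= s -> opnorm (l *: y) <= s * opnorm y.
  move=> lE s0; apply: opnorm_le => [|u]; first by rewrite mulr_ge0 ?opnorm_ge0.
  rewrite -scalemxAr -lecR vnormZ lE -rmorphM lecR -mulrA ler_wpM2l //.
  exact: vnorm_mulmx.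
rewrite rE -rmorphM; congr (_%:C); apply/eqP; rewrite eq_le le //=.
have [k0|k0] := eqVneq k 0.
  have -> : r = 0 by apply: complexI; rewrite -rE k0 normr0.
  by rewrite mul0r opnorm_ge0.
have r1 : 0 < r by rewrite lt_def r0 andbT; apply: contra k0 => /eqP r0';
  rewrite -normr_eq0 rE r0'.
have := le k^-1 r^-1 (k *: x); rewrite scalerA mulVf // scale1r => H.
rewrite -ler_pdivlMl //; apply: H; last by rewrite invr_ge0.
by rewrite normfV rE fmorphV.
Qed.

(** Cauchy-Schwarz. Matrices act on row vectors from the right, so the squared norm of u x is the
    inner product of u x x^* with u, and x x^* appears instead of x^* x. *)
Lemma opnorm_sqr_le x : opnorm x ^+ 2 <= opnorm (x *m ctr x).
Proof.
suff : opnorm x <= Num.sqrt (opnorm (x *m ctr x)).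
  by move=> H; rewrite -(sqr_sqrtr (opnorm_ge0 (x *m
    ctr x))) ler_sqr ?nnegrE ?sqrtr_ge0 ?opnorm_ge0.
apply: opnorm_le => [|u]; first exact: sqrtr_ge0.
rewrite -ler_sqr ?nnegrE ?mulr_ge0 ?sqrtr_ge0 ?vnorm_ge0 // exprMn sqr_sqrtr ?opnorm_ge0 //.
have H : ((vnorm (u *m x)) ^+ 2)%:C = dotmx (u *m x *m ctr x) u.
  rewrite vnorm_sqr dotmxE [RHS]dotmxE trmx_mul map_mxM.
  by rewrite [in RHS]/ctr !mulmxA.
rewrite -lecR H (le_trans (real_ler_norm _)) //.
  by rewrite -H ger0_real // lecR exprn_ge0 ?vnorm_ge0.
rewrite (le_trans (dotmx_le _ _)) // lecR expr2 mulrA ler_wpM2r ?vnorm_ge0 //.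
by rewrite -mulmxA vnorm_mulmx.
Qed.

(** Apply the previous inequality to the adjoint of x, bound the product by submultiplicativity, and
    cancel one factor. *)
Lemma opnorm_ctr_le x : opnorm (ctr x) <= opnorm x.
Proof.
have := opnorm_sqr_le (ctr x); rewrite ctr_K => H.
move: (le_trans H (opnormM (ctr x) x)) (opnorm_ge0 (ctr x)) (opnorm_ge0 x).
move: (opnorm (ctr x)) (opnorm x) => a b {H} H a0 b0.
have [->//|an0] := eqVneq a 0.
by rewrite -(ler_pM2l (x := a)) // lt_def an0.
Qed.

Lemma opnorm_ctr x : opnorm (ctr x) = opnorm x.
Proof.
apply: le_anti; apply/andP; split; first exact: opnorm_ctr_le.
by have := opnorm_ctr_le (ctr x); rewrite ctr_K.
Qed.

Lemma opnorm_cstar x : opnorm (ctr x *m x) = opnorm x ^+ 2.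
Proof.
have := opnorm_sqr_le (ctr x); rewrite ctr_K => H.
move: (opnorm_ctr x) (opnormM (ctr x) x) H.
move: (opnorm (ctr x)) (opnorm x) (opnorm (ctr x *m x)) => a b c -> H1 H2.
by apply: le_anti; rewrite H2 andbT.
Qed.
End OperatorNorm.

Lemma conj_comm (A : pzRingType) n (P P' D w : 'M[A]_n) : P *m P' = 1%:M -> P' *m P = 1%:M ->
  (P' *m D *m P) *m w = w *m (P' *m D *m P) <-> D *m (P *m w *m P') = (P *m w *m P') *m D.
Proof.
move=> H1 H2; split=> H.
  have := congr1 (fun z => P *m z *m P') H; rewrite !mulmxA H1 mul1mx => ->.
  by rewrite -[_ *m P *m P']mulmxA H1 mulmx1.
have := congr1 (fun z => P' *m z *m P) H; rewrite !mulmxA H2 mul1mx => <-.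
by rewrite -[_ *m P' *m P]mulmxA H2 mulmx1.
Qed.

Lemma spectral_decomp (R : realType) n (b : 'M[R[i]]_n) : ctr b = b ->
  exists (P : 'M[R[i]]_n) (d : 'rV[R[i]]_n), [/\ P *m ctr P = 1%:M, ctr P *m P = 1%:M & b =
    ctr P *m diag_mx d *m P].
Proof.
move=> bh; exists (spectralmx b), (spectral_diag b).
have Pu : spectralmx b \is unitarymx := spectral_unitarymx b.
have PP : spectralmx b *m ctr (spectralmx b) = 1%:M by apply/unitarymxP.
split=> //; first exact: mulmx1C.
have /orthomx_spectralP : b \is normalmx.
  by apply/normalmxP; rewrite (bh : map_mx Num.conj b^T = b).
by rewrite invmx_unitary.
Qed.

Section Positive.
Variables (R : realType) (G : woronowicz R) (n : nat).
Local Notation C := (R[i]).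

(* A square root is found by diagonalizing b: in an eigenbasis, w commutes with
   b iff its coefficients vanish between distinct eigenvalues. *)
Lemma psd_sqrt_End (w : 'M[G]_n) (b : 'M[C]_n) : ctr b = b ->
  (forall c : 'M[C]_n, 0 <= \tr (b *m (c *m ctr c))) -> End w b ->
  exists2 y, End w y & b = ctr y *m y.
Proof.
move=> bh bpos bw; have [P [d [PP PP' bE]]] := spectral_decomp bh.
have d0 i : 0 <= d 0 i.
  (* With this c the trace is the eigenvalue [d 0 i]. *)
  have := bpos (ctr P *m delta_mx i i).
  have dh : ctr (delta_mx i i : 'M[C]_n) = delta_mx i i.
    by apply/matrixP => k l; rewrite !mxE andbC; case: (_ && _); [exact: conjC1|exact: conjC0].
  rewrite (ctr_mul (ctr P)) ctr_K dh bE mxtrace_mulC !mulmxA.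
  rewrite -[_ *m P *m ctr P]mulmxA PP mulmx1 mxtrace_mulC !mulmxA PP mul1mx.
  rewrite mul_delta_mx mxtrace_mulC.
  suff -> : \tr (diag_mx d *m delta_mx i i) = d 0 i by [].
  rewrite mul_diag_mx /mxtrace (bigD1 i) //= !mxE !eqxx mulr1 big1 ?addr0 // => j /negbTE ji.
  by rewrite !mxE ji mulr0.
pose s : 'rV[C]_n := map_mx sqrtC d.
have sh : ctr (diag_mx s) = diag_mx s.
  apply/matrixP => k l; rewrite !mxE eq_sym; case: eqP => [->|_]; last by rewrite mulr0n;
    exact: conjC0.
  by rewrite mulr1n; apply: conj_Creal; rewrite ger0_real // sqrtC_ge0.
have ss : diag_mx s *m diag_mx s = diag_mx d.
  apply/matrixP => k l; rewrite mul_diag_mx !mxE.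
  by case: eqP => [->|_]; rewrite ?mulr1n ?mulr0n ?mulr0 // -expr2 sqrtCK.
have diagl (t : 'rV[C]_n) (v : 'M[G]_n) i j : (lift_mx G (diag_mx t) *m v) i j =
  t 0 i *: v i j.
  rewrite mul_liftAE (bigD1 i) //= mxE eqxx mulr1n big1 ?addr0 // => k /negbTE ki.
  by rewrite mxE eq_sym ki mulr0n scale0r.
have diagr (t : 'rV[C]_n) (v : 'M[G]_n) i j : (v *m lift_mx G (diag_mx t)) i j =
  t 0 j *: v i j.
  rewrite mulA_liftE (bigD1 j) //= mxE eqxx mulr1n big1 ?addr0 // => k /negbTE ki.
  by rewrite mxE ki mulr0n scale0r.
have Ps (w' : 'M[G]_n) : lift_mx G (diag_mx d) *m w' = w' *m lift_mx G (diag_mx d) ->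
    lift_mx G (diag_mx s) *m w' = w' *m lift_mx G (diag_mx s).
  move=> H; apply/matrixP => i j; move/matrixP: H => /(_ i j).
  rewrite !diagl !diagr ![s _ _]mxE => /eqP.
  rewrite -subr_eq0 -scalerBl scaler_eq0 => /orP [|/eqP ->]; last by rewrite !scaler0.
  by rewrite subr_eq0 => /eqP ->.
have L1 : lift_mx G P *m lift_mx G (ctr P) = 1%:M by rewrite -lift_mxM PP lift_mx1.
have L2 : lift_mx G (ctr P) *m lift_mx G P = 1%:M by rewrite -lift_mxM PP' lift_mx1.
exists (ctr P *m diag_mx s *m P).
  rewrite /End /Defs.Hom /mkset !lift_mxM.
  apply: (proj2 (conj_comm _ w L1 L2)); apply: Ps; apply: (proj1 (conj_comm _ w L1 L2)).
  by rewrite -!lift_mxM -bE; exact: bw.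
rewrite (ctr_mul (ctr P *m diag_mx s) P) (ctr_mul (ctr P)) ctr_K sh bE -ss !mulmxA.
by rewrite -[_ *m P *m ctr P]mulmxA PP mulmx1.
Qed.
End Positive.

(** * The letters v and hat v *)

Section GenericTensors.
Variables (R : realType) (m : nat).
Local Notation C := (R[i]).
Local Notation widx := (widx m).

Lemma sum_letters2 (V : nmodType) (F : 'I_m.+1 -> 'I_m.+1 -> V) :
  \sum_(k : 'I_(widx 2)) F (letters k 0) (letters k 1) = \sum_a \sum_b F a b.
Proof.
rewrite (@sum_glue m V 1 1 2) //.
rewrite -sum_letters1; apply: eq_bigr => k _; rewrite -sum_letters1; apply: eq_bigr => l _.
by rewrite !idxK.
Qed.

Lemma stens2E (B : pzSemiRingType) (X : nat -> 'M[B]_m.+1) k l :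
  stens 2 X k l = X 0 (letters k 0) (letters l 0) * X 1 (letters k 1) (letters l 1).
Proof. by rewrite mxE big_ord_recl big_ord1. Qed.

Lemma ximxE (q : 'M[C]_m.+1) k l : ximx q k l = q (letters k 0) (letters k 1).
Proof. by rewrite mxE !(tnth_nth ord0). Qed.

(** All computations with the e_k rest on this formula: on xi(q) the first leg acts by left
    multiplication and the second, written in the conjugate basis, by right multiplication with the
    transpose. *)
Lemma stens2_ximx (Y Z q : 'M[C]_m.+1) :
  stens 2 (pair2 Y Z) *m ximx q = ximx (Y *m q *m Z^T).
Proof.
apply/matrixP => k l; rewrite ximxE !mxE.
transitivity (\sum_a \sum_b Y (letters k 0) a * q a b * Z (letters k 1) b).
  rewrite -(sum_letters2 (fun a b => Y (letters k 0) a * q a b * Z (letters k 1) b)).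
  by apply: eq_bigr => r _; rewrite stens2E ximxE /= mulrAC.
rewrite exchange_big; apply: eq_bigr => b _ /=.
by rewrite !mxE mulr_suml.
Qed.

Lemma ximx_dot (q q' : 'M[C]_m.+1) : ctr (ximx q) *m ximx q' = (\tr (ctr q *m q'))%:M.
Proof.
apply/matrixP => i j; rewrite !ord1 [RHS]mxE eqxx mulr1n mxE.
transitivity (\sum_a \sum_b (q a b)^* * q' a b).
  rewrite -(sum_letters2 (fun a b => (q a b)^* * q' a b)).
  by apply: eq_bigr => r _; rewrite ctrE !ximxE.
rewrite exchange_big; apply: eq_bigr => b _; rewrite mxE.
by apply: eq_bigr => a _; rewrite ctrE.
Qed.

Lemma ctr_pair_mx (x y : 'M[C]_(widx 2, 1)) : ctr (x *m ctr y) = y *m ctr x.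
Proof. by rewrite ctr_mul ctr_K. Qed.

Lemma mx11_mul n p (x : 'M[C]_(n, 1)) (c : C) (y : 'M[C]_(1, p)) : x *m c%:M *m y = c *: (x *m
  y).
Proof. by rewrite mul_mx_scalar scalemxAl. Qed.

Lemma mxtrace_place (V : nat -> 'M[C]_m.+1) p q a (x : Lop R m p) : (a + p <= q)%N ->
  (forall b, \tr (V b) = 1) ->
  \tr (stens q V *m place q a x) = \tr (stens p (shiftn a V) *m x).
Proof.
move=> apq HV.
apply: (@stens_ext m _ p C^o (fun x => \tr (stens q V *m
  place q a x)) (fun x => \tr (stens p (shiftn a V) *m x))) => [||X].
- apply: lin_comp (@lin_trace _ _) _.
  exact: lin_comp (lin_mull _) (@place_linear _ _ _ _ _).
- exact: lin_comp (@lin_trace _ _) (lin_mull _).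
rewrite place_st // !stens_mul !mxtrace_st /shiftn.
rewrite [RHS](eq_bigr (fun b : 'I_p => \tr (V (a + b)%N *m X (a + b - a)%N))); last first.
  by move=> b _; rewrite addKn.
rewrite (prod_window (fun b => \tr (V b *m X (b - a)%N)) apq).
by apply: eq_bigr => b _; rewrite /pad; case: ifP => // _; rewrite mulmx1.
Qed.

Lemma ptrace_left_scale p q n (c : C) M (x : 'M[C]_(widx n)) :
  ptrace_left (p := p) q (c *: M) x = c *: ptrace_left q M x.
Proof.
apply/matrixP => k l; rewrite !mxE mulr_sumr; apply: eq_bigr => a _.
by rewrite mulr_sumr; apply: eq_bigr => b _; rewrite !mxE mulrA.
Qed.

Lemma ptrace_right_scale p q n (c : C) M (x : 'M[C]_(widx n)) :
  ptrace_right (q := q) p (c *: M) x = c *: ptrace_right p M x.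
Proof.
apply/matrixP => k l; rewrite !mxE mulr_sumr; apply: eq_bigr => a _.
by rewrite mulr_sumr; apply: eq_bigr => b _; rewrite !mxE mulrA.
Qed.

Lemma widx_gt0 p : (0 < widx p)%N.
Proof. exact: leq_ltn_trans (leq0n _) (ltn_ord (idx p (fun _ => ord0))). Qed.

(** The length enters through an equation because it is used at [j - j]. *)
Lemma Lop0_scalar p (x : Lop R m p) : p = 0%N -> exists c : C, x = c%:M.
Proof.
move=> p0; pose k0 := idx p (fun _ => ord0 : 'I_m.+1).
have kE (k : 'I_(widx p)) : k = k0.
  by rewrite -[k]lettersK; apply: eq_idx => b bp; have : (b < 0)%N by rewrite -p0.
by exists (x k0 k0); apply/matrixP => k l; rewrite !mxE (kE k) (kE l) eqxx.
Qed.

Lemma place_inj p q a (x y : Lop R m p) : (a + p <= q)%N -> place q a x = place q a y -> x = y.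
Proof.
move=> apq H; apply/matrixP => k l.
pose ext (s : nat -> 'I_m.+1) b : 'I_m.+1 := if (a <= b)%N && (b < a +
  p)%N then s (b - a)%N else ord0.
have extE k' : idx p (shiftn a (ext (letters k'))) = k'.
  rewrite -[RHS]lettersK; apply: eq_idx => b bp.
  by rewrite /shiftn /ext leq_addr ltn_add2l bp addKn.
have := congr1 (fun M : 'M[C]_(widx q) => M (idx q (ext (letters k))) (idx q (ext (letters
  l)))) H.
rewrite !placeE // !extE.
have -> : [forall b : 'I_q, (a <= b < a + p)%N || (ext (letters k) b == ext (letters l) b)].
  by apply/forallP => b; rewrite /ext; case: ifP => //= _; rewrite eqxx.
by rewrite !mul1r.
Qed.

Lemma eq_mxtrace_mul n (x y : 'M[C]_n) : (forall c, \tr (x *m c) = \tr (y *m c)) -> x = y.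
Proof.
move=> H; apply/matrixP => i j.
have E (z : 'M[C]_n) : \tr (z *m delta_mx j i) = z i j.
  rewrite /mxtrace (bigD1 i) //= big1 ?addr0 => [|k /negbTE ki].
    rewrite mxE (bigD1 j) //= mxE !eqxx mulr1 big1 ?addr0 // => k /negbTE kj.
    by rewrite mxE kj mulr0.
  by rewrite mxE big1 // => l _; rewrite mxE ki andbF mulr0.
by rewrite -!E H.
Qed.
End GenericTensors.

Lemma mxtrace_scaled (K : comPzRingType) n (A A' B B' Y Y' : 'M[K]_n) (c e : K) :
  Y' = c *: Y -> A' = e *: A -> B' = e *: B -> \tr (A *m Y) = \tr (B *m Y) ->
  \tr (A' *m Y') = \tr (B' *m Y').
Proof. by move=> -> -> -> H; rewrite -!scalemxAl -!scalemxAr !mxtraceZ H. Qed.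

Lemma mxtrace_comm_cycle (K : comPzRingType) n (A X B : 'M[K]_n) : A *m B = B *m A ->
  \tr (A *m X *m B) = \tr (B *m (X *m A)).
Proof.
by move=> AB; rewrite -mulmxA mxtrace_mulC [RHS]mxtrace_mulC -!mulmxA AB.
Qed.

Section Letters.
Variables (R : realType) (G : woronowicz R).
Variables (h : G -> R[i]) (hh : haar_state h).
Variables (f : R[i] -> G -> R[i]) (hf : canonical_characters h f).
Variables (m : nat) (v : 'M[G]_m.+1) (hv : unitary_corep v).
Local Notation C := (R[i]).
Local Notation widx := (widx m).
Local Notation lft := (@lift_mx R G _ _).

(** Letters are counted from 0 here, whereas [letter] counts positions from 1: the word [i,j]
    consists of the letters i, ..., j - 1, and even indices carry [v]. *)
Definition letter_at a : 'M[G]_m.+1 := letter f v a.+1.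
Local Notation w := letter_at.

Lemma letter_at_corep a : unitary_corep (w a).
Proof. by rewrite /letter_at /letter; case: ifP => _ //; exact: (hat_corep hf hv). Qed.

(** Each letter is the dual of the preceding one, also after [hat f v] by [hatK]; so both parities
    of the Jones projections are treated at once. *)
Lemma hat_letter_at a : hat f (w a) = w a.+1.
Proof. by rewrite /letter_at /letter /=; case: (odd a) => //=; rewrite (hatK hf hv). Qed.

Lemma Fmx_next z a : Fmx f z (w a.+1) = (Fmx f (- z) (w a))^T.
Proof. by rewrite -hat_letter_at (Fmx_hat hf (letter_at_corep a)). Qed.

Lemma tr_FmxN n (u : 'M[G]_n) : unitary_corep u -> \tr (Fmx f (-1) u) = \tr (Fmx f 1 u).
Proof. by move=> hu; have := spherical hf hu hh (End1 u); rewrite !mulmx1. Qed.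

Definition wdim : C := qdim f v.
Local Notation d := wdim.

Lemma wdim_gt0 : 0 < d. Proof. exact: (qdim_gt0 hf hv (ltn0Sn m)). Qed.
Lemma wdim_neq0 : d != 0. Proof. by rewrite gt_eqF ?wdim_gt0. Qed.

(** For the dual letters this trace is that of F_(-1) of [v], and sphericality at the identity
    equates the two. *)
Lemma tr_Fmx1 a : \tr (Fmx f 1 (w a)) = d.
Proof.
rewrite /wdim (qdimE hf hv) /letter_at /letter; case: ifP => _ //.
by rewrite (Fmx_hat hf hv) mxtrace_tr tr_FmxN.
Qed.
Lemma tr_FmxN1 a : \tr (Fmx f (-1) (w a)) = d.
Proof. by rewrite tr_FmxN ?tr_Fmx1 //; exact: letter_at_corep. Qed.

Definition weight_r a : 'M[C]_m.+1 := d^-1 *: Fmx f 1 (w a).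
Definition weight_l a : 'M[C]_m.+1 := d^-1 *: Fmx f (-1) (w a).

Lemma tr_weight_r a : \tr (weight_r a) = 1.
Proof. by rewrite mxtraceZ tr_Fmx1 mulVf ?wdim_neq0. Qed.
Lemma tr_weight_l a : \tr (weight_l a) = 1.
Proof. by rewrite mxtraceZ tr_FmxN1 mulVf ?wdim_neq0. Qed.

Lemma Fmx_st z n (u : nat -> 'M[G]_m.+1) : (forall a, unitary_corep (u a)) ->
  Fmx f z (stens n u) = stens n (fun a => Fmx f z (u a)).
Proof.
move=> hu; apply/matrixP => k l; rewrite !mxE (char_prod hf); last first.
  by move=> a; exact: (corep_coef (hu a)).
by apply: eq_bigr => a _; rewrite mxE.
Qed.

(** Given by length and first letter, which avoids the subtraction in [word_corep]. *)
Definition word n i : 'M[G]_(widx n) := stens n (shiftn i w).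

Lemma word_unitary_corep n i : unitary_corep (word n i).
Proof. by apply: stens_corep => a; exact: letter_at_corep. Qed.

Lemma word_corepE i j : word_corep f v i j = word (j - i) i.
Proof.
apply/matrixP => k l; rewrite !mxE; apply: eq_bigr => a _.
by rewrite !(tnth_nth ord0) /shiftn /letter_at addnS.
Qed.

Lemma stens_weight_r n i : stens n (shiftn i weight_r) = (d^-1 ^+ n) *: Fmx f 1 (word n i).
Proof.
rewrite Fmx_st; last by move=> a; exact: letter_at_corep.
have E := stens_scale n (fun _ => d^-1) (fun a => Fmx f 1 (shiftn i w a)).
by rewrite prodr_const card_ord in E.
Qed.

Lemma stens_weight_l n i : stens n (shiftn i weight_l) = (d^-1 ^+ n) *: Fmx f (-1) (word n i).
Proof.
rewrite Fmx_st; last by move=> a; exact: letter_at_corep.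
have E := stens_scale n (fun _ => d^-1) (fun a => Fmx f (-1) (shiftn i w a)).
by rewrite prodr_const card_ord in E.
Qed.

Lemma qdim_word n i : qdim f (word n i) = d ^+ n.
Proof.
rewrite (qdimE hf (word_unitary_corep n i)) Fmx_st; last by move=> a; exact: letter_at_corep.
rewrite mxtrace_st (eq_bigr (fun=> d)) ?prodr_const ?card_ord // => a _.
exact: tr_Fmx1.
Qed.

(** Q^2 of a word is the simple tensor of the F_1 of its letters, so the canonical trace slices
    every letter with the right weight. *)
Lemma qtrace_word n i y : qtrace f (word n i) y = \tr (stens n (shiftn i weight_r) *m y).
Proof.
by rewrite (qtraceE hf (word_unitary_corep n i)) qdim_word stens_weight_r -scalemxAl mxtraceZ
  exprVn.
Qed.

Local Notation "'E'" := (expect weight_l weight_r).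
Local Notation tr_out := (ptrace weight_l weight_r).

Lemma End_scale n (u : 'M[G]_n) (c : C) x : End u x -> End u (c *: x).
Proof.
move=> Hx; rewrite -[c *: x]addr0 -(scale0r x); apply: End_lin => //.
have := End_lin (-1) Hx Hx; rewrite scaleN1r addNr => H0.
by rewrite scale0r.
Qed.

(** The products of weights outside the window are, up to scalars, F_(-1) and F_1 of the
    corresponding subwords, to which the two slice lemmas for intertwiners apply. *)
Lemma ptrace_End i j n x : (i <= j <= n)%N -> End (word n 0) x ->
  End (word (j - i) i) (tr_out i j x).
Proof.
move=> /andP [ij jn] Hx; rewrite /ptrace.
rewrite (stens_weight_l i 0 : stens i weight_l =
  _) stens_weight_r ptrace_left_scale ptrace_right_scale (linZ (@ptrace_left_linear _ _ _ _ _
    _)).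
do 2!apply: End_scale.
apply: (ptrace_left_End hf (esym (subnKC ij)) letter_at_corep).
exact: (ptrace_right_End hf (esym (subnKC jn)) letter_at_corep).
Qed.

Lemma mxtrace_ptr r n x : (r <= n)%N ->
  \tr (stens n weight_r *m x) = \tr (stens r weight_r *m
    ptrace_right r (stens (n - r) (shiftn r weight_r)) x).
Proof.
move=> rn.
apply: (@stens_ext m _ n C^o (fun x => \tr (stens n weight_r *m x))
  (fun x => \tr (stens r weight_r *m
    ptrace_right r (stens (n - r) (shiftn r weight_r)) x))) => [||X].
- exact: lin_comp (@lin_trace _ _) (lin_mull _).
- apply: lin_comp (@lin_trace _ _) _.
  exact: lin_comp (lin_mull _) (@ptrace_right_linear _ _ _ _ _ _).
rewrite ptrace_right_st ?subnKC // -scalemxAr mxtraceZ !stens_mul !mxtrace_st /shiftn mulrC.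
by rewrite -[in LHS](subnKC rn) big_split_ord.
Qed.

Lemma expect_diag r n x : (r <= n)%N ->
  E r r x = (\tr (stens r weight_l *m
    ptrace_right r (stens (n - r) (shiftn r weight_r)) x))%:M :> 'M[C]_(widx n).
Proof.
move=> rn; move: x; apply: stens_ext => [||X].
- exact: expect_linear.
- apply: lin_comp (@lin_scalar _ _) _; apply: lin_comp (@lin_trace _ _) _.
  exact: lin_comp (lin_mull _) (@ptrace_right_linear _ _ _ _ _ _).
rewrite expect_st ?leqnn // ptrace_right_st ?subnKC // -scalemxAr mxtraceZ !stens_mul
  !mxtrace_st /shiftn mulrC.
rewrite -scalemx1 -[1%:M]stens1; congr (_ *: _); last first.
  by apply: eq_stens => b bn; rewrite /inner; case: ifP => // ?; exfalso; lia.
transitivity (\prod_(b < r + (n - r)) outer weight_l weight_r r r b (X b));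
  first by rewrite subnKC.
rewrite big_split_ord; congr (_ * _); apply: eq_bigr => b _ /=; rewrite /outer.
  by rewrite ltn_ord.
by rewrite ltnNge leq_addr.
Qed.

(** Slicing the letters from r on leaves an intertwiner [y] of the first r letters, and on it
    [spherical] allows F_(-1) to be replaced by F_1. Hence the cut r does not matter. *)
Lemma expect_diag_End r n x : (r <= n)%N -> End (word n 0) x ->
  E r r x = (\tr (stens n weight_r *m x))%:M :> 'M[C]_(widx n).
Proof.
move=> rn Hx; rewrite expect_diag //; apply: (congr1 (fun c => c%:M)).
rewrite (mxtrace_ptr x rn).
pose y := ptrace_right r (Fmx f 1 (word (n - r) r)) x.
have yE : ptrace_right r (stens (n - r) (shiftn r weight_r)) x =
  d^-1 ^+ (n - r) *: y by rewrite stens_weight_r ptrace_right_scale.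
have Hy : End (word r 0) y := ptrace_right_End hf (esym (subnKC rn)) letter_at_corep Hx.
have El : stens r weight_l = d^-1 ^+ r *: Fmx f (-1) (word r 0) := stens_weight_l r 0.
have Er : stens r weight_r = d^-1 ^+ r *: Fmx f 1 (word r 0) := stens_weight_r r 0.
have S := spherical hf (word_unitary_corep r 0) hh Hy.
exact: (mxtrace_scaled yE El Er S).
Qed.

Lemma wN_real z : z \is Num.real -> forall a, ctr (Fmx f z (w a)) = Fmx f z (w a).
Proof. by move=> zr a; apply: (Fmx_real hf (letter_at_corep a) zr). Qed.

(** The weights outside the window form a self-adjoint matrix [D] that commutes with operators
    placed in the window, so the pairing of [ptrace_dual] is compatible with adjoints. *)
Lemma ptrace_ctr i j n x : (i <= j <= n)%N ->
  tr_out i j (ctr x : 'M[C]_(widx n)) = ctr (tr_out i j x).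
Proof.
move=> ijn; apply: eq_mxtrace_mul => c; rewrite ptrace_dual //.
have H : (i + (j - i) <= n)%N by lia.
set D := stens n _.
have Dh : ctr D = D.
  rewrite /D ctr_st; apply: eq_stens => b _.
  have dr : (d^-1)^* = d^-1.
    by apply: conj_Creal; rewrite ger0_real // invr_ge0 ltW ?wdim_gt0.
  have ctrZ' (y : 'M[C]_m.+1) : ctr (d^-1 *: y) = d^-1 *: ctr y.
    by apply/matrixP => k l; rewrite !mxE rmorphM; congr (_ * _).
  do ![case: ifP => _]; rewrite ?ctr1 // /weight_l /weight_r ctrZ' wN_real //;
    first [exact: real1 | by rewrite rpredN; exact: real1].
have Dc y : place n i (y : Lop R m (j - i)) *m D = D *m place n i y.
  by apply: place_st_comm => // b b1 b2; do ![case: ifP => ?]; first [by [] | exfalso; lia].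
have -> : \tr (ctr (tr_out i j x) *m c) = (\tr (tr_out i j x *m ctr c))^*.
  by rewrite -mxtrace_ctr ctr_mul ctr_K mxtrace_mulC.
rewrite ptrace_dual // -/D -mxtrace_ctr !ctr_mul ctr_place // ctr_K Dh.
exact: (mxtrace_comm_cycle _ (esym (Dc c))).
Qed.
End Letters.

(** * Jones projections *)

Section JonesElement.
Variables (R : realType) (m : nat).
Local Notation C := (R[i]).
Local Notation widx := (widx m).
Variables (q qi : 'M[C]_m.+1) (d : C).
Hypotheses (qh : ctr q = q) (qVl : qi *m q = 1%:M) (qVr : q *m qi = 1%:M).
Hypotheses (dq : \tr (q *m q) = d) (dpos : 0 < d).

(** The orthogonal projection onto the line of xi(q): the squared norm of this vector is Tr(q q) = d
    for self-adjoint q. *)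
Definition rank_one : Lop R m 2 := d^-1 *: (ximx q *m ctr (ximx q)).
Local Notation e := rank_one.

Let d0 : d != 0. Proof. by rewrite gt_eqF. Qed.

Lemma ctr_scale n p (c : C) (x : 'M[C]_(n, p)) : ctr (c *: x) = c^* *: ctr x.
Proof. by apply/matrixP => i j; rewrite !mxE rmorphM. Qed.

Lemma rank_one_herm : ctr e = e.
Proof.
have dr : (d^-1)^* = d^-1 by apply: conj_Creal; rewrite ger0_real // invr_ge0 ltW.
by rewrite /rank_one ctr_scale dr ctr_pair_mx.
Qed.

Lemma rank_one_sandwich (x : 'M[C]_(widx 2)) (c : C) :
  ctr (ximx q) *m (x *m ximx q) = c%:M -> e *m x *m e = (d^-1 * c) *: (e : 'M[C]_(widx 2)).
Proof.
move=> H; rewrite /rank_one -!scalemxAl -scalemxAr.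
have -> : ximx q *m ctr (ximx q) *m x *m (ximx q *m ctr (ximx q)) =
   ximx q *m (ctr (ximx q) *m (x *m ximx q)) *m ctr (ximx q) by rewrite !mulmxA.
rewrite H mx11_mul !scalerA; congr (_ *: _).
by rewrite mulrAC.
Qed.

Lemma rank_one_idem : e *m e = e.
Proof.
have := @rank_one_sandwich 1%:M d; rewrite mul1mx mulmx1 ximx_dot qh dq mulVf //.
by rewrite scale1r; apply.
Qed.

(** The vector state of xi(q), restricted to the first leg, has density q q / d; on the second leg
    the density is transposed. *)
Lemma rank_one_compress0 Y : e *m stens 2 (pair2 Y 1%:M) *m e =
  \tr ((d^-1 *: (q *m q)) *m Y) *: (e : 'M[C]_(widx 2)).
Proof.
rewrite (rank_one_sandwich (c := \tr (q *m q *m Y))); first by rewrite -scalemxAl mxtraceZ.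
by rewrite stens2_ximx trmx1 mulmx1 ximx_dot qh mulmxA mxtrace_mulC mulmxA.
Qed.

Lemma rank_one_compress1 Y : e *m stens 2 (pair2 1%:M Y) *m e =
  \tr ((d^-1 *: (q *m q)^T) *m Y) *: (e : 'M[C]_(widx 2)).
Proof.
rewrite (rank_one_sandwich (c := \tr ((q *m q)^T *m Y))); first by rewrite -scalemxAl mxtraceZ.
by rewrite stens2_ximx mul1mx ximx_dot qh mulmxA -mxtrace_tr trmx_mul trmxK mxtrace_mulC.
Qed.

Lemma rank_one_transfer1 Y : exists Y', stens 2 (pair2 1%:M Y) *m e =
  stens 2 (pair2 Y' 1%:M) *m e.
Proof.
(* The witness solves Y' q = q Y^T. *)
exists (q *m Y^T *m qi);
  rewrite /rank_one -!scalemxAr !mulmxA !stens2_ximx trmx1 mul1mx mulmx1.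
by rewrite -[_ *m qi *m q]mulmxA qVl mulmx1.
Qed.

Lemma rank_one_transfer0 Y : exists Y', stens 2 (pair2 Y 1%:M) *m e =
  stens 2 (pair2 1%:M Y') *m e.
Proof.
(* The witness solves q Y'^T = Y q. *)
exists (qi *m Y *m q)^T;
  rewrite /rank_one -!scalemxAr !mulmxA !stens2_ximx trmx1 mul1mx mulmx1.
by rewrite trmxK !mulmxA qVr mul1mx.
Qed.

Lemma rank_oneE k l k' l' : e (idx 2 (glue 1 (letters (n := 1) k) (letters (n := 1) l)))
     (idx 2 (glue 1 (letters (n := 1) k') (letters (n := 1) l'))) =
  d^-1 * (q (letters k 0) (letters l 0) * (q (letters k' 0) (letters l' 0))^*).
Proof. by rewrite mxE [X in _ * X]mxE big_ord1 ctrE !ximxE !idxK. Qed.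

(** The origin of lambda: [rank_one] and the weight contribute 1/d each, and the inner product of
    matrices is q qi qi q = 1. *)
Lemma ptrace_right_rank_one (X : nat -> 'M[C]_m.+1) : X 0 = d^-1 *: (qi *m qi)^T ->
  ptrace_right 1 (stens 1 X) e = (d ^- 2)%:M.
Proof.
move=> X0; apply/matrixP => k l; rewrite mxE.
transitivity (\sum_a \sum_b X 0 b a * (d^-1 * (q (letters k 0) a * (q (letters l 0) b)^*))).
  rewrite -(sum_letters1 (fun a => \sum_b X 0 b a * (d^-1 * (q (letters k 0) a * (q (letters l
    0) b)^*)))).
  apply: eq_bigr => c _; rewrite -(sum_letters1 (fun b => X 0 b (letters c 0) *
    (d^-1 * (q (letters k 0) (letters c 0) * (q (letters l 0) b)^*)))).
  by apply: eq_bigr => r _; rewrite stens1E rank_oneE.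
transitivity ((d^-1 *: (q *m (X 0)^T *m ctr q)) (letters k 0) (letters l 0)).
  rewrite mxE [X in _ = _ * X]mxE mulr_sumr exchange_big /=; apply: eq_bigr => b _.
  rewrite [X in _ = _ * (X * _)]mxE mulr_suml mulr_sumr; apply: eq_bigr => a _.
  by rewrite ctrE mxE; ring.
rewrite X0 linearZ /= trmxK -scalemxAr -scalemxAl scalerA qh !mulmxA qVr mul1mx qVl.
by rewrite mxE [RHS]mxE [X in _ * X]mxE letters1_eq mulr_natr -exprVn expr2.
Qed.

Lemma ptrace_left_rank_one (X : nat -> 'M[C]_m.+1) : X 0 = d^-1 *: (qi *m qi) ->
  ptrace_left 1 (stens 1 X) e = (d ^- 2)%:M.
Proof.
move=> X0; apply/matrixP => k l; rewrite mxE.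
transitivity (\sum_a \sum_b X 0 b a * (d^-1 * (q a (letters k 0) * (q b (letters l 0))^*))).
  rewrite -(sum_letters1 (fun a => \sum_b X 0 b a * (d^-1 * (q a (letters k 0) * (q b (letters
    l 0))^*)))).
  apply: eq_bigr => c _; rewrite -(sum_letters1 (fun b => X 0 b (letters c 0) *
    (d^-1 * (q (letters c 0) (letters k 0) * (q b (letters l 0))^*)))).
  by apply: eq_bigr => r _; rewrite stens1E rank_oneE.
transitivity ((d^-1 *: (ctr q *m X 0 *m q)) (letters l 0) (letters k 0)).
  rewrite mxE [X in _ = _ * X]mxE mulr_sumr; apply: eq_bigr => a _.
  rewrite [X in _ = _ * (X * _)]mxE mulr_suml mulr_sumr; apply: eq_bigr => b _.
  by rewrite ctrE; ring.
rewrite X0 -scalemxAr -scalemxAl scalerA qh !mulmxA qVr mul1mx qVl.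
by rewrite mxE [RHS]mxE [X in _ * X]mxE letters1_eq eq_sym mulr_natr -exprVn expr2.
Qed.
End JonesElement.

Section JonesEnd.
Variables (R : realType) (G : woronowicz R).
Variables (h : G -> R[i]) (f : R[i] -> G -> R[i]) (hf : canonical_characters h f).
Variables (m : nat) (u : nat -> 'M[G]_m.+1) (hu : forall a, unitary_corep (u a)).
Hypothesis u1 : u 1 = hat f (u 0).
Local Notation lft := (@lift_mx R G _ _).
Local Notation q := (Qmx f (u 0)).

Lemma ximx_invariant : stens 2 u *m lft (ximx q) = lft (ximx q).
Proof.
apply/matrixP => k l; rewrite mulA_liftE.
rewrite -[RHS](_ : lft q (letters k 0) (letters k 1) = _);
  last by rewrite !mxE !(tnth_nth ord0).
rewrite -(hat_invariant hf (hu 0)) -u1.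
transitivity (\sum_a \sum_b q a b *: (u 0 (letters k 0) a * u 1 (letters k 1) b)).
  rewrite -(sum_letters2 (fun a b => q a b *: (u 0 (letters k 0) a * u 1 (letters k 1) b))).
  by apply: eq_bigr => r _; rewrite ximxE stens2E.
rewrite exchange_big mxE; apply: eq_bigr => b _ /=.
rewrite mulA_liftE mulr_suml; apply: eq_bigr => a _.
by rewrite [(u 1)^T _ _]mxE -scalerAl.
Qed.

(** The vector xi(q) is fixed by the corepresentation; taking adjoints and using unitarity, so is
    the corresponding functional. *)
Lemma rank_one_End (d : R[i]) : End (stens 2 u) (rank_one q d).
Proof.
have [U1 U2] := corep_unitary (stens_corep 2 hu).
apply: End_scale; rewrite /End /Defs.Hom /mkset lift_mxM mulmxA ximx_invariant -mulmxA.
congr (_ *m _).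
have H : lft (ctr (ximx q)) *m adj (stens 2 u) = lft (ctr (ximx q)).
  have := congr1 (@adj R G _ _) ximx_invariant; rewrite adjM.
  by rewrite (adj_lift G).
by rewrite -[in LHS]H -mulmxA U1 mulmx1.
Qed.
End JonesEnd.

(** * The Popa system *)

Section PopaSystem.
Variables (R : realType) (G : woronowicz R).
Variables (h : G -> R[i]) (hh : haar_state h).
Variables (f : R[i] -> G -> R[i]) (hf : canonical_characters h f).
Variables (m : nat) (v : 'M[G]_m.+1) (hv : unitary_corep v).
Local Notation C := (R[i]).
Local Notation widx := (widx m).
Local Notation Lop := (Lop R m).
Local Notation w := (letter_at f v).
Local Notation d := (wdim f v).
Local Notation weight_r := (weight_r f v).
Local Notation weight_l := (weight_l f v).
Local Notation word := (word f v).

Lemma End_fd_cstar p (u : 'M[G]_(widx p)) : unitary_corep u ->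
  fd_cstar_subalg (End u : set (Lop p)).
Proof.
move=> hu; split.
- split.
  + exact: End1.
  + by move=> x y Hx Hy; have := End_lin 1 Hx Hy; rewrite scale1r.
  + by move=> k x Hx; exact: End_scale.
  + by move=> x y Hx Hy; exact: End_mul.
  + by move=> x Hx; exact: (End_ctr hu).
- exists (widx p * widx p)%N, (fun i => vec_mx (delta_mx 0 i)).
  move=> x _; exists (fun i => mxvec (x : 'M[C]_(widx p)) 0 i).
  rewrite -[LHS](mxvecK (x : 'M[C]_(widx p))) {1}[mxvec _]row_sum_delta linear_sum.
  by apply: eq_bigr => i _; rewrite linearZ.
- exists (@opnorm R (widx p)); split.
  + by move=> x _; exact: opnorm_ge0.
  + by move=> x _; exact: opnorm_eq0.
  + by move=> x y _ _; exact: opnormD.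
  + by move=> k x _; exact: opnormZ.
  + by move=> x y _ _; exact: opnormM.
  + by move=> x _; exact: opnorm_cstar.
Qed.

(** This is e_(b+2) on its own two letters, b and b + 1. *)
Definition jones_proj b : Lop 2 := rank_one (Qmx f (w b)) d.

Let wc := letter_at_corep hf hv.
Let dpos := wdim_gt0 hf hv.

Lemma tr_Qmx_letter_at b : \tr (Qmx f (w b) *m Qmx f (w b)) = d.
Proof. by rewrite (Qmx_sqr hf (wc b)) (tr_Fmx1 hh hf hv). Qed.

Lemma jones_proj_idem b : jones_proj b *m jones_proj b = jones_proj b.
Proof. exact: (rank_one_idem (Qmx_ctr hf (wc b)) (tr_Qmx_letter_at b) dpos). Qed.

Lemma jones_proj_herm b : ctr (jones_proj b) = jones_proj b.
Proof. exact: (rank_one_herm _ dpos). Qed.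

Lemma jones_proj_compress0 b Y : jones_proj b *m stens 2 (pair2 Y 1%:M) *m jones_proj b =
  \tr (weight_r b *m Y) *: (jones_proj b : 'M[C]_(widx 2)).
Proof.
by rewrite (rank_one_compress0 d (Qmx_ctr hf (wc b))) (Qmx_sqr hf (wc b)).
Qed.

(** The transposed density on the second leg is F_(-1) of the dual letter, that is, the left weight
    at b + 1. *)
Lemma jones_proj_compress1 b Y : jones_proj b *m stens 2 (pair2 1%:M Y) *m jones_proj b =
  \tr (weight_l b.+1 *m Y) *: (jones_proj b : 'M[C]_(widx 2)).
Proof.
rewrite (rank_one_compress1 d (Qmx_ctr hf (wc b))) (Qmx_sqr hf (wc b)).
by rewrite /weight_l (Fmx_next hf hv) opprK.
Qed.

Lemma jones_proj_transfer1 b Y :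
  exists Y', stens 2 (pair2 1%:M Y) *m jones_proj b = stens 2 (pair2 Y' 1%:M) *m jones_proj b.
Proof. exact: (rank_one_transfer1 d (QmxVl hf (wc b))). Qed.

Lemma jones_proj_transfer0 b Y :
  exists Y', stens 2 (pair2 Y 1%:M) *m jones_proj b = stens 2 (pair2 1%:M Y') *m jones_proj b.
Proof. exact: (rank_one_transfer0 d (QmxVr hf (wc b))). Qed.

Lemma jones_proj_ptr b : ptrace_right 1 (stens 1 (shiftn b.+1 weight_r)) (jones_proj b) =
  (d ^- 2)%:M.
Proof.
apply: (ptrace_right_rank_one (Qmx_ctr hf (wc b)) (QmxVl hf (wc b)) (QmxVr hf (wc b))).
by rewrite /shiftn addn0 (QmxN_sqr hf (wc b)) /weight_r (Fmx_next hf hv).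
Qed.

Lemma jones_proj_ptl b : ptrace_left 1 (stens 1 (shiftn b weight_l)) (jones_proj b) =
  (d ^- 2)%:M.
Proof.
apply: (ptrace_left_rank_one (Qmx_ctr hf (wc b)) (QmxVl hf (wc b)) (QmxVr hf (wc b))).
by rewrite /shiftn addn0 (QmxN_sqr hf (wc b)).
Qed.

Lemma jones_proj_End b : End (stens 2 (shiftn b w)) (jones_proj b).
Proof.
have := rank_one_End hf (u := shiftn b w) (fun a => wc _) _ d.
rewrite /shiftn addn0 addn1 => H; apply: H.
by rewrite (hat_letter_at hf hv).
Qed.

(** Both cases have the form i i^*: p_v is the adjoint of i for the dual, and p of the dual is the
    adjoint of i_v by [hatK]. *)
Lemma jonesE k : (2 <= k)%N -> jones f v k = place (k - (k - 2)) 0 (jones_proj (k - 2)).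
Proof.
move=> k2; have [k' ->] : exists k', k = k'.+2 by exists (k - 2)%N; lia.
move: k' => {k2}k.
have -> : jones_proj (k.+2 - 2) = jones_proj k by congr jones_proj; lia.
rewrite /jones; congr (place _ 0 _); rewrite /jones_proj /rank_one; congr (_ *: _).
rewrite /letter_at /letter /= negbK /imx /pmx /imx.
by case: (odd k) => //=; rewrite (hatK hf hv).
Qed.

Local Notation inc := (@word_incl R m).
Local Notation MM := (fun i j => Lop (j - i)%N).
Local Notation up' n x := (@up R MM inc n _ _ x).
Local Notation jp' n k := (@jp R MM inc (jones f v) n k).
Local Notation A := (fun i j => (End (word_corep f v i j) : set (MM i j))).
Local Notation box' n i j := (@box R MM A inc n i j).

Lemma upE n i j (x : Lop (j - i)) : up' n x = place (n - 0) i x.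
Proof. exact: (congr1 (fun a => place (n - 0) a x) (subn0 i)). Qed.

Lemma jpE n k : (2 <= k <= n)%N -> jp' n k = place (n - 0) (k - 2) (jones_proj (k - 2)).
Proof.
move=> kn; rewrite /jp upE jonesE; last lia.
by rewrite place_place ?addn0 //; lia.
Qed.

Lemma A_word i j (x : Lop (j - i)) : End (word_corep f v i j) x <-> End (word (j - i) i) x.
Proof. by rewrite word_corepE. Qed.

Lemma tau_word i j x : qtrace f (word_corep f v i j) x =
  \tr (stens (j - i) (shiftn i weight_r) *m x).
Proof. by rewrite word_corepE (qtrace_word hh hf hv). Qed.

(** For i > j the convention that the box consists of scalars is the empty window at j, so the left
    end [minn i j] covers both cases; [word_expect] uses the same device. *)
Lemma boxE n i j z : (j <= n)%N -> box' n i j z <->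
  exists2 y : Lop (j - minn i j), End (word (j - minn i j) (minn i j)) y &
    z = place (n - 0) (minn i j) y.
Proof.
move=> jn; rewrite /box; case: leqP => ij.
  split=> [[x /A_word Hx <-]|[y Hy ->]]; first by exists x; rewrite ?upE.
  by exists y; [apply/A_word|rewrite upE].
have pl c : place (n - 0) j (c%:M : Lop (j - j)) = c%:M.
  rewrite -[c%:M]scalemx1 (linZ (@place_linear _ _ _ _ _)) place1 ?scalemx1 //; lia.
split=> [[c _ <-]|[y Hy ->]].
  exists (c%:M : Lop (j - j)); last by rewrite pl -scalemx1.
  by rewrite -[c%:M]scalemx1; apply: End_scale; exact: End1.
have [c ->] := Lop0_scalar y (subnn j).
by exists c => //; rewrite pl -scalemx1.
Qed.

Definition word_expect n i j (x : Lop (n - 0)) : Lop (n - 0) :=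
  expect weight_l weight_r (minn i j) j x.

Lemma word_expectE n i j x : (i <= j)%N -> @word_expect n i j x =
  expect weight_l weight_r i j x.
Proof. by move=> ij; rewrite /word_expect (minn_idPl ij). Qed.

Lemma mxtrace_sandwich n (D0 X c c' : 'M[C]_n) : c' *m D0 = D0 *m c' ->
  \tr (D0 *m D0 *m X *m (c *m c')) = \tr (D0 *m c' *m X *m c *m D0).
Proof.
move=> H; rewrite mulmxA mxtrace_mulC !mulmxA H -[D0 *m c' *m D0]mulmxA H.
by rewrite -!mulmxA mxtrace_mulC !mulmxA.
Qed.

(** The matrix of outer weights is the square of a self-adjoint [D0], built from Q, its inverse and
    a square root of 1/d. As [D0] commutes with operators in the window, the trace takes the form
    Tr(z^* z). *)
Lemma ptrace_pos i j n (x : 'M[C]_(widx n)) (c : Lop (j - i)) : (i <= j <= n)%N ->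
  0 <= \tr (ptrace weight_l weight_r i j (ctr x *m x) *m (c *m ctr c)).
Proof.
move=> ijn; rewrite ptrace_dual //.
pose s := sqrtC d^-1.
have s0 : 0 <= s by rewrite sqrtC_ge0 invr_ge0 ltW.
have sr : s^* = s by apply: conj_Creal; rewrite ger0_real.
have ss : s * s = d^-1 by rewrite -expr2 sqrtCK.
pose D0 := stens n (fun b => if (b < i)%N then s *: Fmx f (- 2^-1) (w b)
  else if (j <= b)%N then s *: Qmx f (w b) else 1%:M).
have -> : stens n (fun b => if (b < i)%N then weight_l b else if (j <= b)%N then weight_r b
  else 1%:M) = D0 *m D0.
  rewrite stens_mul; apply: eq_stens => b _; do ![case: ifP => _]; rewrite ?mulmx1 //.
    by rewrite -scalemxAl -scalemxAr scalerA ss (QmxN_sqr hf (wc b)).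
  by rewrite -scalemxAl -scalemxAr scalerA ss (Qmx_sqr hf (wc b)).
have D0h : ctr D0 = D0.
  rewrite ctr_st; apply: eq_stens => b _; do ![case: ifP => _]; rewrite ?ctr1 // ctr_scale sr.
    by rewrite (QmxN_ctr hf (wc b)).
  by rewrite (Qmx_ctr hf (wc b)).
have H : (i + (j - i) <= n)%N by lia.
have Dc : place n i (ctr c : Lop (j - i)) *m D0 = D0 *m place n i (ctr c : Lop (j - i)).
  by apply: place_st_comm => // b b1 b2; do ![case: ifP => ?]; first [by [] | exfalso; lia].
clearbody D0; rewrite placeM // (mxtrace_sandwich _ _ Dc).
pose z := x *m place n i c *m D0.
suff -> : D0 *m place n i (ctr c : Lop (j - i)) *m (ctr x *m x) *m place n i c *m D0 =
  ctr z *m z.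
  exact: mxtrace_ctr_mul_ge0.
by rewrite /z (ctr_mul (x *m _) D0) (ctr_mul x) D0h (ctr_place c H) !mulmxA.
Qed.

Lemma place_scalar p q a (c : C) : (a + p <= q)%N -> place q a (c%:M : Lop p) = c%:M.
Proof. by move=> apq;
  rewrite -[c%:M]scalemx1 (linZ (@place_linear _ _ _ _ _)) place1 ?scalemx1. Qed.

Lemma scalar_widx_inj n (a b : C) : a%:M = b%:M :> 'M[C]_(widx n) -> a = b.
Proof.
move=> /matrixP /(_ (Ordinal (widx_gt0 m n)) (Ordinal (widx_gt0 m n))).
by rewrite !mxE eqxx.
Qed.

Lemma word_expect_cond_exp n i j : (j <= n)%N ->
  cond_exp (qtrace f (word_corep f v 0 n) : Lop (n - 0) ->
    C) (A 0 n) (box' n i j) (@word_expect n i j).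
Proof.
move=> jn; have ijn : (minn i j <= j <= n - 0)%N by lia.
split.
- move=> x /A_word Hx; apply/boxE => //.
  exists (ptrace weight_l weight_r (minn i j) j x) => //.
  exact: (ptrace_End hf hv ijn Hx).
- by move=> k x y _ _; exact: expect_linear.
- move=> b /boxE [//|y Hy ->].
  by rewrite /word_expect /expect (ptrace_place (tr_weight_l hh hf hv) (tr_weight_r hh hf hv)).
- move=> b x b' /boxE [//|y Hy ->] _ /boxE [//|y' Hy' ->].
  exact: expect_bimod.
- move=> x /A_word Hx.
  pose b := ptrace weight_l weight_r (minn i j) j (ctr x *m x).
  have Hxx : End (word (n - 0) 0) (ctr x *m x).
    by apply: End_mul => //; apply: (End_ctr (word_unitary_corep hf hv _ _)).
  have Hb : End (word (j - minn i j) (minn i j)) b := ptrace_End hf hv ijn Hxx.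
  have bh : ctr b = b.
    by rewrite /b -(ptrace_ctr hf hv) // ctr_mul ctr_K.
  have bpos := fun c => ptrace_pos x c ijn.
  (* The root is taken in End of the window before placing it, so that it belongs to the box. *)
  have [y Hy bE] := psd_sqrt_End bh bpos Hb.
  exists (place (n - 0) (minn i j) (y : Lop (j - minn i j))).
    by apply/boxE => //; exists y.
  have H : (minn i j + (j - minn i j) <= n - 0)%N by lia.
  have E : place (n - 0) (minn i j) (b : Lop (j - minn i j)) =
      ctr (place (n - 0) (minn i j) (y : Lop (j - minn i j))) *m place (n - 0) (minn i j) y.
    by rewrite ctr_place // -placeM // -bE.
  exact: E.
(* Both traces are the scalar of the slice of [x] onto the empty window at [minn i j]. *)
- move=> x /A_word Hx; rewrite !tau_word; apply: (@scalar_widx_inj (n - 0)).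
  rewrite -(expect_diag_End hh hf hv (r := minn i j) _ Hx); last lia.
  by rewrite (expect_trace weight_l (tr_weight_r hh hf hv) x ijn).
Qed.

Lemma qtrace_linear n (u : 'M[G]_n) (k : C) x y :
  qtrace f u (k *: x + y) = k * qtrace f u x + qtrace f u y.
Proof. by rewrite /qtrace mulmxDr -scalemxAr mxtraceD mxtraceZ mulrDr mulrCA. Qed.

Lemma qtrace1 n (u : 'M[G]_n) : unitary_corep u -> (0 < n)%N -> qtrace f u 1%:M = 1.
Proof.
move=> hu n0; have d1 := qdim_gt0 hf hu n0.
by rewrite (qtraceE hf hu) mulmx1 -(qdimE hf hu) mulVf // gt_eqF.
Qed.

Lemma qtrace_ge0 n (u : 'M[G]_n) (x : 'M[C]_n) : unitary_corep u -> (0 < n)%N ->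
  0 <= qtrace f u (ctr x *m x).
Proof.
move=> hu n0; have d1 := qdim_gt0 hf hu n0.
by rewrite (qtraceE hf hu) mulr_ge0 ?invr_ge0 ?(ltW d1) //; exact: (mxtrace_Q_ge0 hf hu x).
Qed.

Lemma qtrace_eq0 n (u : 'M[G]_n) (x : 'M[C]_n) : unitary_corep u -> (0 < n)%N ->
  qtrace f u (ctr x *m x) = 0 -> x = 0.
Proof.
move=> hu n0; have d1 := qdim_gt0 hf hu n0.
rewrite (qtraceE hf hu) => /eqP; rewrite mulf_eq0 invr_eq0 gt_eqF //= => /eqP.
exact: (mxtrace_Q_eq0 hf hu).
Qed.

(** For disjoint intervals the composite is the slice onto an empty window at k or at l, in general
    not at the required [minn j l]; on End of the word all of these equal tau(x) 1. *)
Lemma word_expect_square n i j k l x : (i <= j <= n)%N -> (k <= l <= n)%N ->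
  End (word (n - 0) 0) x ->
  word_expect i j (@word_expect n k l x) = word_expect (maxn i k) (minn j l) x.
Proof.
move=> ijn kln Hx; have trl := tr_weight_l hh hf hv; have trr := tr_weight_r hh hf hv.
have ijn' : (i <= j <= n - 0)%N by lia.
have kln' : (k <= l <= n - 0)%N by lia.
rewrite (@word_expectE n k l x) ?(@word_expectE n i j); [|lia|lia].
have [H|H] := boolP (maxn i k <= minn j l)%N.
  rewrite word_expectE //; apply: (expect_comp trl trr x ijn' kln'); first lia.
  exact: Or31.
rewrite /word_expect; have -> : minn (maxn i k) (minn j l) = minn j l by lia.
have diag r : (r <= n - 0)%N -> expect weight_l weight_r r r x =
  (\tr (stens (n - 0) weight_r *m x))%:M.
  by move=> rn; exact: (expect_diag_End hh hf hv rn Hx).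
have [jk|li] : (j <= k)%N \/ (l <= i)%N by lia.
  rewrite (expect_comp trl trr (r := k) (s := k) x ijn' kln'); first by rewrite !diag //; lia.
    by lia.
  by apply: Or32.
rewrite (expect_comp trl trr (r := l) (s := l) x ijn' kln'); first by rewrite !diag //; lia.
  by lia.
by apply: Or33.
Qed.

Theorem popa_axioms_words : popa_axioms (qdim f v ^- 2) (M := MM) A inc
  (fun i j => qtrace f (word_corep f v i j)) (jones f v) word_expect.
Proof.
have trl := tr_weight_l hh hf hv; have trr := tr_weight_r hh hf hv.
have wcw i j : unitary_corep (word_corep f v i j).
  by rewrite word_corepE; exact: (word_unitary_corep hf hv).
split.
- by rewrite invr_gt0 exprn_gt0.
- by move=> i j _; exact: End_fd_cstar.
- by move=> i x _; have [c ->] := Lop0_scalar x (subnn i); exists c; rewrite -scalemx1.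
- move=> i j k l kij jl; have H : (i - k + (j - i) <= l - k)%N by lia.
  split.
  + move=> x /A_word Hx; apply/A_word; rewrite /word /word_incl.
    apply: place_End => //; move: Hx; congr (End _ _); apply: eq_stens => b _.
    by rewrite /shiftn; congr w; lia.
  + split.
    * by move=> c x y _ _; exact: place_linear.
    * exact: place1.
    * by move=> x y _ _; exact: placeM.
    * by move=> x _; apply: esym; exact: ctr_place.
  + by move=> x y _ _; exact: place_inj.
- move=> i j x _ _; rewrite /word_incl subnn; exact: place_id.
- move=> i j k l p q x pk kij jlq _; rewrite /word_incl place_place; [|lia|lia].
  by rewrite (_ : (k - p + (i - k) = i - p)%N) //; lia.
- by move=> i j k x y _ _ _; exact: qtrace_linear.
- by move=> i j _; exact: (qtrace1 (wcw i j) (widx_gt0 m _)).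
- by move=> i j x y _ Hx _; exact: (qtraceM hf (wcw i j) y Hx).
- by move=> i j x _ _; exact: (qtrace_ge0 _ (wcw i j) (widx_gt0 m _)).
- by move=> i j x _ _; exact: (qtrace_eq0 (wcw i j) (widx_gt0 m _)).
- move=> i j k l x kij jl _; rewrite !tau_word /word_incl mxtrace_place; [|lia|by move=> b;
  exact: trr].
  have -> : stens (j - i) (shiftn (i - k) (shiftn k weight_r)) =
    stens (j - i) (shiftn i weight_r).
    by apply: eq_stens => b _; apply: (congr1 weight_r); lia.
  by [].
- move=> k k2; rewrite jonesE //; split.
  + by rewrite -[_ * _]/(_ *m _) -placeM ?jones_proj_idem //; lia.
  + by rewrite -[star _]/(ctr _) ctr_place ?jones_proj_herm //; lia.
- exact: word_expect_cond_exp.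
- move=> n i j k l x ijn kln /A_word Hx; split; first exact: word_expect_square.
  by rewrite maxnC minnC; exact: word_expect_square.
- move=> n k kn; rewrite !jpE; [|lia|lia].
  rewrite (_ : (k.+1 - 2 = (k - 2).+1)%N); last lia.
  have bn : ((k - 2).+3 <= n - 0)%N by lia.
  (* Each triple product is the compression of the middle projection, hence its expectation times
     the outer projection. The target window cuts between the two letters of the middle projection,
     so the expectation is the slice with value lambda. *)
  move: (k - 2)%N bn => b bn; split.
    have H := @jones_compress_l _ _ _ _ trl trr b _ (n - 0) 2 (jones_proj b.+1)
      (jones_proj_compress1 b) (ltn0Sn 1).
    apply: (etrans (H _)); first lia.
    rewrite expect_straddle_l //; [|lia|lia].
    by rewrite jones_proj_ptl place_scalar ?mul_scalar_mx //; lia.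
  have H := @jones_compress_r _ _ _ _ trl trr b.+1 _ (n - 0) b 2 (jones_proj b)
    (jones_proj_compress0 b.+1) (leqnSn b) (addn2 b).
  apply: (etrans (H _)); first lia.
  rewrite expect_straddle_r //; last lia.
  by rewrite jones_proj_ptr place_scalar ?mul_scalar_mx //; lia.
- move=> n k l k2 kl; rewrite !jpE; [|lia|lia].
  by apply: place_comm; lia.
- move=> i j k ij jk; apply/A_word; rewrite jonesE; last lia.
  rewrite /word_incl place_place; [|lia|lia].
  apply: place_End; first lia.
  have := jones_proj_End (j - 2); congr (End _ _); apply: eq_stens => b _.
  by rewrite /shiftn; congr w; lia.
- move=> n i j x ijn _; rewrite !upE jpE; last lia.
  rewrite word_expectE; last lia.
  (* Counting letters from 0, e_(j+1) acts on j - 1 and j, and j - 1 is the last letter of [x]. *)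
  rewrite (_ : (j.+1 - 2 = j.-1)%N); last lia.
  apply: (jones_compress_r trl trr x (jones_proj_compress0 j.-1)); lia.
- move=> n i j x ij jn _; rewrite !upE jpE; last lia.
  rewrite word_expectE; last lia.
  (* After the shift, e_(i+2) acts on the letters i and i + 1, and i + 1 is the first letter of
     [x]. *)
  case: i ij x => [//|i] ij x.
  rewrite (_ : (i.+2 - 2 = i)%N); last lia.
  have := @jones_compress_l _ _ _ _ trl trr i _ (n - 0) _ x (jones_proj_compress1 i).
  rewrite subnKC; last lia.
  by apply; lia.
- move=> n i j x ij jn _; rewrite !upE jpE; last lia.
  rewrite word_expectE; last lia.
  rewrite (_ : (j + 2 - 2 = j)%N); last lia.
  have H := @markov_r _ _ _ _ trl trr j _ _ (n - 0) i _ x (jones_proj_transfer1 j)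
    (jones_proj_ptr j) ij.
  transitivity ((d ^- 2)^-1 *: (d ^- 2 *: (place (n - 0) i x *m
    place (n - 0) j (jones_proj j)))).
    by congr (_ *: _); apply: H; lia.
  by rewrite scalerA mulVf ?scale1r // invr_eq0 expf_neq0 // gt_eqF.
- move=> n i j x ij _; rewrite !upE jpE; last lia.
  rewrite word_expectE; last lia.
  rewrite (_ : (i + 2 - 2 = i)%N); last lia.
  have H := @markov_l _ _ _ _ trl trr i _ _ (n - 0) _ x (jones_proj_transfer0 i)
    (jones_proj_ptl i).
  rewrite subnKC in H; last lia.
  transitivity ((d ^- 2)^-1 *: (d ^- 2 *: (place (n - 0) i x *m
    place (n - 0) i (jones_proj i)))).
    by congr (_ *: _); apply: H; lia.
  by rewrite scalerA mulVf ?scale1r // invr_eq0 expf_neq0 // gt_eqF.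
- move=> n i j k l x y ij jk kl _ _; rewrite !upE.
  by apply: place_comm; lia.
Qed.
End PopaSystem.

Local Open Scope complex_scope.

Theorem theoremA (R : realType) (G : woronowicz R)
    (h : G -> R[i]) (hh : haar_state h)
    (f : R[i] -> G -> R[i]) (hf : canonical_characters h f)
    (m : nat) (v : 'M[G]_m.+1) (hv : unitary_corep v) :
  popa_system (qdim f v ^- 2)
    (M := fun i j => Lop R m (j - i)%N)
    (fun i j => End (word_corep f v i j))
    (@word_incl R m)
    (fun i j => qtrace f (word_corep f v i j))
    (jones f v).
Proof. by exists (@word_expect R G f m v); exact: (popa_axioms_words hh hf hv). Qed.
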